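(* Let $\mathcal D$ denote either of the graph complexes $\mathcal D_o$, $\mathcal D_e$ of graphs on an oriented circle, with coboundary operator $\delta$, shuffle product $\bullet$ and grading $|\cdot|$. Then for every $\Gamma_1,\Gamma_2\in\mathcal D$ $$\delta(\Gamma_1\bullet\Gamma_2)=\delta(\Gamma_1)\bullet\Gamma_2+(-1)^{|\Gamma_1|}\,\Gamma_1\bullet\delta(\Gamma_2).$$
   Context: **Graphs.** A graph consists of an oriented circle and edges joining vertices. Vertices lying on the circle are called external; those lying off the circle are called internal and are required to be at least trivalent. With $e$, $v_i$, $v_e$ the numbers of edges, internal vertices and external vertices, the order is $k=e-v_i\ge 0$ and the degree is $m=2e-v_e-3v_i\ge0$. An arc is a piece of the oriented circle between two consecutive vertices; a regular edge is an edge with at least one internal end-point. **Decorations and relations.** $\mathcal D_o^{k,m}$ is the real vector space generated by graphs of order $k$ and degree $m$ decorated by numbering all the vertices (first the external ones, then the internal ones) and orienting the edges, modulo the relations: a cyclic permutation of the external vertices or a permutation of the internal vertices multiplies the graph by the sign of the permutation; reversing the orientation of an edge produces a minus sign. Edges connecting an external vertex to itself carry in addition an ordering of their two half-edges. $\mathcal D_e^{k,m}$ is generated by graphs decorated by numbering the external vertices and numbering the edges, modulo: a cyclic permutation of the external vertices or a permutation of the edges multiplies the graph by the sign of the permutation. In both cases one also quotients by the subspace generated by graphs containing two edges joining the same pair of vertices and graphs containing an edge whose end-points are the same internal vertex. $\mathcal D=\bigoplus_{k,m}\mathcal D^{k,m}$ in each case. **Coboundary.** $\delta\colon\mathcal D^{k,m}\to\mathcal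 D^{k,m+1}$ sends $\Gamma$ to the signed sum of all graphs obtained from $\Gamma$ by contracting, one at a time, all the regular edges and arcs. Contracting an arc or edge connecting vertex $i$ with vertex $j$ and oriented from $i$ to $j$ has sign $(-1)^j$ if $j>i$ and $(-1)^{i+1}$ if $j<i$; contracting an edge labeled by $\alpha$ has sign $(-1)^{\alpha+1+v_e}$. Contracting the edge between $i$ and $j$ produces a vertex labeled $\min(i,j)$, and vertex labels greater than $\max(i,j)$ are rescaled by one; when the edge labeled $\alpha$ is collapsed, edge labels greater than $\alpha$ are rescaled by one. **Grading.** $|\Gamma|=e(\Gamma)+v_e(\Gamma)$ in the even case and $|\Gamma|=v(\Gamma)$, the total number of vertices, in the odd case. **Shuffle product.** For graphs $\Gamma_1,\Gamma_2$ with (cyclically ordered) sets of external vertices $V_e^1,V_e^2$, a $(V_e^1,V_e^2)$-shuffle is a permutation $\sigma$ of $V_e^1\cup V_e^2$ respecting the cyclic orders of $V_e^1$ and $V_e^2$; $\Gamma_1\bullet_\sigma\Gamma_2$ is the graph obtained by placing the legs of $\Gamma_1$ and $\Gamma_2$ into distinct external vertices on one oriented circle according to $\sigma$. Vertices and edges coming from $\Gamma_1$ keep their labels; to vertex (edge) labels of $\Gamma_2$ one adds the number of labeled vertices (the number of edges) of $\Gamma_1$; unlabeled items stay unlabeled. Then $\Gamma_1\bullet\Gamma_2=(-1)^{\lambda(\Gamma_1,\Gamma_2)}\sum_\sigma\Gamma_1\bullet_\sigma\Gamma_2$, summed over all shuffles and extended linearly, with $\lambda(\Gamma_1,\Gamma_2)=v_e(\Gamma_2)\,e(\Gamma_1)$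 in the even case and $0$ in the odd case. *)

(* Defs.v *)
From HB Require Import structures.
From mathcomp Require Import all_boot fingroup perm all_algebra generic_quotient.
From mathcomp Require Import finmap monalg.
From mathcomp Require Import boolp reals.

Set Implicit Arguments.
Unset Strict Implicit.
Unset Printing Implicit Defensive.

Import GRing.Theory.

Definition perm_nat n (s : 'S_n) (k : nat) : nat :=
  if insub k is Some i then val (s i) else k.

(* Labels are numbered from 0; [contraction_sign] is the exponent of the
   contraction sign for the labels [i.+1], [j.+1] counted from 1. *)
Definition contraction_sign (i j : nat) : nat := if i < j then j.+1 else i.+2.

Definition collapse (i j k : nat) : nat :=
  if k == maxn i j then minn i j else if maxn i j < k then k.-1 else k.

(* A circle is the sequence of the labels of its external vertices, read along
   the orientation from an arbitrary starting point. *)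
Definition arcs (c : seq nat) : seq (nat * nat) :=
  if 1 < size c then [seq (v, next c v) | v <- c] else [::].

Definition contract_circle (i j : nat) (c : seq nat) : seq nat :=
  [seq collapse i j v | v <- rem j c].

Definition is_rotation (c w : seq nat) : bool :=
  w \in [seq rot k c | k <- iota 0 (size c).+1].

(* The cyclic orders on the disjoint union of [c1] and [c2] inducing the given
   cyclic orders on [c1] and [c2], each listed once: it is cut open at the first
   vertex of [c1 ++ c2]. *)
Definition cyclic_shuffles (c1 c2 : seq nat) : seq (seq nat) :=
  [seq w <- permutations (c1 ++ c2) |
     [&& ohead w == ohead (c1 ++ c2),
         is_rotation c1 [seq v <- w | v \in c1]
       & is_rotation c2 [seq v <- w | v \in c2]]].

(* [orev] is meaningful only for an edge connecting an external vertex to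
   itself: it tells whether the orientation of the edge disagrees with the order
   of its two half-edges. *)
Record oedge := OEdge { osrc : nat; otgt : nat; orev : bool }.
Definition oedge_code e := (osrc e, otgt e, orev e).
Definition oedge_decode x := OEdge x.1.1 x.1.2 x.2.
Fact oedge_codeK : cancel oedge_code oedge_decode. Proof. by case. Qed.
HB.instance Definition _ := Choice.copy oedge (can_type oedge_codeK).

(* Vertices are numbered by [0 .. onum - 1]; those on [ocirc] are external. The
   numbering is arbitrary: the shuffle product does not number external vertices
   first, nor along the circle. Among the numberings that do so, two of the same
   graph differ by a cyclic permutation of the external vertices and a
   permutation of the internal ones. *)
Record opregraph :=
  OPreGraph { onum : nat; ocirc : seq nat; oedges : seq oedge }.
Definition opregraph_code G := (onum G, ocirc G, oedges G).
Definition opregraph_decode x := OPreGraph x.1.1 x.1.2 x.2.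
Fact opregraph_codeK : cancel opregraph_code opregraph_decode.
Proof. by case. Qed.
HB.instance Definition _ := Choice.copy opregraph (can_type opregraph_codeK).

Definition oends (v : nat) (e : oedge) : nat := (osrc e == v) + (otgt e == v).
Definition ovalence (E : seq oedge) (v : nat) : nat := \sum_(e <- E) oends v e.

(* Edges join vertices, so an external vertex has at least one edge; this is also
   what makes the degree [2 e - v_e - 3 v_i] nonnegative. *)
Definition owf (G : opregraph) : bool :=
  let: OPreGraph n c E := G in
  [&& uniq c, all (fun v => v < n) c,
      all (fun e => (osrc e < n) && (otgt e < n)) E,
      all (fun e => orev e ==> (osrc e == otgt e) && (osrc e \in c)) E
    & all (fun v => (if v \in c then 1 else 3) <= ovalence E v) (iota 0 n)].

Record ograph := OGraph { ograph_val :> opregraph; _ : owf ograph_val }.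
HB.instance Definition _ := [isSub for ograph_val].
HB.instance Definition _ := [Choice of ograph by <:].

Definition osame_ends (e f : oedge) : bool :=
  ((osrc e == osrc f) && (otgt e == otgt f)) ||
  ((osrc e == otgt f) && (otgt e == osrc f)).

(* Two edges connecting the same external vertex to itself join the same pair of
   vertices. *)
Definition oadmissible (G : opregraph) : bool :=
  pairwise (fun e f => ~~ osame_ends e f) (oedges G) &&
  all (fun e => (osrc e == otgt e) ==> (osrc e \in ocirc G)) (oedges G).

Definition oregular (c : seq nat) (e : oedge) : bool :=
  ~~ ((osrc e \in c) && (otgt e \in c)).

Definition orenumber (f : nat -> nat) (G : opregraph) : opregraph :=
  OPreGraph (onum G) [seq f v | v <- ocirc G]
    [seq OEdge (f (osrc e)) (f (otgt e)) (orev e) | e <- oedges G].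

Definition oreverse (c : seq nat) (e : oedge) : oedge :=
  OEdge (otgt e) (osrc e)
    (if (osrc e == otgt e) && (osrc e \in c) then ~~ orev e else orev e).

Definition odegree (G : opregraph) : nat := onum G.

(* On an arc from [i] to [j] the half-edge at [i] comes first, which orders the
   half-edges of an edge joining [i] and [j] when the arc is contracted. *)
Definition ocontract_arc (i j : nat) (G : opregraph) : opregraph :=
  OPreGraph (onum G).-1 (contract_circle i j (ocirc G))
    [seq OEdge (collapse i j (osrc e)) (collapse i j (otgt e))
           (orev e || (osrc e == j) && (otgt e == i)) | e <- oedges G].

Definition ocontract_edge (e0 : oedge) (G : opregraph) : opregraph :=
  let f := collapse (osrc e0) (otgt e0) in
  OPreGraph (onum G).-1 [seq f v | v <- ocirc G]
    [seq OEdge (f (osrc e)) (f (otgt e)) (orev e) | e <- rem e0 (oedges G)].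

Definition ojoin (G1 G2 : opregraph) (w : seq nat) : opregraph :=
  let n := onum G1 in
  OPreGraph (n + onum G2) w
    (oedges G1 ++
     [seq OEdge (n + osrc e) (n + otgt e) (orev e) | e <- oedges G2]).

Definition oshuffles (G1 G2 : opregraph) : seq (seq nat) :=
  cyclic_shuffles (ocirc G1) [seq onum G1 + v | v <- ocirc G2].

(* [inl k] is the external vertex labeled [k]; as in the odd case, its label need
   not follow the order of the circle. Internal vertices carry no label
   in the even case: the index [k] of [inr k] is a mere name. *)
Definition evertex := (nat + nat)%type.
Definition eedge := (evertex * evertex)%type.

Definition is_external (v : evertex) : bool := if v is inl _ then true else false.

(* [eedges] lists the edges in the order of their labels. *)
Record epregraph :=
  EPreGraph { ecirc : seq nat; eint : nat; eedges : seq eedge }.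
Definition epregraph_code G := (ecirc G, eint G, eedges G).
Definition epregraph_decode x := EPreGraph x.1.1 x.1.2 x.2.
Fact epregraph_codeK : cancel epregraph_code epregraph_decode.
Proof. by case. Qed.
HB.instance Definition _ := Choice.copy epregraph (can_type epregraph_codeK).

Definition eends (v : evertex) (e : eedge) : nat := (e.1 == v) + (e.2 == v).
Definition evalence (E : seq eedge) (v : evertex) : nat :=
  \sum_(e <- E) eends v e.

Definition evalid (p r : nat) (v : evertex) : bool :=
  match v with inl k => k < p | inr k => k < r end.

Definition ewf (G : epregraph) : bool :=
  let: EPreGraph c r E := G in
  [&& perm_eq c (iota 0 (size c)),
      all (fun e => evalid (size c) r e.1 && evalid (size c) r e.2) E,
      all (fun k => 1 <= evalence E (inl k)) (iota 0 (size c))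
    & all (fun k => 3 <= evalence E (inr k)) (iota 0 r)].

Record egraph := EGraph { egraph_val :> epregraph; _ : ewf egraph_val }.
HB.instance Definition _ := [isSub for egraph_val].
HB.instance Definition _ := [Choice of egraph by <:].

Definition esame_ends (e f : eedge) : bool := (e == f) || (e == (f.2, f.1)).

Definition eadmissible (G : epregraph) : bool :=
  pairwise (fun e f => ~~ esame_ends e f) (eedges G) &&
  all (fun e => (e.1 == e.2) ==> is_external e.1) (eedges G).

Definition eregular (e : eedge) : bool := ~~ (is_external e.1 && is_external e.2).

Definition vertex_map (f g : nat -> nat) (v : evertex) : evertex :=
  match v with inl k => inl (f k) | inr k => inr (g k) end.

Definition eedge_map (h : evertex -> evertex) (e : eedge) : eedge :=
  (h e.1, h e.2).

Definition erenumber (f : nat -> nat) (G : epregraph) : epregraph :=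
  EPreGraph [seq f v | v <- ecirc G] (eint G)
    [seq eedge_map (vertex_map f id) e | e <- eedges G].

(* Only a totalizing value for [nth]. *)
Definition edefault : eedge := (inl 0, inl 0).

Definition edegree (G : epregraph) : nat := size (eedges G) + size (ecirc G).

Definition econtract_arc (i j : nat) (G : epregraph) : epregraph :=
  EPreGraph (contract_circle i j (ecirc G)) (eint G)
    [seq eedge_map (vertex_map (collapse i j) id) e | e <- eedges G].

Definition identify (u v x : evertex) : evertex :=
  match u, v with
  | inl i, inr k | inr k, inl i =>
      if x == inr k then inl i
      else vertex_map id (fun l => if k < l then l.-1 else l) x
  | inr k, inr l => vertex_map id (collapse k l) x
  | inl _, inl _ => x
  end.

Definition econtract_edge (a : nat) (G : epregraph) : epregraph :=
  let: (u, v) := nth edefault (eedges G) a in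
  EPreGraph (ecirc G) (eint G).-1
    [seq eedge_map (identify u v) e
       | e <- take a (eedges G) ++ drop a.+1 (eedges G)].

Definition ejoin (G1 G2 : epregraph) (w : seq nat) : epregraph :=
  let shift := vertex_map (addn (size (ecirc G1))) (addn (eint G1)) in
  EPreGraph w (eint G1 + eint G2)
    (eedges G1 ++ [seq eedge_map shift e | e <- eedges G2]).

Definition eshuffles (G1 G2 : epregraph) : seq (seq nat) :=
  cyclic_shuffles (ecirc G1) [seq size (ecirc G1) + v | v <- ecirc G2].

Definition elambda (G1 G2 : epregraph) : nat :=
  size (ecirc G2) * size (eedges G1).

Local Open Scope ring_scope.
Local Open Scope quotient_scope.

Inductive span (R : pzRingType) (V : lmodType R) (B : V -> Prop) : V -> Prop :=
| span_zero : span B 0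
| span_cons a u v : B u -> span B v -> span B (a *: u + v).

Section QuotientModule.
Variables (R : pzRingType) (V : lmodType R) (B : V -> Prop).

Definition in_span : {pred V} := fun v => `[< span B v >].

Lemma span_lin a u v : span B u -> span B v -> span B (a *: u + v).
Proof.
move=> Bu Bv; elim: Bu => [|b w z Bw _ IH]; first by rewrite scaler0 add0r.
by rewrite scalerDr scalerA -addrA; apply: span_cons.
Qed.

Lemma in_span_zmod : zmod_closed in_span.
Proof.
split; first by apply/asboolP; exact: span_zero.
move=> u v /asboolP Bu /asboolP Bv; apply/asboolP.
by rewrite addrC -scaleN1r; apply: span_lin.
Qed.

HB.instance Definition _ := GRing.isZmodClosed.Build V in_span in_span_zmod.

Definition quotmod := Quotient.quot in_span.
HB.instance Definition _ := GRing.Zmodule.on quotmod.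
HB.instance Definition _ := Quotient.on quotmod.

Definition qclass (v : V) : quotmod := \pi_quotmod v.

Lemma qclass_eq u v : qclass u = qclass v <-> span B (u - v).
Proof.
split=> [/eqP|Buv]; first by rewrite -Quotient.idealrBE => /asboolP.
by apply/eqP; rewrite -Quotient.idealrBE; apply/asboolP.
Qed.

Lemma qclassD : {morph qclass : u v / u + v}.
Proof. by move=> u v; rewrite /qclass !piE. Qed.
Lemma qclassK x : qclass (repr x) = x. Proof. exact: reprK. Qed.

Definition qscale a (x : quotmod) : quotmod := qclass (a *: repr x).

Lemma qscaleE a v : qscale a (qclass v) = qclass (a *: v).
Proof.
apply/qclass_eq; rewrite -scalerBr -[_ *: _]addr0.
apply: span_lin; last exact: span_zero.
by apply/qclass_eq; rewrite qclassK.
Qed.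

Fact qscaleA a b x : qscale a (qscale b x) = qscale (a * b) x.
Proof. by rewrite -[x]qclassK !qscaleE scalerA. Qed.
Fact qscale1 : left_id 1 qscale.
Proof. by move=> x; rewrite -[x]qclassK qscaleE scale1r. Qed.
Fact qscaleDr : right_distributive qscale +%R.
Proof.
move=> a x y; rewrite -[x]qclassK -[y]qclassK -qclassD !qscaleE -qclassD.
by rewrite scalerDr.
Qed.
Fact qscaleDl x : {morph qscale^~ x : a b / a + b}.
Proof. by move=> a b; rewrite -[x]qclassK !qscaleE -qclassD scalerDl. Qed.

HB.instance Definition _ :=
  GRing.Zmodule_isLmodule.Build R quotmod qscaleA qscale1 qscaleDr qscaleDl.

Fact qclass_linear : linear qclass.
Proof. by move=> a u v; rewrite qclassD -qscaleE. Qed.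
HB.instance Definition _ :=
  GRing.isLinear.Build R V quotmod *:%R qclass qclass_linear.

End QuotientModule.

Section LinearExtension.
Variables (R : nzRingType) (T : choiceType).

Definition lext (M : lmodType R) (f : T -> M) (x : {malg R[T]}) : M :=
  \sum_(k <- msupp x) x@_k *: f k.

Variable B : {malg R[T]} -> Prop.

(* Meant for maps [f] compatible with the relations [B]: the result is then
   independent of the representative. *)
Definition qext (M : lmodType R) (f : T -> M) (x : quotmod B) : M :=
  lext f (repr x).

(* Classes of combinations of generators of degree [p]. *)
Definition homogeneous (deg : T -> nat) (p : nat) (x : quotmod B) : Prop :=
  exists2 c : {malg R[T]}, {in msupp c, forall k, deg k = p} & x = qclass B c.

End LinearExtension.

Section OddComplex.
Variable R : realType.

Local Notation "[[ G ]]" := (<< G >> : {malg R[ograph]}).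

Inductive orel : {malg R[ograph]} -> Prop :=
| orel_same (G H : ograph) k :
    onum H = onum G -> ocirc H = rot k (ocirc G) ->
    perm_eq (oedges H) (oedges G) -> orel ([[H]] - [[G]])
| orel_renumber (G H : ograph) (s : 'S_(onum G)) :
    H = orenumber (perm_nat s) G :> opregraph ->
    orel ([[H]] - (-1) ^+ s *: [[G]])
| orel_reverse (G H : ograph) E1 e E2 :
    oedges G = E1 ++ e :: E2 ->
    H = OPreGraph (onum G) (ocirc G) (E1 ++ oreverse (ocirc G) e :: E2)
      :> opregraph ->
    orel ([[H]] + [[G]])
| orel_inadmissible (G : ograph) : ~~ oadmissible G -> orel [[G]].

(* Every graph has order and degree at least 0, so that the sum of the complexes
   of all orders and degrees is spanned by all graphs. *)
Definition oD : lmodType R := quotmod orel.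

(* The value 0 is never used below: contractions and shuffle products of graphs
   are graphs. *)
Definition oclass (P : opregraph) : oD :=
  if insub P is Some G then qclass orel [[G]] else 0.

(* An inadmissible graph is 0 in the complex, hence its coboundary is 0; the sum
   of its contractions need not be: contracting one of two parallel edges joining
   an external and an internal vertex turns the other into an admissible edge
   from the external vertex to itself. *)
Definition odelta_graph (G : opregraph) : oD :=
  if oadmissible G then
    \sum_(a <- arcs (ocirc G))
       (-1) ^+ contraction_sign a.1 a.2 *: oclass (ocontract_arc a.1 a.2 G) +
    \sum_(e <- oedges G | oregular (ocirc G) e)
       (-1) ^+ contraction_sign (osrc e) (otgt e) *: oclass (ocontract_edge e G)
  else 0.

Definition oshuffle_graph (G1 G2 : opregraph) : oD :=
  \sum_(w <- oshuffles G1 G2) oclass (ojoin G1 G2 w).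

Definition odelta (x : oD) : oD := qext (fun G : ograph => odelta_graph G) x.

Definition oshuffle (x y : oD) : oD :=
  qext (fun G1 : ograph => qext (fun G2 : ograph => oshuffle_graph G1 G2) y) x.

Definition ohomogeneous (p : nat) (x : oD) : Prop :=
  homogeneous (fun G : ograph => odegree G) p x.

End OddComplex.

Section EvenComplex.
Variable R : realType.

Local Notation "[[ G ]]" := (<< G >> : {malg R[egraph]}).

Inductive erel : {malg R[egraph]} -> Prop :=
| erel_same (G H : egraph) k (s : 'S_(eint G)) :
    eint H = eint G -> ecirc H = rot k (ecirc G) ->
    all2 esame_ends (eedges H)
      [seq eedge_map (vertex_map id (perm_nat s)) e | e <- eedges G] ->
    erel ([[H]] - [[G]])
| erel_renumber (G H : egraph) (s : 'S_(size (ecirc G))) :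
    H = erenumber (perm_nat s) G :> epregraph ->
    erel ([[H]] - (-1) ^+ s *: [[G]])
| erel_edges (G H : egraph) (s : 'S_(size (eedges G))) :
    ecirc H = ecirc G -> eint H = eint G ->
    size (eedges H) = size (eedges G) ->
    (forall i, nth edefault (eedges H) (s i) = nth edefault (eedges G) i) ->
    erel ([[H]] - (-1) ^+ s *: [[G]])
| erel_inadmissible (G : egraph) : ~~ eadmissible G -> erel [[G]].

Definition eD : lmodType R := quotmod erel.

Definition eclass (P : epregraph) : eD :=
  if insub P is Some G then qclass erel [[G]] else 0.

Definition edelta_graph (G : epregraph) : eD :=
  if eadmissible G then
    \sum_(a <- arcs (ecirc G))
       (-1) ^+ contraction_sign a.1 a.2 *: eclass (econtract_arc a.1 a.2 G) +
    \sum_(0 <= a < size (eedges G) | eregular (nth edefault (eedges G) a))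
       (-1) ^+ (a.+1 + 1 + size (ecirc G)) *: eclass (econtract_edge a G)
  else 0.

Definition eshuffle_graph (G1 G2 : epregraph) : eD :=
  (-1) ^+ elambda G1 G2 *: \sum_(w <- eshuffles G1 G2) eclass (ejoin G1 G2 w).

Definition edelta (x : eD) : eD := qext (fun G : egraph => edelta_graph G) x.

Definition eshuffle (x y : eD) : eD :=
  qext (fun G1 : egraph => qext (fun G2 : egraph => eshuffle_graph G1 G2) y) x.

Definition ehomogeneous (p : nat) (x : eD) : Prop :=
  homogeneous (fun G : egraph => edegree G) p x.

End EvenComplex.

(* Main.v *)
(* By bilinearity it suffices to treat two graphs [G1] and [G2], once the coboundary
   and the shuffle product are known to be compatible with the relations.  In the
   coboundary of a shuffle, contracting a regular edge commutes with shuffling.  An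
   arc of the joint circle either joins vertices of the same factor, and then it is
   an arc of that factor whose contraction commutes with shuffling, or joins a
   vertex [i] of one factor to a vertex [j] of the other.  In the latter case
   exchanging [i] and [j] gives another shuffle with the opposite arc, the same
   contraction and the opposite sign, so that these terms cancel in pairs.

   Compatibility with renumberings only has to be checked on a transposition of
   consecutive labels, where the sign of a contraction changes exactly when no
   transposition of labels survives in the contracted graph. *)

Require Import Defs.
From HB Require Import structures.
From mathcomp Require Import all_boot fingroup perm all_algebra generic_quotient.
From mathcomp Require Import finmap monalg boolp reals zify.

Set Implicit Arguments.
Unset Strict Implicit.
Unset Printing Implicit Defensive.

Import Defs GRing.Theory.

(** * Cyclic shuffles and their arcs *)

(** A cyclic order is stored as a word cut open at one vertex, and contracting an arc may remove
    that very vertex. The sums are therefore moved to words with an arbitrary cut, for functions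
    invariant under rotation: any arc can then be brought to the front, where contracting it deletes
    the second letter and relabels the others.

    Raw graphs that are not well formed have class 0, and the coboundary is set to 0 on inadmissible
    graphs. Hence contractions must be shown to be well formed before their classes are multiplied,
    and inadmissible factors are treated apart.

    The sign [(-1)^|G1|] arises from the labels of the second factor. In the odd case they are
    shifted by the number of vertices of the first. In the even case an arc of the second factor
    picks up [v_e(G1)] from the shift of its labels and [e(G1)] from the change of [elambda],
    whereas an edge picks up [e(G1)] from the shift of its label and [v_e(G1)] from the number of
    external vertices in its sign. *)

Lemma big_seq_bij (V : nmodType) (I J : eqType) (r : seq I) (s : seq J)
    (h : I -> J) (g : J -> I) (F : J -> V) :
  uniq r -> uniq s -> {in r, forall i, h i \in s} ->
  {in s, forall j, g j \in r} -> {in r, cancel h g} -> {in s, cancel g h} ->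
  (\sum_(j <- s) F j = \sum_(i <- r) F (h i))%R.
Proof.
move=> Ur Us hs gr hK gK; rewrite -(big_map h xpredT F); apply: perm_big.
apply: uniq_perm => // [|j].
  by rewrite map_inj_in_uniq // => i i' ri ri' /(congr1 g); rewrite !hK.
apply/idP/mapP => [sj | [i ri ->]]; last exact: hs.
by exists (g j); rewrite ?gr ?gK.
Qed.

Lemma is_rotationP c w : reflect (exists k, w = rot k c) (is_rotation c w).
Proof.
apply: (iffP mapP) => [[k _ ->]|[k ->]]; first by exists k.
exists (minn k (size c)); first by rewrite mem_iota ltnS geq_minr.
by case: (leqP k (size c)) => // /ltnW le; rewrite rot_oversize // rot_size.
Qed.

Lemma rot_rot_ex (T : Type) k l (c : seq T) : exists m, rot k (rot l c) = rot m c.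
Proof. by rewrite rot_rot_add; eexists. Qed.

Lemma rot_inv_ex (T : Type) k (c : seq T) : exists m, c = rot m (rot k c).
Proof. by exists (size c - k)%N; rewrite -{1}(rotK k c) /rotr size_rot. Qed.

Lemma is_rotation_rotl k c w : is_rotation (rot k c) w = is_rotation c w.
Proof.
apply/is_rotationP/is_rotationP => [[m ->]|[m ->]]; first exact: rot_rot_ex.
by have [l {1}->] := rot_inv_ex k c; apply: rot_rot_ex.
Qed.

Lemma is_rotation_rotr k c w : is_rotation c (rot k w) = is_rotation c w.
Proof.
apply/is_rotationP/is_rotationP => [[m Dw]|[m ->]]; last exact: rot_rot_ex.
by have [l ->] := rot_inv_ex k w; rewrite Dw; apply: rot_rot_ex.
Qed.

(** The subword turns by the number of kept letters in the prefix that is moved. *)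
Lemma filter_rot_ex (T : Type) (p : pred T) k (w : seq T) :
  exists m, filter p (rot k w) = rot m (filter p w).
Proof.
exists (size (filter p (take k w))).
by rewrite -{3}(cat_take_drop k w) filter_cat rot_size_cat /rot filter_cat.
Qed.

(** Marking a vertex turns equality of circles into equality of words: with no repeated vertex, only
    the trivial rotation keeps [v] in front. *)
Lemma is_rotation_cons v c w : uniq (v :: c) ->
  is_rotation (v :: c) (v :: w) = (w == c).
Proof.
move=> Uc; apply/idP/eqP => [/is_rotationP[k]|->]; last first.
  by apply/is_rotationP; exists 0%N; rewrite rot0.
case: (ltnP k (size (v :: c))) => lek; last by rewrite rot_oversize // => -[].
move=> Dw; have := congr1 (fun s => nth v s 0) Dw.
rewrite /rot nth_cat size_drop subn_gt0 lek nth_drop addn0 /= => /esym/eqP.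
rewrite -[v in _ == v]/(nth v (v :: c) 0) nth_uniq // => /eqP k0.
by move: Dw; rewrite k0 rot0 => -[].
Qed.

(** No starting vertex is imposed, unlike in [cyclic_shuffles]. This makes the predicate invariant
    under rotation of [w] and symmetric in [c1] and [c2]; a cyclic order without repetition has one
    representative for each choice of its first letter. *)
Definition lshuffle (c1 c2 w : seq nat) : bool :=
  [&& perm_eq w (c1 ++ c2), is_rotation c1 [seq v <- w | v \in c1]
    & is_rotation c2 [seq v <- w | v \in c2]].

Definition lshuffles (c1 c2 : seq nat) : seq (seq nat) :=
  [seq w <- permutations (c1 ++ c2) | lshuffle c1 c2 w].

Lemma mem_lshuffles c1 c2 w : (w \in lshuffles c1 c2) = lshuffle c1 c2 w.
Proof. by rewrite mem_filter mem_permutations andb_idr // => /and3P[]. Qed.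

Lemma lshuffles_uniq c1 c2 : uniq (lshuffles c1 c2).
Proof. by rewrite filter_uniq ?permutations_uniq. Qed.

Lemma mem_cyclic_shuffles c1 c2 w :
  (w \in cyclic_shuffles c1 c2) = (ohead w == ohead (c1 ++ c2)) && lshuffle c1 c2 w.
Proof.
rewrite mem_filter mem_permutations /lshuffle.
by case: (perm_eq w _); rewrite ?andbT ?andbF //=.
Qed.

Lemma cyclic_shuffles_uniq c1 c2 : uniq (cyclic_shuffles c1 c2).
Proof. by rewrite filter_uniq ?permutations_uniq. Qed.

Lemma lshuffleC c1 c2 w : lshuffle c1 c2 w = lshuffle c2 c1 w.
Proof.
rewrite /lshuffle perm_sym perm_catC perm_sym.
by case: perm_eq => //=; rewrite andbC.
Qed.

Lemma lshuffle_rot k c1 c2 w : lshuffle c1 c2 (rot k w) = lshuffle c1 c2 w.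
Proof.
rewrite /lshuffle perm_rot; congr [&& _, _ & _].
  by have [m ->] := filter_rot_ex (mem c1) k w; rewrite is_rotation_rotr.
by have [m ->] := filter_rot_ex (mem c2) k w; rewrite is_rotation_rotr.
Qed.

Lemma lshuffle_rotl k c1 c2 w : lshuffle (rot k c1) c2 w = lshuffle c1 c2 w.
Proof.
rewrite /lshuffle is_rotation_rotl; congr [&& _, _ & _].
  by apply: (permPr _); rewrite perm_cat2r perm_rot.
by congr is_rotation; apply: eq_filter => v; rewrite mem_rot.
Qed.

(** The word read from [v] is a normal form of the circle. *)
Lemma rot_index_eq v (w w' : seq nat) : uniq w -> v \in w ->
  is_rotation w w' -> rot (index v w) w = rot (index v w') w'.
Proof.
move=> Uw vw /is_rotationP[k Dw'].
have vw' : v \in w' by rewrite Dw' mem_rot.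
have Uw' : uniq w' by rewrite Dw' rot_uniq.
have Dr s : uniq s -> v \in s -> {t | rot (index v s) s = v :: t}.
  move=> Us vs; exists (behead (rot (index v s) s)).
  by rewrite /rot (drop_nth v) ?index_mem // nth_index.
have [t Dt] := Dr w Uw vw; have [t' Dt'] := Dr w' Uw' vw'.
rewrite Dt Dt'; congr cons; apply/esym/eqP.
rewrite -(@is_rotation_cons v) -?Dt ?rot_uniq // -Dt' is_rotation_rotr.
by rewrite is_rotation_rotl; apply/is_rotationP; exists k.
Qed.

Local Open Scope ring_scope.

Section ShuffleSums.
Variable V : zmodType.

(** The cut may be moved to any vertex [v]. Rotating each word to start at [v], and back to start at
    the original cut, are inverse bijections between the two sets of representatives. *)
Lemma sum_cyclic_shuffles v c1 c2 (F : seq nat -> V) :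
    uniq (c1 ++ c2) -> v \in c1 ++ c2 -> (forall k w, uniq w -> F (rot k w) = F w) ->
  \sum_(w <- cyclic_shuffles c1 c2) F w =
  \sum_(w <- lshuffles c1 c2 | ohead w == Some v) F w.
Proof.
move=> Uc vc Frot; rewrite -[RHS]big_filter.
set x := head 0%N (c1 ++ c2).
have Dx : ohead (c1 ++ c2) = Some x by rewrite /x; case: (c1 ++ c2) vc.
have xc : x \in c1 ++ c2 by rewrite /x; case: (c1 ++ c2) vc => // *; apply: mem_head.
pose turn y (w : seq nat) := rot (index y w) w.
have turn_head y w : y \in w -> ohead (turn y w) = Some y.
  by move=> yw; rewrite /turn /rot (drop_nth y) ?index_mem // nth_index.
have turnK y z w : uniq w -> z \in w -> ohead w = Some z -> turn z (turn y w) = w.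
  move=> Uw zw; case: w Uw zw => //= t w Uw zw [Dt]; rewrite /turn; symmetry.
  have <- := @rot_index_eq z (t :: w) (rot (index y (t :: w)) (t :: w)) Uw zw.
    by rewrite /= Dt eqxx rot0.
  by apply/is_rotationP; eexists.
have mem_sh w y : lshuffle c1 c2 w -> y \in c1 ++ c2 -> uniq w /\ y \in w.
  by case/and3P=> pw _ _; rewrite (perm_uniq pw) (perm_mem pw).
have turnP y w : y \in c1 ++ c2 -> lshuffle c1 c2 w ->
  lshuffle c1 c2 (turn y w) /\ ohead (turn y w) = Some y.
  by move=> yc sw; have [_ yw] := mem_sh _ _ sw yc; rewrite lshuffle_rot turn_head.
rewrite [RHS](@big_seq_bij _ _ _ (cyclic_shuffles c1 c2) _ (turn v) (turn x)) /=.
- rewrite !big_seq; apply: eq_bigr => w; rewrite mem_cyclic_shuffles => /andP[_ sw].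
  by have [Uw _] := mem_sh _ v sw vc; rewrite Frot.
- exact: cyclic_shuffles_uniq.
- by rewrite filter_uniq ?lshuffles_uniq.
- move=> w; rewrite mem_cyclic_shuffles mem_filter mem_lshuffles => /andP[_ sw].
  by have [-> ->] := turnP v w vc sw; rewrite eqxx.
- move=> w; rewrite mem_cyclic_shuffles mem_filter mem_lshuffles Dx => /andP[_ sw].
  by have [-> ->] := turnP x w xc sw; rewrite eqxx.
- move=> w; rewrite mem_cyclic_shuffles Dx => /andP[/eqP Dw sw].
  by have [Uw xw] := mem_sh _ x sw xc; apply: turnK.
move=> w; rewrite mem_filter mem_lshuffles => /andP[/eqP Dw sw].
by have [Uw vw] := mem_sh _ v sw vc; apply: turnK.
Qed.

(** Once both families are cut at a common vertex, only the predicate [lshuffle] matters. The empty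
    circle, which offers no vertex to cut at, is separate. *)
Lemma eq_sum_cyclic_shuffles c1 c2 d1 d2 (F : seq nat -> V) :
    uniq (c1 ++ c2) -> perm_eq (c1 ++ c2) (d1 ++ d2) ->
    lshuffle c1 c2 =1 lshuffle d1 d2 ->
    (forall k w, uniq w -> F (rot k w) = F w) ->
  \sum_(w <- cyclic_shuffles c1 c2) F w = \sum_(w <- cyclic_shuffles d1 d2) F w.
Proof.
move=> Uc pcd eq_sh Frot.
case Dc: (c1 ++ c2) => [|v c].
  apply: perm_big; apply: uniq_perm => [||w]; rewrite ?cyclic_shuffles_uniq //.
  rewrite !mem_cyclic_shuffles eq_sh Dc.
  by move: pcd; rewrite Dc perm_sym => /perm_nilP->.
have vc : v \in c1 ++ c2 by rewrite Dc mem_head.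
rewrite !(@sum_cyclic_shuffles v) -?(perm_mem pcd) -?(perm_uniq pcd) //.
apply: perm_big; apply: uniq_perm => [||w]; rewrite ?lshuffles_uniq //.
by rewrite !mem_lshuffles eq_sh.
Qed.

Lemma sum_cyclic_shufflesC c1 c2 (F : seq nat -> V) :
    uniq (c1 ++ c2) -> (forall k w, uniq w -> F (rot k w) = F w) ->
  \sum_(w <- cyclic_shuffles c1 c2) F w = \sum_(w <- cyclic_shuffles c2 c1) F w.
Proof.
move=> Uc; apply: eq_sum_cyclic_shuffles => // [|w]; last exact: lshuffleC.
by rewrite perm_catC.
Qed.

Lemma sum_cyclic_shuffles_rotl k c1 c2 (F : seq nat -> V) :
    uniq (c1 ++ c2) -> (forall k w, uniq w -> F (rot k w) = F w) ->
  \sum_(w <- cyclic_shuffles (rot k c1) c2) F w =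
  \sum_(w <- cyclic_shuffles c1 c2) F w.
Proof.
move=> Uc Frot; symmetry; apply: eq_sum_cyclic_shuffles => // [|w].
  by rewrite perm_cat2r perm_sym perm_rot.
by rewrite lshuffle_rotl.
Qed.

End ShuffleSums.

Lemma is_rotation_map (f : nat -> nat) (s c w : seq nat) :
    {in s &, injective f} -> {subset c <= s} -> {subset w <= s} ->
  is_rotation (map f c) (map f w) = is_rotation c w.
Proof.
move=> injf cs ws; apply/is_rotationP/is_rotationP => [[k]|[k ->]]; last first.
  by exists k; rewrite map_rot.
rewrite -map_rot => /(inj_in_map injf) Dw; exists k; apply: Dw.
  by apply/allP.
by apply/allP => v; rewrite mem_rot => /cs.
Qed.

Lemma lshuffle_map (f : nat -> nat) c1 c2 w :
    {in c1 ++ c2 &, injective f} -> perm_eq w (c1 ++ c2) ->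
  lshuffle (map f c1) (map f c2) (map f w) = lshuffle c1 c2 w.
Proof.
move=> injf pw; rewrite /lshuffle pw -map_cat perm_map //=.
have sub c : {subset c <= c1 ++ c2} ->
  [seq v <- map f w | v \in map f c] = map f [seq v <- w | v \in c].
  move=> cs; rewrite filter_map; congr map; apply: eq_in_filter => v /=.
  rewrite (perm_mem pw) => vc; apply/mapP/idP => [[x xc]|]; last by exists v.
  by move/injf => -> //; apply: cs.
have sw (p : pred nat) : {subset [seq v <- w | p v] <= c1 ++ c2}.
  by move=> v; rewrite mem_filter (perm_mem pw) => /andP[].
have s1 : {subset c1 <= c1 ++ c2} by move=> v vc; rewrite mem_cat vc.
have s2 : {subset c2 <= c1 ++ c2} by move=> v vc; rewrite mem_cat vc orbT.
by rewrite !sub //; congr (_ && _); apply: is_rotation_map injf _ _.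
Qed.

(** Injectivity is asked on the circles only, because the maps of interest, the [collapse i j],
    identify two labels. *)
Lemma sum_cyclic_shuffles_map (V : zmodType) (f : nat -> nat) c1 c2
    (F : seq nat -> V) :
  {in c1 ++ c2 &, injective f} ->
  \sum_(w <- cyclic_shuffles (map f c1) (map f c2)) F w =
  \sum_(w <- cyclic_shuffles c1 c2) F (map f w).
Proof.
move=> injf; set s := c1 ++ c2.
(* A left inverse of [f] on [s], read off from positions. *)
pose g y := nth 0%N s (index y (map f s)).
have fK : {in s, cancel f g}.
  move=> x xs; have fxs := map_f f xs.
  have ltx : (index (f x) (map f s) < size s)%N by rewrite -(size_map f) index_mem.
  apply: injf => //; first exact: mem_nth.
  by rewrite -(nth_map _ 0%N) // nth_index.
have gK : {in map f s, cancel g f} by move=> _ /mapP[x xs ->]; rewrite fK.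
have mem_sh w : w \in cyclic_shuffles c1 c2 -> perm_eq w s.
  by rewrite mem_cyclic_shuffles => /andP[_ /and3P[]].
have omap_head h w : ohead (map h w) = omap h (ohead w) by case: w.
have mapK : map g (map f s) = s.
  by rewrite -map_comp -[RHS]map_id; apply/eq_in_map => x /fK.
have mapgK w : perm_eq w (map f s) -> map f (map g w) = w.
  move=> pw; rewrite -map_comp -[RHS]map_id; apply/eq_in_map => x.
  by rewrite (perm_mem pw) => /gK.
rewrite [LHS](@big_seq_bij _ _ _ (cyclic_shuffles c1 c2) _ (map f) (map g)) //.
- exact: cyclic_shuffles_uniq.
- exact: cyclic_shuffles_uniq.
- move=> w cw; have pw := mem_sh w cw; move: cw.
  rewrite !mem_cyclic_shuffles lshuffle_map // => /andP[/eqP Dw ->].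
  by rewrite -map_cat !omap_head Dw eqxx.
- move=> w; rewrite mem_cyclic_shuffles -map_cat => /andP[/eqP Dw sw].
  have pw : perm_eq w (map f s) by case/and3P: sw; rewrite -map_cat.
  rewrite mem_cyclic_shuffles omap_head Dw -omap_head mapK eqxx /=.
  rewrite -(lshuffle_map injf) ?mapgK //.
  by rewrite -/s -mapK perm_map.
- move=> w /mem_sh pw; rewrite -map_comp -[RHS]map_id; apply/eq_in_map => x.
  by rewrite (perm_mem pw) => /fK.
move=> w; rewrite mem_cyclic_shuffles -map_cat => /andP[_ /and3P[pw _ _]].
by apply: mapgK; rewrite -map_cat in pw.
Qed.

(** * Arcs of a circle and arcs of a shuffle *)

Lemma arcsE c : (1 < size c)%N -> arcs c = [seq (v, next c v) | v <- c].
Proof. by rewrite /arcs => ->. Qed.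

Lemma arcs_uniq c : uniq c -> uniq (arcs c).
Proof. by move=> Uc; rewrite /arcs; case: ifP; rewrite // map_inj_uniq // => x y []. Qed.

Lemma perm_arcs_rot k c : uniq c -> perm_eq (arcs (rot k c)) (arcs c).
Proof.
move=> Uc; rewrite /arcs size_rot; case: ifP => // _; rewrite map_rot perm_rot.
by under eq_map do rewrite next_rot //.
Qed.

Lemma arcs_map f c : injective f -> uniq c ->
  arcs (map f c) = [seq (f a.1, f a.2) | a <- arcs c].
Proof.
move=> injf Uc; rewrite /arcs size_map; case: ifP => // _; rewrite -!map_comp.
by apply: eq_map => v /=; rewrite next_map.
Qed.

Lemma mem_arcs i j c : (i, j) \in arcs c -> (i \in c) && (j \in c).
Proof.
rewrite /arcs; case: ifP => // _ /mapP[v vc [-> ->]].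
by rewrite mem_next vc.
Qed.

Lemma arcs_cons2 i j d : (i, j) \in arcs (i :: j :: d).
Proof.
rewrite arcsE //; apply/mapP; exists i; first exact: mem_head.
by rewrite /= eqxx.
Qed.

Lemma arcsP i j c : uniq c -> (i, j) \in arcs c -> exists k d, c = rot k (i :: j :: d).
Proof.
move=> Uc aij; have /andP[ic _] := mem_arcs aij; have [k d Dc] := rot_to ic.
move: aij; rewrite -(perm_mem (perm_arcs_rot k Uc)) Dc.
have [m Dm] := rot_inv_ex k c; move: Dm; rewrite Dc.
case: d {Dc} => [//|j' d] Dm; rewrite arcsE // => /mapP[v vs [Dv Dj]].
by exists m, d; move: Dj; rewrite -Dv /= eqxx => ->.
Qed.

Lemma big_pred1_seq_cond (V : nmodType) (I : eqType) (s : seq I) x (F : I -> V) :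
  uniq s -> \sum_(a <- s | x == a) F a = if x \in s then F x else 0.
Proof.
move=> Us; under eq_bigl do rewrite eq_sym.
case: ifP => [xs | /negbT xs]; last first.
  rewrite big_seq_cond big1 // => a /andP[a_s /eqP Da].
  by case/negP: xs; rewrite -Da.
by rewrite -big_filter filter_pred1_uniq // big_seq1.
Qed.

(* Every cyclic order marked at one of its arcs has exactly one linear
   representative in which that arc comes first. *)
Lemma sum_arcs_cyclic_shuffles (V : zmodType) c1 c2 (F : seq nat -> nat -> nat -> V) :
    uniq (c1 ++ c2) -> (1 < size (c1 ++ c2))%N ->
    (forall k w i j, uniq w -> F (rot k w) i j = F w i j) ->
  \sum_(w <- cyclic_shuffles c1 c2) \sum_(a <- arcs w) F w a.1 a.2 =
  \sum_(w <- lshuffles c1 c2) F w (nth 0%N w 0) (nth 0%N w 1).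
Proof.
move=> Uc c_gt1 Frot; pose H w v := F w v (next w v).
transitivity (\sum_(w <- cyclic_shuffles c1 c2) \sum_(v <- c1 ++ c2) H w v).
  rewrite !big_seq; apply: eq_bigr => w.
  rewrite mem_cyclic_shuffles => /andP[_ /and3P[pw _ _]].
  by rewrite -(perm_big _ pw) arcsE ?(perm_size pw) // big_map.
rewrite exchange_big /= big_seq.
under eq_bigr => v vc.
  rewrite (sum_cyclic_shuffles Uc vc); last first.
    by move=> k w Uw; rewrite /H next_rot // Frot.
  rewrite big_mkcond /=; over.
rewrite -big_seq exchange_big /= !big_seq; apply: eq_bigr => w.
rewrite mem_lshuffles => /and3P[pw _ _].
have Uw : uniq w by rewrite (perm_uniq pw).
case: w pw Uw => [|i [|j u]] pw Uw; try by rewrite -(perm_size pw) in c_gt1.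
rewrite -big_mkcond big_pred1_seq_cond // -(perm_mem pw) mem_head.
by rewrite /H /= eqxx.
Qed.

(** * Contraction of an arc and its compatibility with shuffles *)

Lemma collapse_inj i j : {in predC1 j &, injective (collapse i j)}.
Proof.
move=> k l; rewrite !inE /collapse => kj lj.
by case: eqP => ?; case: eqP => ?; do ?case: ifP; lia.
Qed.

Lemma collapseC i j : collapse i j =1 collapse j i.
Proof. by move=> k; rewrite /collapse maxnC minnC. Qed.

Lemma collapsel i j : collapse i j i = minn i j.
Proof. by rewrite /collapse; case: eqP => // ?; case: ifP; lia. Qed.

Lemma collapser i j : collapse i j j = minn i j.
Proof. by rewrite collapseC collapsel minnC. Qed.

Lemma rem_cat_neq j c1 c2 : uniq (c1 ++ c2) -> j \in c1 ->
  {subset rem j c1 ++ c2 <= (predC1 j : pred nat)}.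
Proof.
rewrite cat_uniq => /and3P[Uc1 /hasPn disj _] jc1 v.
rewrite mem_cat mem_rem_uniq // !inE => /orP[/andP[]// | vc2].
by apply: contraTneq vc2 => ->; apply: contraL jc1; apply: disj.
Qed.

Lemma uniq_contract_circle i j c1 c2 : uniq (c1 ++ c2) -> j \in c1 ->
  uniq (contract_circle i j c1 ++ map (collapse i j) c2).
Proof.
move=> Uc jc1; rewrite -map_cat map_inj_in_uniq.
  by apply: subseq_uniq Uc; apply: cat_subseq => //; apply: rem_subseq.
by apply: sub_in2 (@collapse_inj i j); apply: rem_cat_neq.
Qed.

Lemma contract_circle_rot k i j w : uniq w ->
  exists m, contract_circle i j (rot k w) = rot m (contract_circle i j w).
Proof.
move=> Uw; rewrite /contract_circle !rem_filter ?rot_uniq //.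
by have [m ->] := filter_rot_ex (predC1 j) k w; exists m; rewrite map_rot.
Qed.

(** Rotated to start with [i], the circle [c1] begins with [i] and [j], as does the subword of the
    shuffle on [c1]. Both memberships thus compare the remaining letters literally, and erasing [j]
    does not affect the comparison. *)
Lemma lshuffle_rem i j c1 c2 u : uniq (c1 ++ c2) -> (i, j) \in arcs c1 ->
  lshuffle c1 c2 (i :: j :: u) = lshuffle (rem j c1) c2 (i :: u).
Proof.
move=> Uc aij; have Uc1 : uniq c1 by move: Uc; rewrite cat_uniq => /andP[].
have [k [d Dc]] := arcsP Uc1 aij.
have Ud : uniq (i :: j :: d) by rewrite Dc rot_uniq in Uc1.
have Dr : exists m, rem j c1 = rot m (i :: d).
  rewrite rem_filter // Dc.
  have [m ->] := filter_rot_ex (predC1 j) k (i :: j :: d); exists m.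
  congr rot; rewrite -rem_filter //=; move: Ud; rewrite /= inE negb_or eqxx.
  by case: eqP => [->|] //; rewrite eqxx.
case: Dr => m ->; rewrite Dc !lshuffle_rotl.
have {Uc} Uc : uniq ((i :: j :: d) ++ c2).
  by rewrite (perm_uniq (s2 := c1 ++ c2)) // perm_cat2r Dc perm_sym perm_rot.
rewrite /lshuffle /= !perm_cons; case pu: (perm_eq u (d ++ c2)) => //=.
move: Uc; rewrite /= !inE !mem_cat !negb_or => /and3P[/and3P[ij id ic2] /andP[jd jc2]].
move=> Udc; rewrite !eqxx ?orbT (negPf ic2) (negPf jc2) /=.
rewrite is_rotation_cons // is_rotation_cons; last first.
  by move: Ud; rewrite /= inE; case/andP=> /norP[_ ->] /andP[_ ->].
have uE v : v \in u -> (v \in [:: i, j & d]) = (v \in i :: d).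
  rewrite (perm_mem pu) mem_cat !inE; case: (v =P j) => [->|] //.
  by rewrite (negPf jd) (negPf jc2).
have uE' v : v \in u -> (v \in i :: d) = (v \in d).
  rewrite (perm_mem pu) mem_cat !inE; case: (v =P i) => [->|] //.
  by rewrite (negPf id) (negPf ic2).
by rewrite eqseq_cons eqxx (eq_in_filter uE).
Qed.

(** Deleting [j] and inserting it back right after [i] are inverse bijections between the shuffles
    that begin with the arc and the shuffles of [rem j c1] and [c2] cut at [i]. *)
Lemma sum_contract_circle (V : zmodType) i j c1 c2 (G : seq nat -> V) :
    uniq (c1 ++ c2) -> (i, j) \in arcs c1 ->
    (forall k w, G (rot k w) = G w) ->
  \sum_(w <- lshuffles c1 c2 | (nth 0%N w 0, nth 0%N w 1) == (i, j))
     G (contract_circle i j w) =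
  \sum_(w <- cyclic_shuffles (contract_circle i j c1) (map (collapse i j) c2)) G w.
Proof.
move=> Uc aij Grot; have /andP[ic1 jc1] := mem_arcs aij.
have [Uc1 Nc12 _] := and3P (etrans (esym (cat_uniq _ _)) Uc).
have [k [d Dc]] := arcsP Uc1 aij.
have ij : i != j.
  by move: Uc1; rewrite Dc rot_uniq /= inE negb_or => /andP[/andP[]].
(* With [j] removed, [collapse i j] is a mere renaming and can be taken out of the shuffles. *)
rewrite sum_cyclic_shuffles_map; last first.
  by apply: sub_in2 (@collapse_inj i j); apply: rem_cat_neq.
rewrite (@sum_cyclic_shuffles _ i); first last.
- by move=> m w _; rewrite map_rot.
- by rewrite mem_cat mem_rem_uniq // !inE ij ic1.
- apply: subseq_uniq Uc; apply: cat_subseq => //; exact: rem_subseq.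
rewrite -[LHS]big_filter -[RHS]big_filter.
have Dsh w : w \in [seq w <- lshuffles c1 c2 | (nth 0%N w 0, nth 0%N w 1) == (i, j)] ->
  exists2 u, w = i :: j :: u & lshuffle c1 c2 (i :: j :: u).
  (* Words with fewer than two letters have to be excluded by hand, since [nth] reads its default 0
     there. *)
  rewrite mem_filter mem_lshuffles; case: w => [|i' [|j' u]] /=.
  - by rewrite xpair_eqE => /andP[/andP[/eqP i0 /eqP j0] _]; rewrite -i0 -j0 in ij.
  - rewrite xpair_eqE => /andP[/andP[/eqP-> _]] /and3P[/perm_mem pw _ _].
    by move: (pw j); rewrite mem_cat jc1 inE eq_sym (negPf ij).
  by rewrite xpair_eqE => /andP[/andP[/eqP-> /eqP->]]; exists u.
have Dsh' w : w \in [seq w <- lshuffles (rem j c1) c2 | ohead w == Some i] ->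
  exists2 u, w = i :: u & lshuffle (rem j c1) c2 (i :: u).
  rewrite mem_filter mem_lshuffles; case: w => [|i' u] //=.
  by case/andP=> /eqP[->]; exists u.
rewrite [LHS](@big_seq_bij _ _ _
  [seq w <- lshuffles (rem j c1) c2 | ohead w == Some i] _
  (fun w => i :: j :: behead w) (rem j)).
- rewrite !big_seq; apply: eq_bigr => w /Dsh'[u -> _].
  by rewrite /contract_circle /= (negPf ij) eqxx.
- by rewrite filter_uniq ?lshuffles_uniq.
- by rewrite filter_uniq ?lshuffles_uniq.
- move=> w /Dsh'[u -> sw] /=.
  by rewrite mem_filter /= eqxx mem_lshuffles lshuffle_rem.
- move=> w /Dsh[u -> sw] /=.
  by rewrite (negPf ij) eqxx mem_filter /= eqxx mem_lshuffles -lshuffle_rem.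
- by move=> w /Dsh'[u -> sw] /=; rewrite (negPf ij) eqxx.
by move=> w /Dsh[u -> sw] /=; rewrite (negPf ij) eqxx.
Qed.

Lemma arcs_small c : (size c <= 1)%N -> arcs c = [::].
Proof. by rewrite /arcs ltnNge => ->. Qed.

(** If both ends of the first arc of the shuffle lie on [c1], they come first in the subword on
    [c1], which is a rotation of [c1]; hence they are consecutive on [c1]. *)
Lemma mem_arcs_lshuffle i j c1 c2 u : uniq (c1 ++ c2) ->
  lshuffle c1 c2 (i :: j :: u) -> ((i, j) \in arcs c1) = (i \in c1) && (j \in c1).
Proof.
move=> Uc /and3P[_ rot1 _]; apply/idP/idP => [/mem_arcs // | /andP[ic jc]].
have Uc1 : uniq c1 by move: Uc; rewrite cat_uniq => /andP[].
move: rot1; rewrite /= ic jc => /is_rotationP[k Dk].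
by rewrite -(perm_mem (perm_arcs_rot k Uc1)) -Dk arcs_cons2.
Qed.

(** The shuffles whose first arc belongs to [c1] are grouped according to that arc. *)
Lemma sum_arcs_part (V : zmodType) c1 c2 (G : nat -> nat -> seq nat -> V) :
    uniq (c1 ++ c2) -> (forall i j k w, G i j (rot k w) = G i j w) ->
  \sum_(w <- lshuffles c1 c2 | (nth 0%N w 0, nth 0%N w 1) \in arcs c1)
     G (nth 0%N w 0) (nth 0%N w 1)
       (contract_circle (nth 0%N w 0) (nth 0%N w 1) w) =
  \sum_(a <- arcs c1)
     \sum_(w <- cyclic_shuffles (contract_circle a.1 a.2 c1)
                                (map (collapse a.1 a.2) c2)) G a.1 a.2 w.
Proof.
move=> Uc Grot; have Uc1 : uniq c1 by move: Uc; rewrite cat_uniq => /andP[].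
transitivity (\sum_(a <- arcs c1) \sum_(w <- lshuffles c1 c2)
    if (nth 0%N w 0, nth 0%N w 1) == a
    then G a.1 a.2 (contract_circle a.1 a.2 w) else 0); last first.
  rewrite big_seq [RHS]big_seq; apply: eq_bigr => -[i j] aij.
  by rewrite -(sum_contract_circle Uc aij (Grot i j)) -big_mkcond.
rewrite exchange_big [LHS]big_mkcond /=; apply: eq_bigr => w _.
rewrite -(big_mkcond (fun a => _ == a)
  (fun a : nat * nat => G a.1 a.2 (contract_circle a.1 a.2 w))).
by rewrite big_pred1_seq_cond ?arcs_uniq.
Qed.

(* An arc joining consecutive vertices of both circles occurs with both
   orientations, in shuffles differing by a transposition of its ends; the two
   contractions cancel. *)
Lemma sum_arcs_mixed (V : zmodType) c1 c2 (F : seq nat -> nat -> nat -> V) :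
    uniq (c1 ++ c2) -> (1 < size (c1 ++ c2))%N ->
    (forall i j u, i \in c1 -> j \in c2 ->
       F (i :: j :: u) i j + F (j :: i :: u) j i = 0) ->
  \sum_(w <- lshuffles c1 c2 | ((nth 0%N w 0, nth 0%N w 1) \notin arcs c1) &&
                               ((nth 0%N w 0, nth 0%N w 1) \notin arcs c2))
     F w (nth 0%N w 0) (nth 0%N w 1) = 0.
Proof.
move=> Uc c_gt1 Fmix; set L := lshuffles c1 c2.
have Lw w : w \in L -> exists i j u, w = i :: j :: u /\ lshuffle c1 c2 (i :: j :: u).
  rewrite mem_lshuffles => sw; have /and3P[/perm_size pw _ _] := sw.
  by case: w sw pw c_gt1 => [|i [|j u]] sw <- // _; exists i, j, u.
have notboth v : v \in c1 -> v \in c2 = false.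
  move: Uc; rewrite cat_uniq => /and3P[_ /hasPn disj _] v1.
  by apply/negbTE; apply: contraL v1; apply: disj.
pose m12 (w : seq nat) := (nth 0%N w 0 \in c1) && (nth 0%N w 1 \in c2).
pose m21 (w : seq nat) := (nth 0%N w 0 \in c2) && (nth 0%N w 1 \in c1).
rewrite big_seq_cond (eq_bigl (fun w => (w \in L) && (m12 w || m21 w))); last first.
  move=> w; case wL: (w \in L) => //=; have [i [j [u [-> sw]]]] := Lw w wL.
  rewrite /= (mem_arcs_lshuffle Uc sw) (@mem_arcs_lshuffle _ _ c2 c1 u); first last.
  - by rewrite lshuffleC.
  - by rewrite uniq_catC.
  have /and3P[pw _ _] := sw; rewrite /m12 /m21 /=.
  have : i \in c1 ++ c2 by rewrite -(perm_mem pw) mem_head.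
  have : j \in c1 ++ c2 by rewrite -(perm_mem pw) !inE eqxx orbT.
  rewrite !mem_cat; move: (notboth i) (notboth j).
  case: (i \in c1); case: (j \in c1); case: (i \in c2); case: (j \in c2) => /= ni nj mj mi;
    first [by [] | by have := ni isT | by have := nj isT].
rewrite -big_seq_cond (bigID m12) /=.
rewrite [X in X + _](eq_bigl m12) => [|w]; last by case: (m12 w); rewrite ?andbF.
rewrite [X in _ + X](eq_bigl m21) => [|w]; last first.
  rewrite /m12 /m21; case: (boolP (nth 0%N w 0 \in c1)) => [/notboth->|_] /=.
    by rewrite orbF andbN.
  by rewrite andbT.
pose sw (w : seq nat) := [:: nth 0%N w 1, nth 0%N w 0 & drop 2 w].
(* The exchanged letters lie on different circles, so neither subword changes. *)
have sw_sh i j u : lshuffle c1 c2 (i :: j :: u) ->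
    m12 (i :: j :: u) || m21 (i :: j :: u) ->
    lshuffle c1 c2 (j :: i :: u).
  case/and3P=> pw r1 r2 mij; apply/and3P; split.
  - by rewrite (perm_catCA [:: j] [:: i] u).
  - move: r1 mij; rewrite /m12 /m21 /=.
    by case i1: (i \in c1); case j1: (j \in c1) => //=;
      rewrite ?(notboth _ i1) ?(notboth _ j1) ?andbF => // r _; exact: r.
  move: r2 mij; rewrite /m12 /m21 /=.
  by case i1: (i \in c1); case j1: (j \in c1) => //=;
    rewrite ?(notboth _ i1) ?(notboth _ j1) ?andbF => // r _; exact: r.
rewrite -[X in _ + X]big_filter -[X in X + _]big_filter.
have mem12 w : w \in [seq w <- L | m12 w] ->
    exists i j u, [/\ w = i :: j :: u, i \in c1, j \in c2 & lshuffle c1 c2 w].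
  rewrite mem_filter => /andP[mw /Lw[i [j [u [Dw sw']]]]]; exists i, j, u.
  by rewrite Dw; move: mw; rewrite Dw => /andP[].
have mem21 w : w \in [seq w <- L | m21 w] ->
    exists i j u, [/\ w = j :: i :: u, i \in c1, j \in c2 & lshuffle c1 c2 w].
  rewrite mem_filter => /andP[mw /Lw[j [i [u [Dw sw']]]]]; exists i, j, u.
  by rewrite Dw; move: mw; rewrite Dw => /andP[].
rewrite [X in _ + X](@big_seq_bij _ _ _ [seq w <- L | m12 w] _ sw sw).
- rewrite -big_split big_seq big1 // => w /mem12[i [j [u [-> i1 j2 _]]]].
  by rewrite /sw /= ?drop0; apply: Fmix.
- by rewrite filter_uniq ?lshuffles_uniq.
- by rewrite filter_uniq ?lshuffles_uniq.
- move=> w /mem12[i [j [u [-> i1 j2 shw]]]]; rewrite mem_filter mem_lshuffles.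
  by rewrite /m21 /sw /= i1 j2 ?drop0 sw_sh // /m12 /= i1 j2.
- move=> w /mem21[i [j [u [-> i1 j2 shw]]]]; rewrite mem_filter mem_lshuffles.
  by rewrite /m12 /sw /= i1 j2 ?drop0 sw_sh // /m21 /= i1 j2 orbT.
- by move=> w /mem12[i [j [u [-> _ _ _]]]]; rewrite /sw /= ?drop0.
by move=> w /mem21[i [j [u [-> _ _ _]]]]; rewrite /sw /= ?drop0.
Qed.

Lemma sum_arcs_shuffle (V : zmodType) c1 c2 (G : nat -> nat -> seq nat -> V) :
    uniq (c1 ++ c2) -> (forall i j k w, G i j (rot k w) = G i j w) ->
    (forall i j w, i \in c1 -> j \in c2 -> G i j w + G j i w = 0) ->
  \sum_(w <- cyclic_shuffles c1 c2)
     \sum_(a <- arcs w) G a.1 a.2 (contract_circle a.1 a.2 w) =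
  \sum_(a <- arcs c1)
     \sum_(w <- cyclic_shuffles (contract_circle a.1 a.2 c1)
                                (map (collapse a.1 a.2) c2)) G a.1 a.2 w +
  \sum_(a <- arcs c2)
     \sum_(w <- cyclic_shuffles (map (collapse a.1 a.2) c1)
                                (contract_circle a.1 a.2 c2)) G a.1 a.2 w.
Proof.
move=> Uc Grot Gmix; have Uc' : uniq (c2 ++ c1) by rewrite uniq_catC.
(* The main argument reads the first two letters of a word; circles with at most one vertex in all
   have no arcs and are set apart. *)
case: (ltnP 1 (size (c1 ++ c2))) => [c_gt1|c_le1]; last first.
  rewrite big_seq big1 => [|w]; last first.
    rewrite mem_cyclic_shuffles => /andP[_ /and3P[pw _ _]].
    by rewrite arcs_small ?big_nil // (perm_size pw).
  move: c_le1; rewrite size_cat => c_le1.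
  rewrite !arcs_small ?big_nil ?addr0 //.
    exact: leq_trans (leq_addl _ _) c_le1.
  exact: leq_trans (leq_addr _ _) c_le1.
have Frot k w i j : uniq w ->
    G i j (contract_circle i j (rot k w)) = G i j (contract_circle i j w).
  by move=> Uw; have [m ->] := contract_circle_rot k i j Uw.
rewrite (@sum_arcs_cyclic_shuffles _ c1 c2
  (fun w i j => G i j (contract_circle i j w))) //.
rewrite (bigID (fun w => (nth 0%N w 0, nth 0%N w 1) \in arcs c1)) /=.
rewrite sum_arcs_part //; congr (_ + _).
rewrite (bigID (fun w => (nth 0%N w 0, nth 0%N w 1) \in arcs c2)) /=.
rewrite (@sum_arcs_mixed _ c1 c2 (fun w i j => G i j (contract_circle i j w))) //.
  rewrite addr0 (eq_bigl (fun w => (nth 0%N w 0, nth 0%N w 1) \in arcs c2)).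
    transitivity (\sum_(w <- lshuffles c2 c1 | (nth 0%N w 0, nth 0%N w 1) \in arcs c2)
      G (nth 0%N w 0) (nth 0%N w 1) (contract_circle (nth 0%N w 0) (nth 0%N w 1) w)).
      apply: perm_big; apply: uniq_perm => [||w]; rewrite ?lshuffles_uniq //.
      by rewrite !mem_lshuffles lshuffleC.
    rewrite sum_arcs_part // big_seq [RHS]big_seq; apply: eq_bigr => -[i j] /mem_arcs aij.
    apply: sum_cyclic_shufflesC => //.
    by apply: uniq_contract_circle; case/andP: aij.
  move=> w; case: (boolP (_ \in arcs c2)) => [/mem_arcs/andP[w2 _]|]; last by rewrite andbF.
  rewrite andbT; apply/negP => /mem_arcs/andP[w1 _].
  by move: Uc; rewrite cat_uniq => /and3P[_ /hasPn/(_ _ w2)]; rewrite /= w1.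
move=> i j u i1 j2; have ij : i != j.
  apply: contraTneq i1 => ->; move: Uc; rewrite cat_uniq => /and3P[_ /hasPn disj _].
  exact: disj.
(* Whichever of [i] and [j] is deleted, the other one becomes [minn i j], so both orders contract to
   the same word and the terms cancel by [Gmix]. *)
rewrite /contract_circle /= (negPf ij) eq_sym (negPf ij) !eqxx /=.
by rewrite !collapsel minnC (eq_map (collapseC j i)) Gmix.
Qed.

(** * Linear extension to quotients *)

Section LinearMaps.
Variable R : comNzRingType.

Lemma linear_0 (U V : lmodType R) (g : U -> V) : linear g -> g 0 = 0.
Proof. by move=> glin; have := glin (-1) 0 0; rewrite scaler0 add0r scaleN1r addNr. Qed.

Lemma linear_sum_scale (U V : lmodType R) (g : U -> V) (I : Type) (r : seq I)
    (P : pred I) (a : I -> R) (u : I -> U) : linear g ->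
  g (\sum_(i <- r | P i) a i *: u i) = \sum_(i <- r | P i) a i *: g (u i).
Proof.
move=> glin; apply: (big_ind2 (fun x y => g x = y)) => [|x _ y _ <- <-|i _].
- exact: linear_0.
- by have := glin 1 x y; rewrite !scale1r.
by have := glin (a i) (u i) 0; rewrite !addr0 linear_0 // addr0.
Qed.

Arguments linear_sum_scale {U V g I r P a u}.

(** The same sign [e] serves all the terms of [x], which is what homogeneity of the first argument
    provides. *)
Lemma leibniz_sum (D : lmodType R) (delta : D -> D) (m : D -> D -> D) (e : R)
    (I J : eqType) (r : seq I) (s : seq J) a b (u : I -> D) (v : J -> D) :
  linear delta -> (forall z, linear (m^~ z)) -> (forall z, linear (m z)) ->
  {in r, forall i j, delta (m (u i) (v j)) =
     m (delta (u i)) (v j) + e *: m (u i) (delta (v j))} ->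
  let x := \sum_(i <- r) a i *: u i in let y := \sum_(j <- s) b j *: v j in
  delta (m x y) = m (delta x) y + e *: m x (delta y).
Proof.
move=> dlin ml mr leib /=.
rewrite !(linear_sum_scale dlin) !(linear_sum_scale (ml _)).
rewrite scaler_sumr -big_split /= (linear_sum_scale dlin).
rewrite [LHS]big_seq [RHS]big_seq; apply: eq_bigr => i ri.
rewrite !(linear_sum_scale (mr _)) (linear_sum_scale dlin).
rewrite !scaler_sumr -big_split /=; apply: eq_bigr => j _.
by rewrite leib //= !scalerDr !scalerA [e * _]mulrC -!mulrA [e * _]mulrC.
Qed.

Section Lext.
Variables (T : choiceType) (V : lmodType R).
Implicit Types (f : T -> V) (x : {malg R[T]}).

(** Padding the support with zero coefficients lets several combinations be summed over one index
    set, whence linearity. *)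
Lemma lextEw f (d : {fset T}) x : (msupp x `<=` d)%fset ->
  lext f x = \sum_(k <- d) x@_k *: f k.
Proof.
move=> le; rewrite /lext (big_fset_incl _ le) // => k _ /mcoeff_outdom ->.
by rewrite scale0r.
Qed.

Lemma lext_linear f : linear (lext f).
Proof.
move=> a u v; pose d := (msupp u `|` msupp v)%fset.
have du : (msupp u `<=` d)%fset by apply: fsubsetUl.
have dv : (msupp v `<=` d)%fset by apply: fsubsetUr.
have duv : (msupp (a *: u + v) `<=` d)%fset.
  apply: fsubset_trans (msuppD_le _ _) _; rewrite fsubUset dv andbT.
  exact: fsubset_trans (msuppZ_le _ _) du.
rewrite (lextEw f du) (lextEw f dv) (lextEw f duv) scaler_sumr -big_split /=.
by apply: eq_bigr => k _; rewrite mcoeffD mcoeffZ scalerDl scalerA.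
Qed.

Lemma lextU f k : lext f << k >> = f k.
Proof. by rewrite /lext msuppU oner_eq0 big_seq_fset1 mcoeffUU scale1r. Qed.

Lemma lext0 f : lext f 0 = 0.
Proof. by rewrite /lext msupp0 big_seq_fset0. Qed.

Lemma lextD f u v : lext f (u + v) = lext f u + lext f v.
Proof. by have := lext_linear f 1 u v; rewrite !scale1r. Qed.

Lemma lextB f u v : lext f (u - v) = lext f u - lext f v.
Proof. by have := lext_linear f (-1) v u; rewrite !scaleN1r ![- _ + _]addrC. Qed.

Lemma lextZ f a u : lext f (a *: u) = a *: lext f u.
Proof. by have := lext_linear f a u 0; rewrite addr0 lext0 addr0. Qed.

Variable B : {malg R[T]} -> Prop.

(** The representative chosen by [qext] differs from [c] by an element of the span of the relations,
    on which [lext f] vanishes by induction on the span. *)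
Lemma qext_class f c : (forall b, B b -> lext f b = 0) ->
  qext f (qclass B c) = lext f c.
Proof.
move=> fB; have : Defs.span B (repr (qclass B c) - c) by apply/qclass_eq; rewrite qclassK.
rewrite /qext => Brc; apply/eqP; rewrite -subr_eq0 -lextB; apply/eqP.
elim: Brc => [|a u v /fB fu _ IH]; first exact: lext0.
by rewrite lext_linear fu IH scaler0 addr0.
Qed.

Lemma qext_linear f : (forall b, B b -> lext f b = 0) -> linear (qext f : quotmod B -> V).
Proof.
move=> fB a x y; rewrite -[x]qclassK -[y]qclassK.
by rewrite -linearP !qext_class // lext_linear.
Qed.

Lemma qclass_sum c : qclass B c = \sum_(k <- msupp c) c@_k *: qclass B << k >>.
Proof.
rewrite {1}(monalgE c) linear_sum; apply: eq_bigr => k _; rewrite -linearZ.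
congr qclass; apply/malgP => l; rewrite mcoeffZ !mcoeffU.
by case: eqP; rewrite ?mulr1 ?mulr0.
Qed.

End Lext.

Section BilinearExtension.
Variables (T : choiceType) (B : {malg R[T]} -> Prop).
Local Notation D := (quotmod B).
Variables (f : T -> D) (g : T -> T -> D).
Local Notation delta := (qext f : D -> D).
Local Notation shuffle := (fun x y : D => qext (fun i => qext (g i) y) x : D).
Hypotheses (fB : forall b, B b -> lext f b = 0).
Hypotheses (gBl : forall j b, B b -> lext (g^~ j) b = 0).
Hypotheses (gBr : forall i b, B b -> lext (g i) b = 0).

(** A relation in the first argument is killed against each generator of the second; exchanging the
    two finite sums extends this to every [y]. *)
Lemma qext2_killl (y : D) b : B b -> lext (fun i => qext (g i) y) b = 0.
Proof.
move=> Bb; rewrite -[y]qclassK; set d := repr y.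
rewrite /lext; under eq_bigr do rewrite (qext_class _ (gBr _)).
under eq_bigr do rewrite /lext scaler_sumr.
rewrite exchange_big big1 //= => j _.
have := gBl j Bb; rewrite /lext => /(congr1 ( *:%R d@_j)).
rewrite scaler0 scaler_sumr => {2}<-; apply: eq_bigr => i _.
by rewrite !scalerA mulrC.
Qed.

Lemma qext2U i j : shuffle (qclass B << i >>) (qclass B << j >>) = g i j.
Proof.
by rewrite /= (qext_class _ (@qext2_killl _)) lextU (qext_class _ (gBr i)) lextU.
Qed.

Lemma qext2_linearl y : linear (shuffle^~ y).
Proof. by apply: qext_linear => b; apply: qext2_killl. Qed.

Lemma qext2_linearr x : linear (shuffle x).
Proof.
move=> a y z; rewrite -[x]qclassK !(qext_class _ (@qext2_killl _)).
rewrite /lext scaler_sumr -big_split; apply: eq_bigr => i _ /=.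
by rewrite (qext_linear (gBr i)) scalerDr !scalerA mulrC.
Qed.

Lemma leibniz_extension (deg : T -> nat) p (x y : D) :
    (forall i j, delta (g i j) =
       shuffle (f i) (qclass B << j >>) +
       (-1) ^+ deg i *: shuffle (qclass B << i >>) (f j)) ->
    homogeneous deg p x ->
  delta (shuffle x y) = shuffle (delta x) y + (-1) ^+ p *: shuffle x (delta y).
Proof.
move=> leib [c degc ->]; rewrite -[y]qclassK (qclass_sum B c) (qclass_sum B (repr y)).
have dlin : linear delta by apply: qext_linear.
have dU i : delta (qclass B << i >>) = f i by rewrite qext_class ?lextU.
apply: (@leibniz_sum D delta shuffle) => //.
- exact: qext2_linearl.
- exact: qext2_linearr.
by move=> i ci j; rewrite !dU qext2U leib degc.
Qed.

End BilinearExtension.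
End LinearMaps.

Arguments linear_sum_scale {R U V g I r P a u}.

(** * Consecutive transpositions and contraction signs *)

Definition swp (a k : nat) : nat :=
  if k == a then a.+1 else if k == a.+1 then a else k.

Lemma swpK a : involutive (swp a).
Proof. by move=> k; rewrite /swp; do !case: ifP; lia. Qed.

Lemma swp_inj a : injective (swp a).
Proof. exact: inv_inj (swpK a). Qed.

Lemma swp_lt a n k : (a.+1 < n)%N -> (swp a k < n)%N = (k < n)%N.
Proof. by move=> lt_an; rewrite /swp; do !case: ifP; lia. Qed.

Lemma swp_addn n a k : swp (n + a) (n + k) = (n + swp a k)%N.
Proof. by rewrite /swp; do !case: ifP; lia. Qed.

Lemma swp_ge a n k : (a.+1 < n)%N -> (n <= k)%N -> swp a k = k.
Proof. by rewrite /swp; do !case: ifP; lia. Qed.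

Lemma swp_lt_id a k : (k < a)%N -> swp a k = k.
Proof. by rewrite /swp; do !case: ifP; lia. Qed.

Lemma perm_natE n (s : 'S_n) (i : 'I_n) : perm_nat s i = s i.
Proof. by rewrite /perm_nat valK. Qed.

Lemma perm_nat_out n (s : 'S_n) k : (n <= k)%N -> perm_nat s k = k.
Proof. by move=> le_nk; rewrite /perm_nat insubF // ltnNge le_nk. Qed.

Lemma perm_nat1 n : perm_nat (1 : 'S_n)%g =1 id.
Proof.
move=> k; case: (ltnP k n) => [lt_kn|/perm_nat_out//].
by rewrite -[k]/(val (Ordinal lt_kn)) perm_natE perm1.
Qed.

Lemma perm_natM n (s t : 'S_n) : perm_nat (s * t)%g =1 perm_nat t \o perm_nat s.
Proof.
move=> k; case: (ltnP k n) => [lt_kn|le_nk] /=; last by rewrite !perm_nat_out.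
by rewrite -[k]/(val (Ordinal lt_kn)) !perm_natE permM.
Qed.

Lemma perm_nat_tperm n (i j : 'I_n) : j = i.+1 :> nat -> perm_nat (tperm i j) =1 swp i.
Proof.
move=> Dj k; case: (ltnP k n) => [lt_kn|le_nk]; last first.
  by rewrite perm_nat_out // (swp_ge _ le_nk) // -Dj.
rewrite -[k]/(val (Ordinal lt_kn)) perm_natE /swp -Dj.
case: tpermP => [->|->|/eqP ki /eqP kj]; first by rewrite eqxx.
  by rewrite gtn_eqF ?eqxx //= Dj.
by move: ki kj; rewrite -!val_eqE => /negPf-> /negPf->.
Qed.

(** A distant transposition is a shorter one conjugated by an adjacent one, and every permutation is
    a product of transpositions. *)
Lemma perm_adjacent_ind n (P : 'S_n -> Prop) :
    P 1%g -> (forall s t, P s -> P t -> P (s * t)%g) ->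
    (forall i j : 'I_n, j = i.+1 :> nat -> P (tperm i j)) ->
  forall s, P s.
Proof.
move=> P1 PM Padj.
have Plt d (i j : 'I_n) : j = (i + d.+1)%N :> nat -> P (tperm i j).
  elim: d i j => [|d IHd] i j Dj; first by apply: Padj; rewrite Dj addn1.
  have ltk : (i + d.+1 < n)%N by have := ltn_ord j; lia.
  pose k := Ordinal ltk; have Pkj : P (tperm k j) by apply: Padj; rewrite Dj /= addnS.
  have -> : tperm i j = (tperm k j * (tperm i k * tperm k j))%g.
    rewrite -{1}[tperm k j]tpermV -conjgE tpermJ tpermL tpermD //;
      by rewrite -val_eqE /= ?Dj; apply/eqP; lia.
  by apply: (PM) => //; apply: (PM) => //; apply: IHd.
have Pt (i j : 'I_n) : P (tperm i j).
  case: (ltngtP i j) => [lt_ij|lt_ji|/val_inj->]; last by rewrite tperm1.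
    by apply: (Plt (j - i.+1)%N); lia.
  by rewrite tpermC; apply: (Plt (i - j.+1)%N); lia.
move=> s; have [ts -> _] := prod_tpermP s.
by elim/big_rec: _ => // t u _; apply: PM.
Qed.

Lemma odd_tperm_adjacent n (i j : 'I_n) : j = i.+1 :> nat -> odd_perm (tperm i j).
Proof. by move=> Dj; rewrite odd_tperm -val_eqE /= Dj; lia. Qed.

Lemma collapse_lt i j k : (i < j)%N ->
  collapse i j k = if k == j then i else if (j < k)%N then k.-1 else k.
Proof.
by move=> /ltnW le_ij; rewrite /collapse (maxn_idPr le_ij) (minn_idPl le_ij).
Qed.

(** The label that disappears is the larger of [i] and [j]. If the transposition moves it, the
    exponent changes parity and the collapsed labels agree, so the transposition is absorbed. If
    not, the parity is kept and the transposition survives as [swp b]; the last clause says that [b]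
    and [b.+1] are labels of the contracted graph. *)
Lemma contraction_sign_swp a i j : i != j ->
  (odd (contraction_sign (swp a i) (swp a j)) = ~~ odd (contraction_sign i j) /\
   forall k, collapse (swp a i) (swp a j) (swp a k) = collapse i j k) \/
  (odd (contraction_sign (swp a i) (swp a j)) = odd (contraction_sign i j) /\
   exists2 b, (forall k, collapse (swp a i) (swp a j) (swp a k) =
                         swp b (collapse i j k)) &
     forall n, (a.+1 < n -> i < n -> j < n -> b.+1 < n.-1)%N).
Proof.
(* Exchanging [i] and [j] flips the parity on both sides and leaves [collapse] unchanged. *)
wlog lt_ij : i j / (i < j)%N => [IH ij|].
  case: (ltngtP i j) => [lt_ij|lt_ji|eij]; last by rewrite eij eqxx in ij.
    exact: IH.
  have flip x y : x != y -> odd (contraction_sign x y) = ~~ odd (contraction_sign y x).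
    by rewrite /contraction_sign; case: ltngtP => //= *; rewrite ?negbK.
  have sij : swp a i != swp a j by rewrite (inj_eq (@swp_inj a)).
  rewrite (flip _ _ sij) (flip _ _ ij).
  have := IH j i lt_ji; rewrite eq_sym => /(_ ij) [[-> eqc]|[-> [b eqc ltb]]].
    by left; split=> // k; rewrite collapseC eqc collapseC.
  right; split=> //; exists b => [k|n la li lj]; last exact: ltb.
  by rewrite collapseC eqc collapseC.
move=> _; rewrite {2 4}/contraction_sign lt_ij.
have clt k := @collapse_lt i j k lt_ij.
have [Da|Na] := eqVneq a j.
  have -> : swp a i = i by apply: swp_lt_id; rewrite Da.
  have -> : swp a j = j.+1 by rewrite /swp Da eqxx.
  have lt_ij' : (i < j.+1)%N by lia.
  left; rewrite /contraction_sign lt_ij'; split=> [|k]; first by lia.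
  by rewrite collapse_lt // clt /swp Da; do ?case: eqP; do ?case: ifP; lia.
have [Da|Na'] := eqVneq a.+1 j.
  subst j; have -> : swp a a.+1 = a by rewrite /swp eqxx; case: eqP => //; lia.
  left; have [Di|Ni] := eqVneq i a.
    have -> : swp a i = a.+1 by rewrite /swp Di eqxx.
    rewrite /contraction_sign ltnNge leqnSn /=; split=> [|k]; first by lia.
    by rewrite collapseC collapse_lt // clt Di /swp; do ?case: eqP; do ?case: ifP; lia.
  have -> : swp a i = i by rewrite /swp (negPf Ni); case: eqP => //; lia.
  have lt_ia : (i < a)%N by lia.
  rewrite /contraction_sign lt_ia; split=> [|k]; first by lia.
  by rewrite collapse_lt // clt /swp; do ?case: eqP; do ?case: ifP; lia.
right; case: (ltnP j a) => lt_ja.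
  rewrite (@swp_lt_id a j) // (@swp_lt_id a i); last exact: ltn_trans lt_ja.
  (* Labels above the removed [j] go down by one, which turns [a] into [a.-1]; in the remaining case
     the transposed labels lie below [j] and keep their values. *)
  rewrite /contraction_sign lt_ij; split=> //; exists a.-1 => [k|n]; last by lia.
  by rewrite !clt /swp; do ?case: eqP; do ?case: ifP; lia.
have -> : swp a j = j by rewrite /swp; do ?case: eqP; lia.
have lt_sij : (swp a i < j)%N by rewrite swp_lt //; lia.
rewrite /contraction_sign lt_sij; split=> //; exists a => [k|n]; last by lia.
by rewrite collapse_lt // clt /swp; do ?case: eqP; do ?case: ifP; lia.
Qed.

Lemma collapse_eq i j k l : i != j -> (collapse i j k == collapse i j l) =
  (k == l) || (k \in [:: i; j]) && (l \in [:: i; j]).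
Proof. by rewrite /collapse !inE; do !case: ifP; lia. Qed.

Lemma collapse_ltn i j k n : i != j -> (i < n -> j < n -> k < n ->
  collapse i j k < n.-1)%N.
Proof. by rewrite /collapse; do !case: ifP; lia. Qed.

Lemma collapse_surj i j k n : i != j -> (i < n -> j < n -> k < n.-1 ->
  exists2 v, v < n & k = collapse i j v)%N.
Proof.
move=> ij ltin ltjn ltkn; case: (ltnP k (maxn i j)) => ltk.
  by exists k; rewrite /collapse; do ?case: ifP; lia.
by exists k.+1; rewrite /collapse; do ?case: ifP; lia.
Qed.

Lemma collapse_addn n i j k : collapse (n + i) (n + j) (n + k) = (n + collapse i j k)%N.
Proof. by rewrite /collapse; do !case: ifP; lia. Qed.

Lemma collapse_shift n i j k : (i < n)%N -> (j < n)%N ->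
  collapse i j (n + k) = (n.-1 + k)%N.
Proof. by rewrite /collapse; do !case: ifP; lia. Qed.

Lemma collapse_id n i j k : (k < n)%N -> collapse (n + i) (n + j) k = k.
Proof. by rewrite /collapse; do !case: ifP; lia. Qed.

(** To be applied to a regular edge: at most one of its ends is on the circle, so the external
    labels stay distinct after contraction. *)
Lemma collapse_inj_on i j (c : seq nat) : ~~ ((i \in c) && (j \in c)) ->
  {in c &, injective (collapse i j)}.
Proof.
rewrite negb_and => /orP[ic|jc] k l kc lc.
  rewrite !(collapseC i j); apply: collapse_inj; rewrite !inE.
    by apply: contraNneq ic => <-.
  by apply: contraNneq ic => <-.
apply: collapse_inj; rewrite !inE; first by apply: contraNneq jc => <-.
by apply: contraNneq jc => <-.
Qed.

Lemma mem_contract_circle i j c v : uniq c -> i != j -> i \in c -> j \in c ->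
  (collapse i j v \in contract_circle i j c) = (v \in c).
Proof.
move=> Uc ij ic jc; apply/mapP/idP => [[x]|vc].
  rewrite mem_rem_uniq // => /andP[_ xc] /eqP.
  by rewrite collapse_eq // !inE => /orP[/eqP->//|/andP[/orP[]/eqP->]].
have [vj|vj] := eqVneq v j; last by exists v; rewrite // mem_rem_uniq // !inE vj.
by exists i; rewrite ?mem_rem_uniq ?inE ?ij // vj collapsel collapser.
Qed.

Lemma contract_circle_addn n i j c :
  contract_circle (n + i) (n + j) (map (addn n) c) = map (addn n) (contract_circle i j c).
Proof.
rewrite /contract_circle; have -> : rem (n + j)%N (map (addn n) c) = map (addn n) (rem j c).
  by elim: c => //= v c ->; rewrite eqn_add2l; case: ifP.
by rewrite -!map_comp; apply: eq_map => v /=; rewrite collapse_addn.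
Qed.

Lemma contraction_sign_addn n i j :
  contraction_sign (n + i) (n + j) = (n + contraction_sign i j)%N.
Proof. by rewrite /contraction_sign; do !case: ifP; lia. Qed.

Lemma odd_contraction_signC i j : i != j ->
  odd (contraction_sign j i) = ~~ odd (contraction_sign i j).
Proof. by rewrite /contraction_sign; case: ltngtP => //= *; rewrite ?negbK. Qed.

Lemma arcs_neq i j c : uniq c -> (i, j) \in arcs c -> i != j.
Proof.
move=> Uc aij; have [k [d Dc]] := arcsP Uc aij.
by move: Uc; rewrite Dc rot_uniq /= inE negb_or => /andP[/andP[]].
Qed.

(** * Valences under contraction *)

Section Valence.
Variable V : eqType.
Implicit Types (E : seq (V * V)) (e : V * V) (v : V).

(** Stated for an arbitrary type of vertices so as to serve both complexes; [evalence] is an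
    instance by unfolding, and [ovalence] is one through [oedge_ends]. *)
Definition valence E v : nat := (\sum_(e <- E) ((e.1 == v) + (e.2 == v)))%N.

Lemma valence_cat E1 E2 v : valence (E1 ++ E2) v = (valence E1 v + valence E2 v)%N.
Proof. exact: big_cat. Qed.

Lemma perm_valence E1 E2 v : perm_eq E1 E2 -> valence E1 v = valence E2 v.
Proof. by move=> pE; apply: perm_big. Qed.

End Valence.

Definition edge_map (V W : Type) (h : V -> W) (e : V * V) : W * W := (h e.1, h e.2).

Section ValenceMap.
Variables (V W : eqType) (h : V -> W).
Implicit Types (E : seq (V * V)) (e : V * V) (v : V).

Lemma leq_valence_map E v : (valence E v <= valence (map (edge_map h) E) (h v))%N.
Proof.
rewrite /valence big_map; apply: leq_sum => e _ /=.
by apply: leq_add; case: eqP => // ->; rewrite eqxx.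
Qed.

Lemma eq_valence_map E v :
    (forall e, e \in E -> (h e.1 == h v) = (e.1 == v) /\ (h e.2 == h v) = (e.2 == v)) ->
  valence (map (edge_map h) E) (h v) = valence E v.
Proof.
by move=> hE; rewrite /valence big_map !big_seq; apply: eq_bigr => e /hE[/= -> ->].
Qed.

(* [E] lists the edges other than the contracted one. *)
Lemma valence_contract E u v : u != v ->
    (forall f, f \in E -> (h f.1 == h u) = (f.1 == u) || (f.1 == v) /\
                         (h f.2 == h u) = (f.2 == u) || (f.2 == v)) ->
  (valence (map (edge_map h) E) (h u) + 2 =
   valence ((u, v) :: E) u + valence ((u, v) :: E) v)%N.
Proof.
move=> uv hE; have -> : valence (map (edge_map h) E) (h u) =
    (valence E u + valence E v)%N.
  rewrite /valence big_map -big_split !big_seq; apply: eq_bigr => f /hE[/= -> ->].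
  have addb (x : V) : ((x == u) || (x == v)) = ((x == u) + (x == v))%N :> nat.
    by case: (eqVneq x u) => [->|]; rewrite ?(negPf uv).
  by rewrite !addb addnACA.
rewrite /valence !big_cons -!/(valence _ _) /= !eqxx [v == u]eq_sym (negPf uv).
by move: (valence E u) (valence E v) => a b; lia.
Qed.

Lemma valence_contract_other E u v x : x != u -> x != v ->
    (forall f, f \in E -> (h f.1 == h x) = (f.1 == x) /\ (h f.2 == h x) = (f.2 == x)) ->
  valence (map (edge_map h) E) (h x) = valence ((u, v) :: E) x.
Proof.
move=> xu xv hE; rewrite eq_valence_map // [RHS]big_cons /=.
by rewrite ![_ == x]eq_sym (negPf xu) (negPf xv).
Qed.

End ValenceMap.

(* Contracting an edge between vertices of valence [a] and [b], external when [ic]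
   and [jc] respectively, yields a vertex of valence [d], external when [kc]. *)
Lemma contracted_valence (ic jc kc : bool) (a b d : nat) :
  (d + 2 = a + b -> (if ic then 1 else 3) <= a -> (if jc then 1 else 3) <= b ->
   ~~ (ic && jc) -> kc || ~~ ic && ~~ jc -> (if kc then 1 else 3) <= d)%N.
Proof. by case: ic; case: jc; case: kc => //=; lia. Qed.

(** * The odd complex *)

Definition oedge_map (f : nat -> nat) (e : oedge) : oedge :=
  OEdge (f (osrc e)) (f (otgt e)) (orev e).

Definition oedge_ends (e : oedge) : nat * nat := (osrc e, otgt e).

Lemma ovalenceE E v : ovalence E v = valence (map oedge_ends E) v.
Proof. by rewrite /ovalence /valence big_map. Qed.

Lemma oedge_map_inj f : injective f -> injective (oedge_map f).
Proof. by move=> injf [s t r] [s' t' r'] [/injf-> /injf-> ->]. Qed.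

Lemma map_rem (T1 T2 : eqType) (f : T1 -> T2) : injective f ->
  forall x s, rem (f x) (map f s) = map f (rem x s).
Proof. by move=> injf x; elim=> //= y s ->; rewrite inj_eq //; case: ifP. Qed.

Lemma owf_same n c E k E' : perm_eq E' E ->
  owf (OPreGraph n (rot k c) E') = owf (OPreGraph n c E).
Proof.
move=> pE /=; rewrite rot_uniq (eq_all_r (mem_rot k c)) !(eq_all_r (perm_mem pE)).
congr [&& _, _, _, _ & _]; first by apply: eq_all => e; rewrite mem_rot.
by apply: eq_all => v; rewrite mem_rot /ovalence (perm_big _ pE).
Qed.

Lemma owf_orenumber_imp a G : (a.+1 < onum G)%N -> owf G -> owf (orenumber (swp a) G).
Proof.
case: G => n c E /= lt_an /and5P[Uc cn En Erev val]; apply/and5P; split.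
- by rewrite map_inj_uniq //; apply: swp_inj.
- by rewrite all_map; apply: sub_all cn => v /=; rewrite swp_lt.
- by rewrite all_map; apply: sub_all En => e /=; rewrite !swp_lt.
- rewrite all_map; apply: sub_all Erev => e /=.
  by rewrite (inj_eq (@swp_inj a)) (mem_map (@swp_inj a)).
apply/allP => v; rewrite mem_iota /= add0n => ltvn.
have := allP val (swp a v); rewrite mem_iota /= add0n swp_lt // => /(_ ltvn).
rewrite -(mem_map (@swp_inj a)) swpK !ovalenceE -map_comp => le_val.
apply: leq_trans le_val _; have := leq_valence_map (swp a) (map oedge_ends E) (swp a v).
by rewrite swpK -map_comp.
Qed.

Lemma orenumberK a : involutive (orenumber (swp a)).
Proof.
case=> n c E; rewrite /orenumber /= (mapK (swpK a)); congr OPreGraph.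
by apply: (mapK (f := oedge_map (swp a))) => -[s t r]; rewrite /= !swpK.
Qed.

Lemma owf_orenumber a G : (a.+1 < onum G)%N -> owf (orenumber (swp a) G) = owf G.
Proof.
move=> lt_an; apply/idP/idP => [wf|]; last exact: owf_orenumber_imp.
by rewrite -(orenumberK a G); apply: owf_orenumber_imp.
Qed.

Lemma owf_oreverse n c e E :
  owf (OPreGraph n c (oreverse c e :: E)) = owf (OPreGraph n c (e :: E)).
Proof.
rewrite /=; congr [&& _, _, _, _ & _].
- by rewrite [(otgt e < n)%N && _]andbC.
- congr andb; case: e => s t r /=; rewrite [t == s]eq_sym.
  by case: (eqVneq s t) => [->|] //=; case: (t \in c); rewrite ?implybT //= ?implybF.
apply: eq_all => v; rewrite /ovalence !big_cons /oends /=.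
by rewrite [((_ == _) + _)%N]addnC.
Qed.

Lemma osame_endsC : symmetric osame_ends.
Proof.
move=> e f; rewrite /osame_ends ![osrc f == _]eq_sym ![otgt f == _]eq_sym.
by congr orb; rewrite andbC.
Qed.

Lemma pairwise_perm (T : eqType) (r : rel T) s1 s2 : symmetric r ->
  perm_eq s1 s2 -> pairwise r s1 = pairwise r s2.
Proof.
move=> symr; elim: s1 s2 => [|x s1 IH] s2 p12.
  by move: p12; rewrite perm_sym => /perm_nilP->.
have xs2 : x \in s2 by rewrite -(perm_mem p12) mem_head.
case/splitPr: xs2 p12 => p q.
rewrite perm_sym -[x :: q]cat1s perm_catCA /= perm_cons perm_sym => p12.
rewrite pairwise_cat /= (IH _ p12) (perm_all _ p12) all_cat pairwise_cat allrel_consr.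
have -> : all (r^~ x) p = all (r x) p by apply: eq_all => y; rewrite symr.
by case: (all _ p); case: (all _ q); case: allrel => //=; case: pairwise; rewrite ?andbF.
Qed.

Lemma oadmissible_same n c E k E' : perm_eq E' E ->
  oadmissible (OPreGraph n (rot k c) E') = oadmissible (OPreGraph n c E).
Proof.
move=> pE; rewrite /oadmissible /=; congr andb.
  by apply: pairwise_perm => // e f; rewrite osame_endsC.
by rewrite (eq_all_r (perm_mem pE)); apply: eq_all => e; rewrite mem_rot.
Qed.

Lemma oadmissible_orenumber a G : oadmissible (orenumber (swp a) G) = oadmissible G.
Proof.
rewrite /oadmissible /= pairwise_map all_map; congr andb.
  by apply: eq_pairwise => e f; rewrite /= /osame_ends /= !(inj_eq (@swp_inj a)).
by apply: eq_all => e; rewrite /= (inj_eq (@swp_inj a)) (mem_map (@swp_inj a)).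
Qed.

Lemma oadmissible_oreverse n c e E :
  oadmissible (OPreGraph n c (oreverse c e :: E)) = oadmissible (OPreGraph n c (e :: E)).
Proof.
rewrite /oadmissible /=; congr [&& _ && _, _ & _].
  by apply: eq_all => f; rewrite /osame_ends /= orbC; congr (~~ (_ || _)); rewrite andbC.
by rewrite [otgt e == _]eq_sym; case: eqVneq => [->|].
Qed.

Lemma owf_ojoin G1 G2 w : owf G1 -> owf G2 ->
  perm_eq w (ocirc G1 ++ map (addn (onum G1)) (ocirc G2)) -> owf (ojoin G1 G2 w).
Proof.
case: G1 G2 => n1 c1 E1 [n2 c2 E2] /and5P[Uc1 cn1 En1 Erev1 val1].
case/and5P=> Uc2 cn2 En2 Erev2 val2 /= pw.
have w1 v : (v < n1)%N -> (v \in w) = (v \in c1).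
  move=> ltv; rewrite (perm_mem pw) mem_cat orbC; case: mapP => // -[x _ Dv].
  by rewrite Dv ltnNge leq_addr in ltv.
have w2 v : (n1 + v \in w)%N = (v \in c2).
  rewrite (perm_mem pw) mem_cat (mem_map (@addnI n1)).
  by case c1v: (_ \in c1) => //; have := allP cn1 _ c1v; rewrite /= ltnNge leq_addr.
apply/and5P; split.
- rewrite (perm_uniq pw) cat_uniq Uc1 (map_inj_uniq (@addnI n1)) Uc2 andbT /=.
  apply/hasPn => _ /mapP[v _ ->] /=; apply/negP => /(allP cn1) /=.
  by rewrite ltnNge leq_addr.
- rewrite (perm_all _ pw) all_cat all_map; apply/andP; split.
    by apply: sub_all cn1 => v /= ltv; apply: ltn_addr.
  by apply: sub_all cn2 => v /=; rewrite ltn_add2l.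
- rewrite all_cat all_map; apply/andP; split.
    by apply: sub_all En1 => e /= /andP[lts ltt]; rewrite !ltn_addr.
  by apply: sub_all En2 => e /=; rewrite !ltn_add2l.
- rewrite all_cat all_map; apply/andP; split.
    apply/allP => e eE; have := allP Erev1 e eE; rewrite w1 //.
    by have /andP[] := allP En1 e eE.
  by apply: sub_all Erev2 => e /=; rewrite eqn_add2l w2.
apply/allP => v; rewrite mem_iota add0n /= => ltv; rewrite /ovalence big_cat /=.
case: (ltnP v n1) => [ltv1|le1v].
  have := allP val1 v; rewrite mem_iota add0n /= => /(_ ltv1) le_val.
  by rewrite w1 //; apply: leq_trans le_val (leq_addr _ _).
have ltv2 : (v - n1 < n2)%N by rewrite -(ltn_add2l n1) subnKC.
have := allP val2 (v - n1)%N; rewrite mem_iota add0n /= => /(_ ltv2) le_val.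
rewrite -(subnKC le1v) w2; apply: leq_trans le_val _; rewrite big_map.
apply: leq_trans (leq_addl _ _); apply: leq_sum => e _.
by rewrite /oends /= !eqn_add2l.
Qed.

(** Merging vertices cannot lower a valence, and the image of a vertex is external exactly when the
    vertex is. The edges from [j] to [i], on which [orev] gets set, do become loops at an external
    vertex. *)
Lemma owf_ocontract_arc i j G : owf G -> (i, j) \in arcs (ocirc G) ->
  owf (ocontract_arc i j G).
Proof.
case: G => n c E /and5P[Uc cn En Erev val] /= aij.
have ij := arcs_neq Uc aij; have /andP[ic jc] := mem_arcs aij.
have ltin := allP cn i ic; have ltjn := allP cn j jc.
have mem_c v : (collapse i j v \in contract_circle i j c) = (v \in c).
  exact: mem_contract_circle.
apply/and5P; split.
- rewrite /contract_circle map_inj_in_uniq ?rem_uniq //.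
  by apply: sub_in2 (@collapse_inj i j) => v; rewrite mem_rem_uniq // => /andP[].
- apply/allP => _ /mapP[v vc ->]; apply: collapse_ltn => //.
  by apply: (allP cn); apply: mem_rem vc.
- rewrite all_map; apply: sub_all En => e /= /andP[lts ltt].
  by rewrite !collapse_ltn.
- rewrite all_map; apply: sub_all Erev => e /= /implyP er.
  apply/implyP => /orP[/er/andP[/eqP-> tc]|/andP[/eqP-> /eqP->]].
    by rewrite eqxx mem_c.
  by rewrite mem_c jc andbT collapser collapsel.
apply/allP => k; rewrite mem_iota add0n /= => ltk.
have [v ltv ->] := collapse_surj ij ltin ltjn ltk; rewrite mem_c ovalenceE.
have := allP val v; rewrite mem_iota add0n /= ovalenceE => /(_ ltv) le_val.
apply: leq_trans le_val _; rewrite -map_comp.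
have := leq_valence_map (collapse i j) (map oedge_ends E) v.
by rewrite -map_comp.
Qed.

(** The merged vertex loses the two ends of the contracted edge. The bound on its valence survives
    because a regular edge has an internal end, which is at least trivalent; admissibility
    guarantees that the two ends are distinct. *)
Lemma owf_ocontract_edge e G : owf G -> oadmissible G -> e \in oedges G ->
  oregular (ocirc G) e -> owf (ocontract_edge e G).
Proof.
case: G => n c E /and5P[Uc cn En Erev val] /andP[/= pw loops] eE reg.
set i := osrc e; set j := otgt e.
have ij : i != j.
  have := allP loops e eE; rewrite -/i -/j; case: eqVneq => //= eij ic.
  by move: reg; rewrite /oregular -/i -/j -eij ic.
have [ltin ltjn] : (i < n)%N /\ (j < n)%N by have /andP[] := allP En e eE.
have injc : {in c &, injective (collapse i j)} by apply: collapse_inj_on.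
have mem_c v : v \in c -> collapse i j v \in map (collapse i j) c by apply: map_f.
apply/and5P; split; rewrite -/i -/j.
- by rewrite map_inj_in_uniq.
- rewrite all_map; apply/allP => v vc; apply: collapse_ltn => //.
  exact: (allP cn).
- rewrite all_map; apply/allP => f /mem_rem fE /=.
  by have /andP[lts ltt] := allP En f fE; rewrite !collapse_ltn.
- rewrite all_map; apply/allP => f /mem_rem fE /=; have /implyP er := allP Erev f fE.
  by apply/implyP => /er/andP[/eqP-> tc]; rewrite eqxx mem_c.
apply/allP => k; rewrite mem_iota add0n => /= ltk.
have [v ltv ->] := collapse_surj ij ltin ltjn ltk; rewrite ovalenceE.
have -> : map oedge_ends [seq OEdge (collapse i j (osrc f)) (collapse i j (otgt f)) (orev f)
                         | f <- rem e E] =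
          map (edge_map (collapse i j)) (map oedge_ends (rem e E)).
  by rewrite -!map_comp.
set E0 := map oedge_ends (rem e E).
have pE : perm_eq (map oedge_ends E) ((i, j) :: E0) by apply: perm_map (perm_to_rem eE).
have valP x : (x < n)%N -> ((if x \in c then 1 else 3) <= valence ((i, j) :: E0) x)%N.
  move=> ltx; have := allP val x; rewrite mem_iota add0n /= ovalenceE.
  by rewrite -(perm_valence _ pE); apply.
case v_ij: (v \in [:: i; j]); last first.
  rewrite (@valence_contract_other _ _ _ _ i j); first last.
  - by move=> f _; rewrite !collapse_eq // v_ij !andbF !orbF.
  - by move: v_ij; rewrite !inE => /norP[].
  - by move: v_ij; rewrite !inE => /norP[].
  apply: leq_trans (valP v ltv).
  case: ifP => vc'; first by case: ifP.
  by case: ifP => // vc; rewrite mem_c in vc'.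
have -> : collapse i j v = collapse i j i.
  by apply/eqP; rewrite collapse_eq // v_ij !inE eqxx orbT.
have : (valence (map (edge_map (collapse i j)) E0) (collapse i j i) + 2 =
        valence ((i, j) :: E0) i + valence ((i, j) :: E0) j)%N.
  apply: valence_contract => // f _.
  by rewrite !collapse_eq // !inE eqxx /= !andbT !orbA !orbb.
move/contracted_valence; apply; [exact: valP|exact: valP|exact: reg|].
rewrite -negb_or; case: (boolP (i \in c)) => [/mem_c->//|_].
by case: (boolP (j \in c)) => [/mem_c|_]; rewrite ?orbT // collapser collapsel => ->.
Qed.

(** * The odd complex: relations and the maps compatible with them *)

Section OddRelations.
Variable R : realType.
Local Notation oD := (oD R).
Local Notation gen G := (<< G >> : {malg R[ograph]}).

Lemma oclassE (G : ograph) : oclass R G = qclass (@orel R) (gen G).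
Proof. by rewrite /oclass valK. Qed.

(** If neither graph is well formed, both classes are 0; so a relation between raw graphs only
    requires them to be well formed together. *)
Lemma oclass_rel (a : R) (P Q : opregraph) : owf P = owf Q ->
  (forall G H : ograph, G = P :> opregraph -> H = Q :> opregraph ->
     orel (gen H - a *: gen G)) ->
  oclass R Q = a *: oclass R P.
Proof.
move=> eq_wf rel; rewrite /oclass; case: insubP => [H wfQ DH|nwfQ]; last first.
  by rewrite insubF ?scaler0 // eq_wf (negPf nwfQ).
rewrite -eq_wf in wfQ; rewrite (insubT owf wfQ) -linearZ; apply/qclass_eq.
rewrite -[X in Defs.span _ X]addr0 -[X in X + _]scale1r.
by apply: span_cons; [exact: rel | exact: span_zero].
Qed.

Lemma oclass_same n c E k E' : perm_eq E' E ->
  oclass R (OPreGraph n (rot k c) E') = oclass R (OPreGraph n c E).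
Proof.
move=> pE; rewrite -[RHS]scale1r; apply: oclass_rel => [|G H DG DH].
  by rewrite (owf_same _ _ _ pE).
by rewrite scale1r; apply: (@orel_same _ _ _ k); rewrite DG DH.
Qed.

Lemma oclass_orenumber a G : (a.+1 < onum G)%N ->
  oclass R (orenumber (swp a) G) = - oclass R G.
Proof.
move=> lt_an; rewrite -scaleN1r; apply: oclass_rel => [|P H DP DH].
  by rewrite owf_orenumber.
have lta : (a < onum P)%N by rewrite DP; apply: ltnW.
have lta' : (a.+1 < onum P)%N by rewrite DP.
have D1 : Ordinal lta' = (Ordinal lta).+1 :> nat by [].
have := @orel_renumber R P H (tperm (Ordinal lta) (Ordinal lta')).
rewrite (odd_tperm_adjacent D1) expr1; apply; rewrite DH -DP.
have st := perm_nat_tperm D1; rewrite /orenumber; congr OPreGraph.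
  by apply: eq_map => v; rewrite st.
by apply: eq_map => e; rewrite !st.
Qed.

Lemma oclass_oreverse n c e E :
  oclass R (OPreGraph n c (oreverse c e :: E)) = - oclass R (OPreGraph n c (e :: E)).
Proof.
rewrite -scaleN1r; apply: oclass_rel => [|G H DG DH]; first by rewrite owf_oreverse.
by rewrite scaleN1r opprK; apply: (@orel_reverse _ _ _ [::] e E); rewrite DG ?DH.
Qed.

Lemma oclass_inadmissible G : ~~ oadmissible G -> oclass R G = 0.
Proof.
move=> nadm; rewrite -[RHS](scale0r (oclass R G)); apply: oclass_rel => // P H DP DH.
by rewrite scale0r subr0; apply: orel_inadmissible; rewrite DH.
Qed.

(* Adjacent transpositions of labels generate all the renumberings. *)
Record ocompatible (M : lmodType R) (f : opregraph -> M) : Prop := OCompatible {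
  ocompatible_same n c E k E' : owf (OPreGraph n c E) -> perm_eq E' E ->
    f (OPreGraph n (rot k c) E') = f (OPreGraph n c E);
  ocompatible_orenumber a G : owf G -> (a.+1 < onum G)%N ->
    f (orenumber (swp a) G) = - f G;
  ocompatible_oreverse n c e E : owf (OPreGraph n c (e :: E)) ->
    f (OPreGraph n c (oreverse c e :: E)) = - f (OPreGraph n c (e :: E));
  ocompatible_inadmissible G : owf G -> ~~ oadmissible G -> f G = 0 }.

Lemma ocompatible_perm (M : lmodType R) (f : opregraph -> M) G (s : 'S_(onum G)) :
    ocompatible f -> owf G ->
  f (orenumber (perm_nat s) G) = (-1) ^+ s *: f G.
Proof.
(* The graph is generalized and its well-formedness is carried along, because the second factor of a
   product acts on the graph already renumbered by the first. *)
move=> fP wfG; suff H n : forall (s : 'S_n) G, onum G = n -> owf G ->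
    owf (orenumber (perm_nat s) G) /\
    f (orenumber (perm_nat s) G) = (-1) ^+ s *: f G by case: (H _ s G).
elim/perm_adjacent_ind => [|t u IHt IHu|i j Dj] {s wfG}{}G DG wfG.
- suff -> : orenumber (perm_nat (1 : 'S_n)%g) G = G.
    by rewrite odd_perm1 expr0 scale1r.
  case: (G) => m c E; rewrite /orenumber /= -[RHS]/(OPreGraph m c E); congr OPreGraph.
    by rewrite -[RHS]map_id; apply: eq_map => v; rewrite perm_nat1.
  by rewrite -[RHS]map_id; apply: eq_map => -[a b r]; rewrite /= !perm_nat1.
- have [wft ft] := IHt G DG wfG; have [wfu fu] := IHu (orenumber _ G) DG wft.
  have -> : orenumber (perm_nat (t * u)%g) G =
            orenumber (perm_nat u) (orenumber (perm_nat t) G).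
    rewrite /orenumber /=; congr OPreGraph; rewrite -map_comp; apply: eq_map => v /=.
      by rewrite perm_natM.
    by rewrite !perm_natM.
  by rewrite wfu fu ft scalerA odd_permM signr_addb mulrC.
have -> : orenumber (perm_nat (tperm i j)) G = orenumber (swp i) G.
  by congr OPreGraph; apply: eq_map => v; rewrite !(perm_nat_tperm Dj).
have lti : (i.+1 < onum G)%N by rewrite DG -Dj.
by rewrite owf_orenumber // ocompatible_orenumber // odd_tperm_adjacent // scaleN1r.
Qed.

Lemma ocompatible_kills (M : lmodType R) (f : opregraph -> M) : ocompatible f ->
  forall b : {malg R[ograph]}, orel b -> lext (fun G : ograph => f G) b = 0.
Proof.
move=> fP b; case=> {b}.
- move=> G H k Dn Dc pE; rewrite lextB !lextU; have : owf (ograph_val G) := valP G.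
  move: Dn Dc pE; case: (ograph_val G) => n c E; case: (ograph_val H) => n' c' E'.
  by move=> /= -> -> pE wfG; rewrite (ocompatible_same fP _ wfG pE) subrr.
- move=> G H s DH; rewrite lextB lextZ !lextU DH ocompatible_perm ?subrr //; exact: valP.
- move=> G H E1 e E2 DE DH; rewrite lextD !lextU {}DH; have : owf (ograph_val G) := valP G.
  move: DE; case: (ograph_val G) => n c E DE; rewrite [E]DE => wfG.
  (* Compatibility is stated for reversing the first edge of the list; an edge at any position is
     brought there by reordering. *)
  have pE e' : perm_eq (E1 ++ e' :: E2) (e' :: E1 ++ E2) := permEl (perm_catCA E1 [:: e'] E2).
  have wfe : owf (OPreGraph n c (e :: E1 ++ E2)).
    by rewrite -(rot0 c) (owf_same _ _ _ (pE e)) in wfG.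
  have move_e e' : owf (OPreGraph n c (e' :: E1 ++ E2)) ->
      f (OPreGraph n c (E1 ++ e' :: E2)) = f (OPreGraph n c (e' :: E1 ++ E2)).
    by move/(ocompatible_same fP 0)=> /(_ _ (pE e')); rewrite rot0.
  by rewrite /= !move_e ?owf_oreverse // ocompatible_oreverse // addNr.
move=> G nadm; rewrite lextU ocompatible_inadmissible //; exact: valP.
Qed.
End OddRelations.

(** * The odd complex: the coboundary respects the relations *)

Lemma perm_eq_rem (T : eqType) (x : T) s1 s2 :
  perm_eq s1 s2 -> perm_eq (rem x s1) (rem x s2).
Proof.
move=> p12; apply/seq.permP => p.
by rewrite !count_rem (perm_mem p12) (seq.permP p12).
Qed.

(** Separating the setting of [orev] from the relabelling gives arcs and edges the same form, to
    which [oclass_collapse_swp] applies. *)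
Lemma ocontract_arcE i j n c E : ocontract_arc i j (OPreGraph n c E) =
  OPreGraph n.-1 (map (collapse i j) (rem j c))
    (map (oedge_map (collapse i j))
       [seq OEdge (osrc e) (otgt e) (orev e || (osrc e == j) && (otgt e == i)) | e <- E]).
Proof. by rewrite -map_comp. Qed.

Lemma ocontract_edgeE e n c E : ocontract_edge e (OPreGraph n c E) =
  OPreGraph n.-1 (map (collapse (osrc e) (otgt e)) c)
    (map (oedge_map (collapse (osrc e) (otgt e))) (rem e E)).
Proof. by []. Qed.

Lemma oregular_swp a c e :
  oregular (map (swp a) c) (oedge_map (swp a) e) = oregular c e.
Proof. by rewrite /oregular /= !(mem_map (@swp_inj a)). Qed.

Lemma oregular_neq G e : oadmissible G -> e \in oedges G -> oregular (ocirc G) e ->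
  osrc e != otgt e.
Proof.
case/andP=> _ /allP loops eE; apply: contraTneq => eq_e; have := loops e eE.
by rewrite /oregular -eq_e eqxx /= => ->.
Qed.

Lemma signr_eq_odd (R : pzRingType) m n : odd m = odd n -> (-1) ^+ m = (-1) ^+ n :> R.
Proof. by move=> e; rewrite -signr_odd e signr_odd. Qed.

Lemma signr_oddN (R : pzRingType) m n : odd m = ~~ odd n -> (-1) ^+ m = - (-1) ^+ n :> R.
Proof. by move=> e; rewrite -signr_odd e signrN signr_odd. Qed.

Section OddDelta.
Variable R : realType.

(** In each case of [contraction_sign_swp] exactly one factor changes sign: the coefficient when the
    transposition is absorbed, the class when it survives. *)
Lemma oclass_collapse_swp a i j n c (E : seq oedge) :
    (a.+1 < n)%N -> (i < n)%N -> (j < n)%N -> i != j ->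
  (-1) ^+ contraction_sign (swp a i) (swp a j) *:
    oclass R (OPreGraph n.-1 (map (collapse (swp a i) (swp a j)) (map (swp a) c))
      (map (oedge_map (collapse (swp a i) (swp a j))) (map (oedge_map (swp a)) E))) =
  - ((-1) ^+ contraction_sign i j *:
       oclass R (OPreGraph n.-1 (map (collapse i j) c)
                               (map (oedge_map (collapse i j)) E))).
Proof.
move=> lta lti ltj ij; rewrite -!map_comp.
case: (contraction_sign_swp a ij) => [[odds eqc]|[odds [b eqc ltb]]].
  rewrite (signr_oddN _ odds) scaleNr; congr (- (_ *: oclass R (OPreGraph _ _ _))).
    by apply: eq_map => v /=; rewrite eqc.
  by apply: eq_map => e; rewrite /oedge_map /= !eqc.
rewrite (signr_eq_odd _ odds) -scalerN -(@oclass_orenumber _ b); last exact: ltb.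
congr (_ *: oclass R (OPreGraph _ _ _)); rewrite -map_comp; apply: eq_map => v /=.
  by rewrite eqc.
by rewrite /oedge_map /= !eqc.
Qed.

Lemma odelta_same n c E k E' : owf (OPreGraph n c E) -> perm_eq E' E ->
  odelta_graph R (OPreGraph n (rot k c) E') = odelta_graph R (OPreGraph n c E).
Proof.
move=> /and5P[Uc _ _ _ _] pE; rewrite /odelta_graph (oadmissible_same _ _ _ pE).
case: ifP => // adm; congr (_ + _).
  rewrite (perm_big _ (perm_arcs_rot k Uc)); apply: eq_bigr => -[i j] _ /=.
  have [m] := contract_circle_rot k i j Uc; rewrite /ocontract_arc /= => ->.
  by rewrite (oclass_same _ _ _ _ (perm_map _ pE)).
rewrite (perm_big _ pE); apply: eq_big => [e|e _] /=.
  by rewrite /oregular !mem_rot.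
by rewrite !ocontract_edgeE map_rot (oclass_same _ _ _ _ (perm_map _ (perm_eq_rem _ pE))).
Qed.

Lemma odelta_orenumber a G : owf G -> (a.+1 < onum G)%N ->
  odelta_graph R (orenumber (swp a) G) = - odelta_graph R G.
Proof.
case: G => n c E wfG lta; rewrite /odelta_graph oadmissible_orenumber.
have /and5P[Uc cn En _ _] := wfG; case: ifP => [adm|]; last by rewrite oppr0.
rewrite opprD -!sumrN; congr (_ + _).
  rewrite /= (arcs_map (@swp_inj a) Uc) big_map big_seq [RHS]big_seq.
  apply: eq_bigr => -[i j] aij /=; have /andP[ic jc] := mem_arcs aij.
  rewrite -[orenumber _ _]/(OPreGraph n (map (swp a) c) (map (oedge_map (swp a)) E)).
  rewrite !ocontract_arcE (map_rem (@swp_inj a)) -(@oclass_collapse_swp a) //.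
  - congr (_ *: oclass R (OPreGraph _ _ (map _ _))); rewrite -!map_comp.
    by apply: eq_map => e; rewrite /oedge_map /= !(inj_eq (@swp_inj a)).
  - exact: (allP cn).
  - exact: (allP cn).
  exact: arcs_neq aij.
rewrite /= big_map big_seq_cond [RHS]big_seq_cond; apply: eq_big => [e|e].
  by rewrite -/(oedge_map (swp a) e) oregular_swp.
rewrite -/(oedge_map (swp a) e) oregular_swp => /andP[eE reg].
have /andP[lts ltt] := allP En e eE.
rewrite -[orenumber _ _]/(OPreGraph n (map (swp a) c) (map (oedge_map (swp a)) E)).
rewrite !ocontract_edgeE (map_rem (oedge_map_inj (@swp_inj a))).
by rewrite oclass_collapse_swp // (oregular_neq adm eE reg).
Qed.

(** Contracting an arc or another edge commutes with the reversal of [e], whose sign then comes from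
    the contracted graph. Contracting [e] itself gives the same graph with either orientation, and
    the sign of the contraction changes. *)
Lemma odelta_oreverse n c e E : owf (OPreGraph n c (e :: E)) ->
  odelta_graph R (OPreGraph n c (oreverse c e :: E)) =
  - odelta_graph R (OPreGraph n c (e :: E)).
Proof.
move=> wfG; rewrite /odelta_graph oadmissible_oreverse.
have /and5P[Uc cn En Erev _] := wfG; case: ifP => [adm|]; last by rewrite oppr0.
have adm' : oadmissible (OPreGraph n c (oreverse c e :: E)) by rewrite oadmissible_oreverse.
have /implyP er : orev e ==> (osrc e == otgt e) && (osrc e \in c) by case/andP: Erev.
have notin (f f' : oedge) : oadmissible (OPreGraph n c (f' :: E)) -> f \in E ->
    ~~ osame_ends f' f.
  by case/andP=> /andP[/allP h _] _ /h.
(* Since no two edges are parallel, neither [e] nor its reverse occurs in [E]; hence [rem f] leaves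
   the head of the list in place. *)
have notin' (f f' : oedge) : oadmissible (OPreGraph n c (f' :: E)) -> f \in E ->
    f' != f.
  move=> h1 h2; apply: contraNneq (notin _ _ h1 h2) => ->.
  by rewrite /osame_ends !eqxx.
rewrite opprD -!sumrN; congr (_ + _).
  rewrite /= big_seq [RHS]big_seq; apply: eq_bigr => -[i j] aij /=.
  have ij := arcs_neq Uc aij; have /andP[ic jc] := mem_arcs aij.
  rewrite -scalerN -oclass_oreverse /ocontract_arc /=.
  congr (_ *: oclass R (OPreGraph _ _ (_ :: _))).
  rewrite /oreverse /= mem_contract_circle // collapse_eq //.
  (* The two [orev] marks have to agree. An edge joining [i] and [j] becomes a loop, and reversing
     it before contraction exchanges the outcomes of the test for running from [j] to [i], just as
     [oreverse] toggles the mark of the loop. A former loop fails this test, as [i] and [j]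
     differ. *)
  move: er; case: (e) => s t r /= er; congr OEdge.
  have [est|nst] /= := eqVneq s t.
    move: er; rewrite est eqxx /=; case: (t \in c) => /=.
      move=> _; case: (eqVneq t i) => [->|] /=; last by rewrite !andbF !orbF.
      by rewrite (negPf ij) /= !orbF.
    by move=> er; case: (eqVneq t j) => //= ->; rewrite eq_sym (negPf ij) andbF.
  have -> : r = false by apply/negP => /er; rewrite (negPf nst).
  rewrite /= !inE; case: (eqVneq s i) => [si|si].
    rewrite si in nst *; rewrite (negPf ij) ic !andbT /= [t == i]eq_sym (negPf nst) /=.
    by case: (t == j).
  case: (eqVneq s j) => [sj|sj] /=; last by rewrite andbF.
  rewrite sj in nst *; rewrite [t == j]eq_sym (negPf nst) orbF jc andbT /=.
  by case: (t == i).
have regE : oregular c (oreverse c e) = oregular c e by rewrite /oregular /= andbC.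
rewrite /= !big_cons regE.
have tail : \sum_(f <- E | oregular c f) (-1) ^+ contraction_sign (osrc f) (otgt f) *:
      oclass R (ocontract_edge f (OPreGraph n c (oreverse c e :: E))) =
    \sum_(f <- E | oregular c f) - ((-1) ^+ contraction_sign (osrc f) (otgt f) *:
      oclass R (ocontract_edge f (OPreGraph n c (e :: E)))).
  rewrite big_seq_cond [RHS]big_seq_cond; apply: eq_bigr => f /andP[fE reg].
  have fG : f \in e :: E by rewrite inE fE orbT.
  have neq := oregular_neq adm fG reg.
  rewrite !ocontract_edgeE /= (negPf (notin' _ _ adm fE)) (negPf (notin' _ _ adm' fE)) /=.
  rewrite -scalerN -oclass_oreverse.
  congr (_ *: oclass R (OPreGraph _ _ (_ :: _))).
  (* No edge is parallel to the contracted edge [f], so that contracting [f] creates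
     no loop whose half-edges would have to be reordered. *)
  have /= nsame := notin _ _ adm fE.
  rewrite /oreverse /oedge_map /= collapse_eq //; congr OEdge.
  have [est|nst] /= := eqVneq (osrc e) (otgt e).
    have ec : osrc e \in c by have /andP[_ /andP[/implyP + _]] := adm; apply; rewrite est.
    by rewrite ec map_f.
  suff -> : (osrc e \in [:: osrc f; otgt f]) && (otgt e \in [:: osrc f; otgt f]) = false by [].
  apply: contraNF nsame; rewrite !inE /osame_ends.
  case/andP=> /orP[]/eqP es /orP[]/eqP et; rewrite es et ?eqxx ?orbT //.
    by rewrite es et eqxx in nst.
  by rewrite es et eqxx in nst.
rewrite tail; case: ifP => // reg; congr (_ + _).
(* The remaining term is the contraction of the reversed edge itself. *)
have neq : osrc e != otgt e by apply: (oregular_neq adm) => //; apply: mem_head.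
rewrite !ocontract_edgeE /= !eqxx -scaleNr; congr (_ *: oclass R (OPreGraph _ _ _)).
- by apply: signr_oddN; apply: odd_contraction_signC.
- by apply: eq_map => v; rewrite collapseC.
by apply: eq_map => f; rewrite /oedge_map !(collapseC (otgt e)).
Qed.
End OddDelta.

(** * The odd complex: the shuffle product respects the relations *)

Section OddJoin.
Variables (n1 n2 : nat) (c1 c2 : seq nat) (E1 E2 : seq oedge).
Local Notation G1 := (OPreGraph n1 c1 E1).
Local Notation G2 := (OPreGraph n2 c2 E2).
Hypotheses (wf1 : owf G1) (wf2 : owf G2).
Local Notation c2' := (map (addn n1) c2).

Lemma ojoin_circ_uniq : uniq (c1 ++ c2').
Proof.
have /and5P[Uc1 cn1 _ _ _] := wf1; have /and5P[Uc2 _ _ _ _] := wf2.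
rewrite cat_uniq Uc1 (map_inj_uniq (@addnI n1)) Uc2 andbT /=.
apply/hasPn => _ /mapP[v _ ->] /=; apply/negP => /(allP cn1) /=.
by rewrite ltnNge leq_addr.
Qed.

Variable w : seq nat.
Hypothesis w_sh : w \in oshuffles G1 G2.

Lemma oshuffle_perm : perm_eq w (c1 ++ c2').
Proof. by move: w_sh; rewrite mem_cyclic_shuffles => /andP[_ /and3P[]]. Qed.

Lemma mem_oshuffle_left v : (v < n1)%N -> (v \in w) = (v \in c1).
Proof.
move=> ltv; rewrite (perm_mem oshuffle_perm) mem_cat orbC; case: mapP => // -[x _ Dv].
by rewrite Dv ltnNge leq_addr in ltv.
Qed.

Lemma mem_oshuffle_right v : (n1 + v \in w)%N = (v \in c2).
Proof.
rewrite (perm_mem oshuffle_perm) mem_cat (mem_map (@addnI n1)).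
have /and5P[_ cn1 _ _ _] := wf1.
by case c1v: (_ \in c1) => //; have := allP cn1 _ c1v; rewrite /= ltnNge leq_addr.
Qed.

Lemma owf_oshuffle : owf (ojoin G1 G2 w).
Proof. by apply: owf_ojoin => //; apply: oshuffle_perm. Qed.

(** The labels of the second factor are shifted beyond those of the first, so no edge of one factor
    is parallel to an edge of the other. *)
Lemma oadmissible_ojoin :
  oadmissible (ojoin G1 G2 w) = oadmissible G1 && oadmissible G2.
Proof.
have /and5P[_ _ En1 _ _] := wf1.
rewrite /oadmissible /= pairwise_cat all_cat pairwise_map all_map.
have -> : allrel (fun e f => ~~ osame_ends e f) E1
    [seq OEdge (n1 + osrc e) (n1 + otgt e) (orev e) | e <- E2].
  apply/allrelP => e _ /(allP En1)/andP[lts ltt] /mapP[f _ ->].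
  rewrite /osame_ends /=; apply/negP.
  by case/orP=> /andP[/eqP es /eqP et]; move: lts ltt; rewrite es et !ltnNge !leq_addr.
have -> : pairwise (relpre (fun e => OEdge (n1 + osrc e) (n1 + otgt e) (orev e))
    (fun e f => ~~ osame_ends e f)) E2 = pairwise (fun e f => ~~ osame_ends e f) E2.
  by apply: eq_pairwise => e f; rewrite /= /osame_ends /= !eqn_add2l.
have -> : all (fun e => (osrc e == otgt e) ==> (osrc e \in w)) E1 =
          all (fun e => (osrc e == otgt e) ==> (osrc e \in c1)) E1.
  apply: eq_in_all => e /(allP En1)/andP[lts _]; by rewrite mem_oshuffle_left.
have -> : all (preim (fun e => OEdge (n1 + osrc e) (n1 + otgt e) (orev e))
    (fun e => (osrc e == otgt e) ==> (osrc e \in w))) E2 =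
    all (fun e => (osrc e == otgt e) ==> (osrc e \in c2)) E2.
  by apply: eq_all => e; rewrite /= eqn_add2l mem_oshuffle_right.
by rewrite /= andbACA.
Qed.
End OddJoin.

Section OddShuffle.
Variable R : realType.

Lemma oclass_rot n c E k : oclass R (OPreGraph n (rot k c) E) = oclass R (OPreGraph n c E).
Proof. exact: oclass_same. Qed.

Lemma oclass_perm n c E E' : perm_eq E' E ->
  oclass R (OPreGraph n c E') = oclass R (OPreGraph n c E).
Proof. by move=> pE; rewrite -{1}(rot0 c); apply: oclass_same. Qed.

Lemma odelta_compatible : ocompatible (odelta_graph R).
Proof.
split; [exact: odelta_same|exact: odelta_orenumber|exact: odelta_oreverse|].
by move=> G _ nadm; rewrite /odelta_graph (negPf nadm).
Qed.

(** A transposition of labels of the first factor fixes the shifted labels of the second, so it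
    renumbers each joined graph by one adjacent transposition. *)
Lemma oshuffle_compatiblel G2 : owf G2 ->
  ocompatible (fun G1 => oshuffle_graph R G1 G2).
Proof.
case: G2 => n2 c2 E2 wf2; split.
- move=> n c E k E' wf1 pE; rewrite /oshuffle_graph /oshuffles /=.
  rewrite sum_cyclic_shuffles_rotl; last by move=> m w _; apply: oclass_rot.
    by apply: eq_bigr => w _; apply: oclass_perm; rewrite /= perm_cat2r.
  exact: ojoin_circ_uniq wf1 wf2.
- move=> a [n c E] wf1 /= lta; rewrite /oshuffle_graph /oshuffles /=.
  have -> : map (addn n) c2 = map (swp a) (map (addn n) c2).
    by rewrite -map_comp; apply: eq_map => v /=; rewrite (@swp_ge a n) // leq_addr.
  rewrite sum_cyclic_shuffles_map; last by move=> v v' _ _; apply: swp_inj.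
  rewrite -sumrN; have -> : map (swp a) (map (addn n) c2) = map (addn n) c2.
    by rewrite -map_comp; apply: eq_map => v /=; rewrite (@swp_ge a n) // leq_addr.
  apply: eq_bigr => w _; rewrite -(@oclass_orenumber _ a) /=; last exact: ltn_addr.
  congr (oclass R (OPreGraph _ _ _)); rewrite map_cat -[in RHS]map_comp.
  by congr cat; apply: eq_map => e; rewrite /= !(@swp_ge a n) // leq_addr.
- move=> n c e E wf1; rewrite /oshuffle_graph -sumrN big_seq [RHS]big_seq.
  apply: eq_bigr => w w_sh; rewrite -oclass_oreverse.
  congr (oclass R (OPreGraph _ _ (_ :: _))); rewrite /oreverse.
  have /and5P[_ _ /=/andP[/andP[lts _] _] _ _] := wf1.
  by rewrite (mem_oshuffle_left w_sh lts).
case=> n c E wf1 nadm; rewrite /oshuffle_graph big_seq big1 // => w w_sh.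
by apply: oclass_inadmissible; rewrite (oadmissible_ojoin wf1 w_sh) // (negPf nadm).
Qed.

Lemma oshuffle_compatibler G1 : owf G1 ->
  ocompatible (fun G2 => oshuffle_graph R G1 G2).
Proof.
case: G1 => n1 c1 E1 wf1; split.
- move=> n c E k E' wf2 pE; rewrite /oshuffle_graph /oshuffles /= map_rot.
  have Uc := ojoin_circ_uniq wf1 wf2; have Uc' := Uc; rewrite uniq_catC in Uc'.
  have Uck : uniq (c1 ++ rot k (map (addn n1) c)).
    by rewrite (perm_uniq (s2 := c1 ++ map (addn n1) c)) // perm_cat2l perm_rot.
  have rotF G G' m (w : seq nat) : uniq w ->
    oclass R (ojoin G G' (rot m w)) = oclass R (ojoin G G' w).
    by move=> _; apply: oclass_rot.
  (* Invariance under rotation is known for the first circle, hence the two exchanges around it. *)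
  rewrite [LHS](sum_cyclic_shufflesC Uck (rotF _ _)).
  rewrite (sum_cyclic_shuffles_rotl _ Uc' (rotF _ _)).
  rewrite [LHS](sum_cyclic_shufflesC Uc' (rotF _ _)).
  by apply: eq_bigr => w _; apply: oclass_perm; rewrite /= perm_cat2l perm_map.
- move=> a [n c E] wf2 /= lta; rewrite /oshuffle_graph /oshuffles /=.
  have swc1 : map (swp (n1 + a)) c1 = c1.
    rewrite -[RHS]map_id; apply/eq_in_map => v vc; apply: swp_lt_id.
    by have /and5P[_ /allP/(_ v vc) ltv _ _ _] := wf1; apply: ltn_addr.
  have -> : map (addn n1) (map (swp a) c) = map (swp (n1 + a)) (map (addn n1) c).
    by rewrite -!map_comp; apply: eq_map => v /=; rewrite swp_addn.
  rewrite -{1}swc1 sum_cyclic_shuffles_map; last by move=> v v' _ _; apply: swp_inj.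
  rewrite -sumrN; apply: eq_bigr => w _.
  rewrite -(@oclass_orenumber _ (n1 + a)%N) /=; last by rewrite -addnS ltn_add2l.
  congr (oclass R (OPreGraph _ _ _)); rewrite map_cat -!map_comp; congr cat.
    rewrite -[LHS]map_id; apply/eq_in_map => -[s t r] eE /=.
    have /and5P[_ _ /allP/(_ _ eE)/=/andP[lts ltt] _ _] := wf1.
    by rewrite !swp_lt_id // ltn_addr.
  by apply: eq_map => e; rewrite /= !swp_addn.
- move=> n c e E wf2; rewrite /oshuffle_graph -sumrN big_seq [RHS]big_seq.
  apply: eq_bigr => w w_sh; rewrite /ojoin /=.
  rewrite (oclass_perm _ _ (permEl (perm_catCA _ [:: _] _))) /=.
  rewrite [in RHS](oclass_perm _ _ (permEl (perm_catCA _ [:: _] _))) /=.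
  rewrite -oclass_oreverse; congr (oclass R (OPreGraph _ _ (_ :: _))).
  by rewrite /oreverse /= eqn_add2l (mem_oshuffle_right wf1 w_sh).
case=> n c E wf2 nadm; rewrite /oshuffle_graph big_seq big1 // => w w_sh.
by apply: oclass_inadmissible; rewrite (oadmissible_ojoin wf1 w_sh) // (negPf nadm) andbF.
Qed.
End OddShuffle.

(** * The odd complex: the Leibniz rule for two graphs *)

Lemma rem_catl (T : eqType) (x : T) s1 s2 : x \in s1 -> rem x (s1 ++ s2) = rem x s1 ++ s2.
Proof.
by elim: s1 => //= y s IH; rewrite inE; case: eqVneq => //= _ /IH->.
Qed.

Lemma rem_catr (T : eqType) (x : T) s1 s2 : x \notin s1 -> rem x (s1 ++ s2) = s1 ++ rem x s2.
Proof.
elim: s1 => //= y s IH; rewrite inE negb_or => /andP[xy /IH->].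
by rewrite eq_sym (negPf xy).
Qed.

Section OddLeibniz.
Variables (R : realType) (n1 n2 : nat) (c1 c2 : seq nat) (E1 E2 : seq oedge).
Local Notation G1 := (OPreGraph n1 c1 E1).
Local Notation G2 := (OPreGraph n2 c2 E2).
Hypotheses (wf1 : owf G1) (wf2 : owf G2).
Hypotheses (adm1 : oadmissible G1) (adm2 : oadmissible G2).

Definition oshift n (e : oedge) := OEdge (n + osrc e) (n + otgt e) (orev e).

Let c2' := map (addn n1) c2.
Let E2' := map (oshift n1) E2.

Let lt1 e : e \in E1 -> (osrc e < n1)%N && (otgt e < n1)%N.
Proof. by have /and5P[_ _ /allP En _ _] := wf1; apply: En. Qed.

Let ltc1 v : v \in c1 -> (v < n1)%N.
Proof. by have /and5P[_ /allP cn _ _ _] := wf1; apply: cn. Qed.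

Let oshift_inj : injective (oshift n1).
Proof. by move=> [s t r] [s' t' r'] [/addnI-> /addnI-> ->]. Qed.

Let arc_edge i j e := OEdge (collapse i j (osrc e)) (collapse i j (otgt e))
  (orev e || (osrc e == j) && (otgt e == i)).

Let arc_edge_fresh i j e : (i < n1)%N -> (j < n1)%N ->
  arc_edge i j (oshift n1 e) = oshift n1.-1 e.
Proof.
move=> lti ltj; rewrite /arc_edge /oshift /= !collapse_shift //.
by rewrite [(_ == j)]gtn_eqF ?andFb ?orbF // ltn_addr.
Qed.

Let ojoin_contract_arcl i j w : (i, j) \in arcs c1 ->
  OPreGraph (n1 + n2).-1 w (map (arc_edge i j) (E1 ++ E2')) =
  ojoin (ocontract_arc i j G1) G2 w.
Proof.
case/mem_arcs/andP=> /ltc1 lti /ltc1 ltj; rewrite /ojoin /=; congr OPreGraph.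
  by case: (n1) lti.
rewrite map_cat; congr cat; rewrite -map_comp; apply: eq_map => e.
exact: arc_edge_fresh.
Qed.

Let ojoin_contract_arcr i j w : (i, j) \in arcs c2 ->
  OPreGraph (n1 + n2).-1 w (map (arc_edge (n1 + i) (n1 + j)) (E1 ++ E2')) =
  ojoin G1 (ocontract_arc i j G2) w.
Proof.
case/mem_arcs/andP=> ic2 jc2; rewrite /ojoin /=; congr OPreGraph.
  have /and5P[_ /allP/(_ _ ic2) lti _ _ _] := wf2.
  by case: (n2) lti => // m _; rewrite addnS.
rewrite map_cat -!map_comp; congr cat.
  rewrite -[RHS]map_id; apply/eq_in_map => -[s t r] /lt1/andP[/= lts ltt].
  rewrite /arc_edge /= !collapse_id //.
  by rewrite [s == _]ltn_eqF ?andFb ?orbF // ltn_addr.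
apply: eq_map => e; rewrite /arc_edge /= !collapse_addn.
by rewrite !eqn_add2l.
Qed.

Let ojoin_contract_edgel e w : e \in E1 ->
  ocontract_edge e (ojoin G1 G2 w) =
  ojoin (ocontract_edge e G1) G2 (map (collapse (osrc e) (otgt e)) w).
Proof.
move=> eE; have /andP[lts ltt] := lt1 eE.
rewrite /ojoin ocontract_edgeE /=; congr OPreGraph; first by case: (n1) lts.
rewrite rem_catl // map_cat; congr cat; rewrite -map_comp; apply: eq_map => f.
by rewrite /oedge_map /= !collapse_shift.
Qed.

Let oshift_notin e : oshift n1 e \notin E1.
Proof. by apply/negP => /lt1 /=; rewrite !ltnNge !leq_addr. Qed.

Let ojoin_contract_edger e w : e \in E2 ->
  ocontract_edge (oshift n1 e) (ojoin G1 G2 w) =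
  ojoin G1 (ocontract_edge e G2) (map (collapse (n1 + osrc e) (n1 + otgt e)) w).
Proof.
move=> eE; rewrite /ojoin ocontract_edgeE /=; congr OPreGraph.
  have /and5P[_ _ /allP/(_ _ eE)/=/andP[lts _] _ _] := wf2.
  by case: (n2) lts => // m _; rewrite addnS.
rewrite rem_catr ?oshift_notin // -/(oshift n1) (map_rem oshift_inj) map_cat -!map_comp.
congr cat.
  rewrite -[RHS]map_id; apply/eq_in_map => -[s t r] /lt1/andP[/= lts ltt].
  by rewrite /oedge_map /= !collapse_id.
by apply: eq_map => f; rewrite /oedge_map /= !collapse_addn.
Qed.

Let Uc : uniq (c1 ++ c2') := ojoin_circ_uniq wf1 wf2.

Lemma odelta_ojoin_arcs :
  \sum_(w <- oshuffles G1 G2) \sum_(a <- arcs w)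
     (-1) ^+ contraction_sign a.1 a.2 *: oclass R (ocontract_arc a.1 a.2 (ojoin G1 G2 w)) =
  \sum_(a <- arcs c1) (-1) ^+ contraction_sign a.1 a.2 *:
     oshuffle_graph R (ocontract_arc a.1 a.2 G1) G2 +
  (-1) ^+ n1 *: \sum_(a <- arcs c2) (-1) ^+ contraction_sign a.1 a.2 *:
     oshuffle_graph R G1 (ocontract_arc a.1 a.2 G2).
Proof.
(* The contracted edges depend on the arc but not on the shuffle. Each term is thus a function of
   the arc and of the contracted circle, as [sum_arcs_shuffle] requires. *)
pose F i j w := (-1) ^+ contraction_sign i j *:
  oclass R (OPreGraph (n1 + n2).-1 w (map (arc_edge i j) (E1 ++ E2'))).
transitivity (\sum_(w <- cyclic_shuffles c1 c2') \sum_(a <- arcs w)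
    F a.1 a.2 (contract_circle a.1 a.2 w)) => //.
rewrite sum_arcs_shuffle //; first last.
(* Mixed arcs: no edge joins the two factors, so no [orev] is set and the two opposite contractions
   have the same edges. *)
- move=> i j w /ltc1 lti /mapP[k _ ->]; rewrite /F.
  have ij : i != (n1 + k)%N by rewrite ltn_eqF // ltn_addr.
  rewrite (signr_oddN _ (odd_contraction_signC ij)) scaleNr.
  apply/eqP; rewrite subr_eq0; apply/eqP; congr (_ *: oclass R (OPreGraph _ _ _)).
  rewrite !map_cat -!map_comp; congr cat.
    apply/eq_in_map => e /lt1/andP[lts ltt].
    rewrite /arc_edge !(collapseC i) [osrc e == (n1 + k)%N]ltn_eqF; last exact: ltn_addr.
    by rewrite [otgt e == (n1 + k)%N]ltn_eqF ?andbF // ltn_addr.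
  apply: eq_map => e; rewrite /arc_edge /= !(collapseC i).
  rewrite [(n1 + osrc e)%N == i]gtn_eqF; last exact: ltn_addr.
  by rewrite [(n1 + otgt e)%N == i]gtn_eqF ?andbF // ltn_addr.
- by move=> i j k w; rewrite /F oclass_rot.
congr (_ + _).
  rewrite big_seq [RHS]big_seq; apply: eq_bigr => -[i j] aij /=.
  have /andP[/ltc1 lti /ltc1 ltj] := mem_arcs aij.
  rewrite -scaler_sumr /oshuffle_graph /oshuffles /=; congr (_ *: _).
  have -> : map (collapse i j) c2' = [seq (n1.-1 + v)%N | v <- c2].
    by rewrite -map_comp; apply: eq_map => v /=; rewrite collapse_shift.
  by apply: eq_bigr => w _; rewrite ojoin_contract_arcl.
have /and5P[Uc2 _ _ _ _] := wf2.
rewrite (arcs_map (@addnI n1) Uc2) big_map scaler_sumr big_seq [RHS]big_seq.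
(* The factor [(-1) ^+ n1] comes out of the shift by [n1] of the labels of the second factor. *)
apply: eq_bigr => -[i j] aij /=; rewrite -scaler_sumr contraction_sign_addn exprD -scalerA.
rewrite contract_circle_addn /oshuffle_graph /oshuffles /=; congr (_ *: (_ *: _)).
have -> : map (collapse (n1 + i) (n1 + j)) c1 = c1.
  by rewrite -[RHS]map_id; apply/eq_in_map => v /ltc1 ltv; rewrite collapse_id.
by apply: eq_bigr => w _; rewrite ojoin_contract_arcr.
Qed.

(** An edge is regular in a shuffle exactly when it is regular in its own factor. The contraction
    then relabels the whole circle injectively and passes through the shuffles by
    [sum_cyclic_shuffles_map]. *)
Lemma odelta_ojoin_edges :
  \sum_(w <- oshuffles G1 G2) \sum_(e <- oedges (ojoin G1 G2 w) | oregular w e)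
     (-1) ^+ contraction_sign (osrc e) (otgt e) *:
        oclass R (ocontract_edge e (ojoin G1 G2 w)) =
  \sum_(e <- E1 | oregular c1 e) (-1) ^+ contraction_sign (osrc e) (otgt e) *:
     oshuffle_graph R (ocontract_edge e G1) G2 +
  (-1) ^+ n1 *: \sum_(e <- E2 | oregular c2 e)
     (-1) ^+ contraction_sign (osrc e) (otgt e) *:
       oshuffle_graph R G1 (ocontract_edge e G2).
Proof.
under eq_bigr do rewrite big_cat /=.
rewrite big_split /=; congr (_ + _).
  transitivity (\sum_(w <- oshuffles G1 G2) \sum_(e <- E1 | oregular c1 e)
      (-1) ^+ contraction_sign (osrc e) (otgt e) *:
      oclass R (ocontract_edge e (ojoin G1 G2 w))).
    rewrite big_seq [RHS]big_seq; apply: eq_bigr => w w_sh.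
    rewrite big_seq_cond [RHS]big_seq_cond; apply: eq_bigl => e.
    case eE: (e \in E1) => //=; have /andP[lts ltt] := lt1 eE.
    by rewrite /oregular !(mem_oshuffle_left w_sh).
  rewrite exchange_big /= big_seq_cond [RHS]big_seq_cond.
  apply: eq_bigr => e /andP[eE reg]; rewrite -scaler_sumr; congr (_ *: _).
  rewrite /oshuffle_graph /oshuffles /=; have /andP[lts ltt] := lt1 eE.
  have -> : [seq (n1.-1 + v)%N | v <- c2] = map (collapse (osrc e) (otgt e)) c2'.
    by rewrite -map_comp; apply: eq_map => v /=; rewrite collapse_shift.
  rewrite sum_cyclic_shuffles_map.
    by apply: eq_bigr => w _; rewrite ojoin_contract_edgel.
  apply: collapse_inj_on; apply: contra reg; rewrite /c2' !mem_cat.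
  have nshift v : (v < n1)%N -> (v \in map (addn n1) c2) = false.
    by move=> ltv; apply/mapP => -[x _ Dv]; rewrite Dv ltnNge leq_addr in ltv.
  by rewrite !nshift // !orbF.
transitivity (\sum_(w <- oshuffles G1 G2) \sum_(e <- E2 | oregular c2 e)
    (-1) ^+ contraction_sign (n1 + osrc e) (n1 + otgt e) *:
    oclass R (ocontract_edge (oshift n1 e) (ojoin G1 G2 w))).
  rewrite big_seq [RHS]big_seq; apply: eq_bigr => w w_sh.
  rewrite big_map; apply: eq_bigl => e.
  by rewrite /oregular /= !(mem_oshuffle_right wf1 w_sh).
rewrite exchange_big scaler_sumr /= big_seq_cond [RHS]big_seq_cond.
apply: eq_bigr => e /andP[eE reg]; rewrite -scaler_sumr contraction_sign_addn exprD -scalerA.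
congr (_ *: (_ *: _)); rewrite /oshuffle_graph /oshuffles /=.
set f := collapse (n1 + osrc e) (n1 + otgt e).
have f_c1 : map f c1 = c1.
  by rewrite -[RHS]map_id; apply/eq_in_map => v /ltc1 ltv; rewrite /f collapse_id.
have -> : cyclic_shuffles c1 [seq (n1 + v)%N | v <- map (collapse (osrc e) (otgt e)) c2] =
          cyclic_shuffles (map f c1) (map f c2').
  rewrite f_c1; congr cyclic_shuffles; rewrite -!map_comp.
  by apply: eq_map => v /=; rewrite /f collapse_addn.
rewrite sum_cyclic_shuffles_map.
  by apply: eq_bigr => w _; rewrite ojoin_contract_edger.
apply: collapse_inj_on; apply: contra reg; rewrite /c2' !mem_cat !(mem_map (@addnI n1)).
have nc1 v : (n1 + v \in c1)%N = false.
  by apply/negP => /ltc1; rewrite ltnNge leq_addr.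
by rewrite !nc1.
Qed.

End OddLeibniz.

Lemma oleibniz_graph (R : realType) (G1 G2 : ograph) :
  odelta (oshuffle_graph R G1 G2) =
  oshuffle (odelta_graph R G1) (qclass (@orel R) << G2 >>) +
  (-1) ^+ odegree G1 *: oshuffle (qclass (@orel R) << G1 >>) (odelta_graph R G2).
Proof.
have dB := ocompatible_kills (odelta_compatible R).
have gBl (G : ograph) := ocompatible_kills (oshuffle_compatiblel R (valP G)).
have gBr (G : ograph) := ocompatible_kills (oshuffle_compatibler R (valP G)).
have dlin : linear (@odelta R) by apply: qext_linear.
have ml z : linear (fun x : oD R => oshuffle x z).
  exact: (qext2_linearl (g := fun G G' : ograph => oshuffle_graph R G G') gBl gBr).
have mr z : linear (fun y : oD R => oshuffle z y).
  exact: (qext2_linearr (g := fun G G' : ograph => oshuffle_graph R G G') gBl gBr).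
have dU (P : opregraph) : owf P -> odelta (oclass R P) = odelta_graph R P.
  by move=> wfP; rewrite (oclassE R (OGraph wfP)) /odelta qext_class // lextU.
have mU (P Q : ograph) : oshuffle (oclass R P) (oclass R Q) = oshuffle_graph R P Q.
  rewrite !oclassE.
  exact: (qext2U (g := fun G G' : ograph => oshuffle_graph R G G') gBl gBr).
rewrite -!oclassE.
(* An inadmissible factor has class 0 and, by definition, coboundary 0, so every term of the formula
   vanishes. *)
have [adm1|nadm1] := boolP (oadmissible G1); last first.
  rewrite -mU oclass_inadmissible // /odelta_graph (negPf nadm1).
  by rewrite !(linear_0 (ml _)) (linear_0 dlin) scaler0 addr0.
have [adm2|nadm2] := boolP (oadmissible G2); last first.
  rewrite -mU [oclass R G2]oclass_inadmissible // {2}/odelta_graph (negPf nadm2).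
  by rewrite !(linear_0 (mr _)) (linear_0 dlin) scaler0 addr0.
rewrite {1}/oshuffle_graph; under eq_bigr do rewrite -[oclass _ _]scale1r.
rewrite (linear_sum_scale dlin).
transitivity (\sum_(w <- oshuffles G1 G2) odelta_graph R (ojoin G1 G2 w)).
  rewrite big_seq [RHS]big_seq; apply: eq_bigr => w w_sh; rewrite scale1r dU //.
  case: G1 G2 {adm1 adm2} w_sh => [[n1 c1 E1] wf1] [[n2 c2 E2] wf2].
  exact: owf_oshuffle.
have wf1 : owf G1 := valP G1; have wf2 : owf G2 := valP G2.
(* Well-formedness matters here: [oclass R P] is 0 by default otherwise, while [oshuffle_graph] is
   computed from the raw graph. *)
have mPl P : owf P -> oshuffle (oclass R P) (oclass R G2) = oshuffle_graph R P G2.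
  by move=> wfP; apply: (mU (OGraph wfP)).
have mPr P : owf P -> oshuffle (oclass R G1) (oclass R P) = oshuffle_graph R G1 P.
  by move=> wfP; apply: (mU _ (OGraph wfP)).
have lhsE (w : seq nat) : w \in oshuffles G1 G2 -> odelta_graph R (ojoin G1 G2 w) =
    \sum_(a <- arcs w) (-1) ^+ contraction_sign a.1 a.2 *:
       oclass R (ocontract_arc a.1 a.2 (ojoin G1 G2 w)) +
    \sum_(e <- oedges (ojoin G1 G2 w) | oregular w e)
       (-1) ^+ contraction_sign (osrc e) (otgt e) *:
         oclass R (ocontract_edge e (ojoin G1 G2 w)).
  move=> w_sh; rewrite /odelta_graph; suff -> : oadmissible (ojoin G1 G2 w) by [].
  move: wf1 adm1 w_sh wf2 adm2; case: (ograph_val G1) => n1 c1 E1.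
  case: (ograph_val G2) => n2 c2 E2 w1 a1 w_sh w2 a2.
  by rewrite (oadmissible_ojoin w1 w_sh) a1 a2.
rewrite big_seq (eq_bigr _ lhsE) -big_seq big_split /=.
have -> : odelta_graph R G1 =
    \sum_(a <- arcs (ocirc G1)) (-1) ^+ contraction_sign a.1 a.2 *:
       oclass R (ocontract_arc a.1 a.2 G1) +
    \sum_(e <- oedges G1 | oregular (ocirc G1) e)
       (-1) ^+ contraction_sign (osrc e) (otgt e) *: oclass R (ocontract_edge e G1).
  by rewrite /odelta_graph adm1.
have -> : odelta_graph R G2 =
    \sum_(a <- arcs (ocirc G2)) (-1) ^+ contraction_sign a.1 a.2 *:
       oclass R (ocontract_arc a.1 a.2 G2) +
    \sum_(e <- oedges G2 | oregular (ocirc G2) e)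
       (-1) ^+ contraction_sign (osrc e) (otgt e) *: oclass R (ocontract_edge e G2).
  by rewrite /odelta_graph adm2.
have mlD z x y : oshuffle (x + y) z = oshuffle x z + oshuffle y z :> oD R.
  by have := ml z 1 x y; rewrite !scale1r.
have mrD z x y : oshuffle z (x + y) = oshuffle z x + oshuffle z y :> oD R.
  by have := mr z 1 x y; rewrite !scale1r.
rewrite mlD mrD !(linear_sum_scale (ml _)) !(linear_sum_scale (mr _)).
rewrite scalerDr addrACA; congr (_ + _).
  transitivity (\sum_(a <- arcs (ocirc G1)) (-1) ^+ contraction_sign a.1 a.2 *:
      oshuffle_graph R (ocontract_arc a.1 a.2 G1) G2 +
    (-1) ^+ onum G1 *: \sum_(a <- arcs (ocirc G2)) (-1) ^+ contraction_sign a.1 a.2 *: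
      oshuffle_graph R G1 (ocontract_arc a.1 a.2 G2)).
    move: wf1 wf2; case: (ograph_val G1) => n1 c1 E1; case: (ograph_val G2) => n2 c2 E2.
    exact: odelta_ojoin_arcs.
  congr (_ + _ *: _); rewrite big_seq [RHS]big_seq; apply: eq_bigr => -[i j] aij /=.
    by rewrite mPl // owf_ocontract_arc.
  by rewrite mPr // owf_ocontract_arc.
transitivity (\sum_(e <- oedges G1 | oregular (ocirc G1) e)
    (-1) ^+ contraction_sign (osrc e) (otgt e) *:
      oshuffle_graph R (ocontract_edge e G1) G2 +
  (-1) ^+ onum G1 *: \sum_(e <- oedges G2 | oregular (ocirc G2) e)
    (-1) ^+ contraction_sign (osrc e) (otgt e) *:
      oshuffle_graph R G1 (ocontract_edge e G2)).
  move: wf1 wf2; case: (ograph_val G1) => n1 c1 E1; case: (ograph_val G2) => n2 c2 E2.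
  exact: odelta_ojoin_edges.
congr (_ + _ *: _); rewrite big_seq_cond [RHS]big_seq_cond;
  apply: eq_bigr => e /andP[eE reg].
  by rewrite mPl // owf_ocontract_edge.
by rewrite mPr // owf_ocontract_edge.
Qed.

Lemma oleibniz (R : realType) p (x y : oD R) : ohomogeneous p x ->
  odelta (oshuffle x y) = oshuffle (odelta x) y + (-1) ^+ p *: oshuffle x (odelta y).
Proof.
apply: (leibniz_extension (f := fun G : ograph => odelta_graph R G)
  (g := fun G G' : ograph => oshuffle_graph R G G')).
- exact: ocompatible_kills (odelta_compatible R).
- by move=> G; apply: ocompatible_kills (oshuffle_compatiblel R (valP G)).
- by move=> G; apply: ocompatible_kills (oshuffle_compatibler R (valP G)).
exact: oleibniz_graph.
Qed.

(** * The even complex *)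

(** The converse is the pigeonhole principle: [size c] distinct numbers below [size c] exhaust
    them. *)
Lemma perm_iotaE c :
  perm_eq c (iota 0 (size c)) = uniq c && all (fun v => v < size c)%N c.
Proof.
apply/idP/andP => [pc|[Uc /allP cn]].
  rewrite (perm_uniq pc) iota_uniq; split=> //; apply/allP => v.
  by rewrite (perm_mem pc) mem_iota.
have sub : {subset c <= iota 0 (size c)} by move=> v /cn ltv; rewrite mem_iota.
have [_ eqc] := uniq_min_size Uc sub (eq_leq (size_iota _ _)).
by apply: uniq_perm; rewrite ?iota_uniq.
Qed.

Definition min_valence (v : evertex) : nat := if is_external v then 1 else 3.

Lemma ewfP c r E : reflect
  [/\ uniq c, forall v, v \in c -> (v < size c)%N,
      forall e, e \in E -> evalid (size c) r e.1 && evalid (size c) r e.2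
    & forall v, evalid (size c) r v -> (min_valence v <= valence E v)%N]
  (ewf (EPreGraph c r E)).
Proof.
rewrite /= perm_iotaE; apply: (iffP and4P).
  case=> /andP[Uc /allP cn] /allP En /allP vale /allP vali; split=> // -[k|k] /= ltk.
    by apply: (vale k); rewrite mem_iota.
  by apply: (vali k); rewrite mem_iota.
case=> Uc cn En val; split; first by rewrite Uc; apply/allP.
- exact/allP.
- by apply/allP => k; rewrite mem_iota => ltk; apply: (val (inl k)).
by apply/allP => k; rewrite mem_iota => ltk; apply: (val (inr k)).
Qed.

Lemma min_valence_map f g v : min_valence (vertex_map f g v) = min_valence v.
Proof. by case: v. Qed.

Lemma evalid_map f g p r v : (forall k, (f k < p) = (k < p))%N ->
  (forall k, (g k < r) = (k < r))%N -> evalid p r (vertex_map f g v) = evalid p r v.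
Proof. by case: v => k /=. Qed.

Lemma ewf_rot c r E k : ewf (EPreGraph (rot k c) r E) = ewf (EPreGraph c r E).
Proof. by rewrite /= size_rot perm_rot. Qed.

Lemma vertex_map_inj f g : injective f -> injective g -> injective (vertex_map f g).
Proof.
by move=> injf injg [k|k] [l|l] //= [e]; [rewrite (injf _ _ e)|rewrite (injg _ _ e)].
Qed.

Lemma vertex_mapK f f' g g' : cancel f f' -> cancel g g' ->
  cancel (vertex_map f g) (vertex_map f' g').
Proof. by move=> fK gK [k|k] /=; rewrite ?fK ?gK. Qed.

Lemma eedge_mapK h h' : cancel h h' -> cancel (eedge_map h) (eedge_map h').
Proof. by move=> hK [u v]; rewrite /eedge_map /= !hK. Qed.

Lemma eedge_map_inj h : injective h -> injective (eedge_map h).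
Proof. by move=> injh [u v] [u' v'] [/injh-> /injh->]. Qed.

(** Both maps being involutions, preservation in one direction yields the equivalence. *)
Lemma ewf_vertex_map f g c r E : involutive f -> involutive g ->
    (forall k, (f k < size c) = (k < size c))%N -> (forall k, (g k < r) = (k < r))%N ->
  ewf (EPreGraph (map f c) r (map (eedge_map (vertex_map f g)) E)) =
  ewf (EPreGraph c r E).
Proof.
move=> fK gK ltf ltg.
have imp c0 E0 : size c0 = size c -> ewf (EPreGraph c0 r E0) ->
    ewf (EPreGraph (map f c0) r (map (eedge_map (vertex_map f g)) E0)).
  move=> sz /ewfP; rewrite sz => -[Uc cn En val]; apply/ewfP; rewrite size_map sz; split.
  - by rewrite (map_inj_uniq (inv_inj fK)).
  - by move=> _ /mapP[v /cn ltv ->]; rewrite ltf.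
  - by move=> _ /mapP[e /En eE ->]; rewrite /= !evalid_map.
  move=> v; rewrite -(vertex_mapK fK gK v) evalid_map // min_valence_map => /val le_val.
  exact: leq_trans le_val (leq_valence_map _ _ _).
apply/idP/idP; last exact: imp.
move/imp; rewrite size_map => /(_ erefl).
by rewrite (mapK fK) (mapK (eedge_mapK (vertex_mapK fK gK))).
Qed.

Lemma esame_endsP e f : reflect (e = f \/ e = (f.2, f.1)) (esame_ends e f).
Proof. by apply: (iffP orP) => -[/eqP|/eqP]; [left|right|left|right]. Qed.

Lemma esame_endsxx e : esame_ends e e.
Proof. by rewrite /esame_ends eqxx. Qed.

Lemma esame_endsC : symmetric esame_ends.
Proof.
have imp e f : esame_ends e f -> esame_ends f e.
  by case/esame_endsP=> ->; rewrite ?esame_endsxx // /esame_ends -surjective_pairing eqxx orbT.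
by move=> e f; apply/idP/idP; apply: imp.
Qed.

Lemma esame_ends_trans : transitive esame_ends.
Proof.
move=> f e g /esame_endsP[]-> // /esame_endsP[]->; apply/esame_endsP; first by right.
by left; rewrite -surjective_pairing.
Qed.

Lemma esame_ends_map h e f : esame_ends e f -> esame_ends (eedge_map h e) (eedge_map h f).
Proof. by case/esame_endsP=> ->; apply/esame_endsP; [left|right]. Qed.

Lemma esame_ends_map_inj h e f : injective h ->
  esame_ends (eedge_map h e) (eedge_map h f) = esame_ends e f.
Proof.
move=> injh; apply/idP/idP => [/esame_endsP|]; last exact: esame_ends_map.
case=> [/(eedge_map_inj injh)->|De]; first exact: esame_endsxx.
apply/esame_endsP; right; apply: (eedge_map_inj injh); exact: De.
Qed.

Lemma all2_sym (T : Type) (r : rel T) s t : symmetric r -> all2 r s t = all2 r t s.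
Proof. by move=> symr; elim: s t => [|x s IH] [|y t] //=; rewrite symr IH. Qed.

Lemma all2_map (S T : Type) (r : rel S) (r' : rel T) (h h' : S -> T) s t :
  (forall x y, r x y -> r' (h x) (h' y)) -> all2 r s t -> all2 r' (map h s) (map h' t).
Proof.
by move=> hr; elim: s t => [|x s IH] [|y t] //= /andP[/hr-> /IH].
Qed.

Lemma all2_refl (T : Type) (r : rel T) s : reflexive r -> all2 r s s.
Proof. by move=> rr; elim: s => //= x s ->; rewrite rr. Qed.

Lemma all2_nth (T : Type) (r : rel T) x0 s t i : r x0 x0 -> all2 r s t ->
  r (nth x0 s i) (nth x0 t i).
Proof. by move=> r0; elim: s t i => [|x s IH] [|y t] [|i] //= /andP[] // _ /IH. Qed.

Lemma all2_cat (T : Type) (r : rel T) s t s' t' :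
  all2 r s t -> all2 r s' t' -> all2 r (s ++ s') (t ++ t').
Proof. by elim: s t => [|x s IH] [|y t] //= /andP[-> /IH h] /h. Qed.

(** Removal by position rather than by value, because the label of an edge is its position in the
    list. *)
Definition del (T : Type) (a : nat) (s : seq T) : seq T := take a s ++ drop a.+1 s.

Lemma all2_del (T : Type) (r : rel T) s t a : all2 r s t -> all2 r (del a s) (del a t).
Proof.
rewrite /del; elim: s t a => [|x s IH] [|y t] [|a] //= /andP[rxy st]; rewrite ?drop0 //.
by rewrite rxy IH.
Qed.

Lemma all2_size (T : Type) (r : rel T) s t : all2 r s t -> size s = size t.
Proof. by elim: s t => [|x s IH] [|y t] //= /andP[_ /IH->]. Qed.

Lemma valence_same_ends E E' v : all2 esame_ends E' E -> valence E' v = valence E v.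
Proof.
elim: E' E => [|e s IH] [|f t] //= /andP[/esame_endsP ef /IH].
rewrite /valence !big_cons => ->; congr addn; case: ef => -> //=; exact: addnC.
Qed.

Lemma ewf_same_ends c r E E' : all2 esame_ends E' E ->
  ewf (EPreGraph c r E') = ewf (EPreGraph c r E).
Proof.
have imp F F' : all2 esame_ends F' F -> ewf (EPreGraph c r F) -> ewf (EPreGraph c r F').
  move=> FF' /ewfP[Uc cn En val]; apply/ewfP; split=> // [e eF|v]; last first.
    by rewrite (valence_same_ends _ FF'); apply: val.
  have lt : (index e F' < size F)%N by rewrite -(all2_size FF') index_mem.
  have := all2_nth (index e F') (esame_endsxx edefault) FF'.
  have := En _ (mem_nth edefault lt); rewrite nth_index // => vF.
  by case/esame_endsP=> ->; rewrite // andbC.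
move=> EE'; apply/idP/idP; apply: imp => //.
by rewrite all2_sym //; apply: esame_endsC.
Qed.

Lemma ewf_perm c r E E' : perm_eq E' E -> ewf (EPreGraph c r E') = ewf (EPreGraph c r E).
Proof.
have imp F F' : perm_eq F' F -> ewf (EPreGraph c r F) -> ewf (EPreGraph c r F').
  move=> pF /ewfP[Uc cn En val]; apply/ewfP; split=> // [e|v].
    by rewrite (perm_mem pF); apply: En.
  by rewrite (perm_valence _ pF); apply: val.
by move=> pE; apply/idP/idP; apply: imp; rewrite // perm_sym.
Qed.

Lemma eadmissible_perm c c' r r' E E' : perm_eq E' E ->
  eadmissible (EPreGraph c' r' E') = eadmissible (EPreGraph c r E).
Proof.
move=> pE; rewrite /eadmissible /= (eq_all_r (perm_mem pE)); congr andb.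
by apply: pairwise_perm => // e f; rewrite esame_endsC.
Qed.

Lemma eadmissible_vertex_map f g c c' r r' E : injective f -> injective g ->
  eadmissible (EPreGraph c' r' (map (eedge_map (vertex_map f g)) E)) =
  eadmissible (EPreGraph c r E).
Proof.
move=> injf injg; have injh := vertex_map_inj injf injg.
rewrite /eadmissible /= pairwise_map all_map; congr andb.
  by apply: eq_pairwise => e e'; rewrite /= esame_ends_map_inj.
by apply: eq_all => e; rewrite /= (inj_eq injh); case: (e.1).
Qed.

Lemma eadmissible_same_ends c c' r r' E E' : all2 esame_ends E' E ->
  eadmissible (EPreGraph c' r' E') = eadmissible (EPreGraph c r E).
Proof.
rewrite /eadmissible /=; elim: E' E => [|e s IH] [|f t] //= /andP[ef st].
have eqst := IH t st.
have -> : all (fun e' => ~~ esame_ends e e') s = all (fun e' => ~~ esame_ends f e') t.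
  elim: s t st {IH eqst} => [|x s IH] [|y t] //= /andP[xy /IH->]; congr (~~ _ && _).
  apply/idP/idP => h.
    by apply: esame_ends_trans xy; apply: esame_ends_trans h; rewrite esame_endsC.
  by apply: esame_ends_trans ef _; apply: esame_ends_trans h _; rewrite esame_endsC.
have -> : ((e.1 == e.2) ==> is_external e.1) = ((f.1 == f.2) ==> is_external f.1).
  by case/esame_endsP: ef => -> //=; rewrite eq_sym; case: eqVneq => // ->.
by rewrite andbACA eqst andbACA.
Qed.

(** * The even complex: identification of the ends of an edge *)

Definition contractible (u v : evertex) : bool :=
  (u != v) && ~~ (is_external u && is_external v).

Lemma identifyC u v : identify u v =1 identify v u.
Proof.
case: u v => [i|k] [j|l] x //=.
by case: x => a //=; rewrite collapseC.
Qed.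

Definition drop_label (k l : nat) : nat := if (k < l)%N then l.-1 else l.

Lemma identify_mixed i k x : identify (inl i) (inr k) x =
  if x == inr k then inl i else vertex_map id (drop_label k) x.
Proof. by []. Qed.

(** Up to an exchange of the ends, to which [identify] is insensitive, either an external vertex
    absorbs an internal one or two distinct internal vertices merge. *)
Lemma contractible_ind (P : evertex -> evertex -> Prop) :
  (forall u v, P u v -> P v u) -> (forall i k, P (inl i) (inr k)) ->
  (forall k l, k != l -> P (inr k) (inr l)) -> forall u v, contractible u v -> P u v.
Proof.
move=> symP Pm Pi [i|k] [j|l] // /andP[uv] //= _; first exact: symP.
by apply: Pi; apply: contraNneq uv => ->.
Qed.

Lemma vertex_eqE : (forall a b, (inl a == inl b :> evertex) = (a == b)%N) *
  (forall a b, (inr a == inr b :> evertex) = (a == b)%N) *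
  (forall a b, (inl a == inr b :> evertex) = false) *
  (forall a b, (inr a == inl b :> evertex) = false).
Proof. by []. Qed.

Lemma identify_eq u v x y : contractible u v ->
  (identify u v x == identify u v y) =
  (x == y) || (x \in [:: u; v]) && (y \in [:: u; v]).
Proof.
move=> uv; elim/contractible_ind: uv x y => {u v} [u v IH x y|i k x y|k l kl x y].
- by rewrite !(identifyC v) IH !inE ![_ || (_ == v)]orbC.
- rewrite !identify_mixed; case: x y => [a|a] [b|b]; rewrite !inE !vertex_eqE /=.
  + by rewrite !orbF; lia.
  + by rewrite !orbF; case: (b =P k) => _ /=; rewrite ?vertex_eqE ?andbT ?andbF.
  + by rewrite !orbF; case: (a =P k) => _ /=; rewrite ?vertex_eqE //= eq_sym.
  rewrite /drop_label; case: (a =P k) => [->|ak] /=; case: (b =P k) => [->|bk] /=.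
  + by rewrite !eqxx.
  + by rewrite orbF; apply/esym/eqP => kb; case: bk.
  + by rewrite orbF; apply/esym/eqP.
  by rewrite vertex_eqE orbF; do 2!case: ifP; lia.
case: x y => [a|a] [b|b]; rewrite !inE !vertex_eqE /= ?andbF ?orbF //.
by have := collapse_eq a b kl; rewrite !inE => <-.
Qed.

Lemma identify_valid p r u v x : contractible u v ->
  evalid p r u -> evalid p r v -> evalid p r x -> evalid p r.-1 (identify u v x).
Proof.
move=> uv; elim/contractible_ind: uv => {u v} [u v IH vv vu|i k|k l kl].
- by rewrite identifyC; apply: IH.
- rewrite identify_mixed /= => lti ltk; case: x => a //=.
  case: eqVneq => //= ne; have : a != k by apply: contraNneq ne => ->.
  by rewrite /drop_label; case: ifP; lia.
by case: x => a //= ltk ltl lta; apply: collapse_ltn.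
Qed.

Lemma identify_external u v x : contractible u v ->
  is_external (identify u v x) =
  is_external x || (x \in [:: u; v]) && (is_external u || is_external v).
Proof.
move=> uv; elim/contractible_ind: uv => {u v} [u v IH|i k|k l kl].
- by rewrite identifyC IH !inE orbC [is_external u || _]orbC [X in _ || X && _]orbC [in RHS]orbC.
- by rewrite identify_mixed !inE andbT; case: x => a //=; case: eqVneq.
by rewrite andbF orbF; case: x.
Qed.

Lemma identify_surj p r u v w : contractible u v ->
  evalid p r u -> evalid p r v -> evalid p r.-1 w ->
  exists2 x, evalid p r x & w = identify u v x.
Proof.
move=> uv; elim/contractible_ind: uv => {u v} [u v IH vv vu vw|i k|k l kl].
- by have [x vx ->] := IH vu vv vw; exists x; rewrite // identifyC.
- move=> lti ltk; case: w => a lta; first by exists (inl a).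
  (* The preimage of [a] under [drop_label k] that avoids the absorbed name [k]. *)
  exists (inr (if a < k then a else a.+1)%N) => /=.
    by move: lta ltk => /=; case: ifP; lia.
  rewrite ?vertex_eqE /= /drop_label; move: lta => /= lta.
  have [lt_ak|le_ka] := ltnP a k; first by rewrite ltn_eqF // ltnNge (ltnW lt_ak).
  by rewrite gtn_eqF // ltnS le_ka.
case: w => a ltk ltl lta; first by exists (inl a).
by have [b ltb ->] := collapse_surj kl ltk ltl lta; exists (inr b).
Qed.

Definition eshift (p r : nat) : evertex -> evertex := vertex_map (addn p) (addn r).

Lemma evalid_eshift p1 r1 p2 r2 v :
  evalid (p1 + p2) (r1 + r2) (eshift p1 r1 v) = evalid p2 r2 v.
Proof. by case: v => k /=; rewrite ltn_add2l. Qed.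

Lemma evalidW p1 r1 p2 r2 v : evalid p1 r1 v -> evalid (p1 + p2) (r1 + r2) v.
Proof. by case: v => k /= ltk; rewrite ltn_addr. Qed.

Lemma evalid_split p1 r1 p2 r2 v : evalid (p1 + p2) (r1 + r2) v ->
  evalid p1 r1 v \/ exists2 v', evalid p2 r2 v' & v = eshift p1 r1 v'.
Proof.
case: v => k /= ltk.
  case: (ltnP k p1) => lek; [by left|right; exists (inl (k - p1)%N)].
    by rewrite /= -(ltn_add2l p1) subnKC.
  by rewrite /eshift /= subnKC.
case: (ltnP k r1) => lek; [by left|right; exists (inr (k - r1)%N)].
  by rewrite /= -(ltn_add2l r1) subnKC.
by rewrite /eshift /= subnKC.
Qed.

Lemma eshift_invalid p r v : evalid p r (eshift p r v) = false.
Proof. by case: v => k /=; rewrite ltnNge leq_addr. Qed.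

(** * The even complex: joins and contractions are graphs *)

Section EvenJoin.
Variables (r1 r2 : nat) (c1 c2 : seq nat) (E1 E2 : seq eedge).
Local Notation G1 := (EPreGraph c1 r1 E1).
Local Notation G2 := (EPreGraph c2 r2 E2).
Hypotheses (wf1 : ewf G1) (wf2 : ewf G2).
Local Notation c2' := (map (addn (size c1)) c2).

Lemma ejoin_circ_uniq : uniq (c1 ++ c2').
Proof.
have /ewfP[Uc1 cn1 _ _] := wf1; have /ewfP[Uc2 _ _ _] := wf2.
rewrite cat_uniq Uc1 (map_inj_uniq (@addnI (size c1))) Uc2 andbT /=.
apply/hasPn => _ /mapP[v _ ->] /=; apply/negP => /cn1.
by rewrite ltnNge leq_addr.
Qed.

Variable w : seq nat.
Hypothesis w_sh : w \in eshuffles G1 G2.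

Lemma eshuffle_perm : perm_eq w (c1 ++ c2').
Proof. by move: w_sh; rewrite mem_cyclic_shuffles => /andP[_ /and3P[]]. Qed.

Lemma size_eshuffle : size w = (size c1 + size c2)%N.
Proof. by rewrite (perm_size eshuffle_perm) size_cat size_map. Qed.

Lemma ewf_eshuffle : ewf (ejoin G1 G2 w).
Proof.
have /ewfP[Uc1 cn1 En1 val1] := wf1; have /ewfP[Uc2 cn2 En2 val2] := wf2.
apply/ewfP; rewrite size_eshuffle /=; split.
- by rewrite (perm_uniq eshuffle_perm) ejoin_circ_uniq.
- move=> v; rewrite (perm_mem eshuffle_perm) mem_cat.
  case/orP=> [/cn1/ltn_addr-> //|/mapP[k /cn2 ltk ->]].
  by rewrite ltn_add2l.
- move=> e; rewrite mem_cat => /orP[/En1/andP[v1 v2]|/mapP[f /En2/andP[v1 v2] ->]].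
    by rewrite !evalidW.
  by rewrite /= !evalid_eshift v1.
move=> v /evalid_split[/val1 le_val|[v' /val2 le_val ->]]; rewrite valence_cat.
  exact: leq_trans le_val (leq_addr _ _).
rewrite min_valence_map; apply: leq_trans le_val _.
by apply: leq_trans (leq_addl _ _); apply: leq_valence_map.
Qed.

Lemma eadmissible_ejoin :
  eadmissible (ejoin G1 G2 w) = eadmissible G1 && eadmissible G2.
Proof.
have /ewfP[_ _ En1 _] := wf1.
rewrite /eadmissible /= pairwise_cat all_cat.
have -> : allrel (fun e f => ~~ esame_ends e f) E1
    (map (eedge_map (eshift (size c1) r1)) E2).
  apply/allrelP => e _ /En1/andP[v1 v2] /mapP[f _ ->].
  apply/negP => /esame_endsP[] De; move: v1; rewrite De /=.
    by rewrite eshift_invalid.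
  by rewrite eshift_invalid.
have := @eadmissible_vertex_map (addn (size c1)) (addn r1) c2 c2 r2 r2 E2
  (@addnI _) (@addnI _).
by rewrite /eadmissible /= andbACA => ->.
Qed.
End EvenJoin.

Lemma ewf_econtract_arc i j G : ewf G -> (i, j) \in arcs (ecirc G) ->
  ewf (econtract_arc i j G).
Proof.
case: G => c r E /ewfP[Uc cn En val] /= aij.
have ij := arcs_neq Uc aij; have /andP[ic jc] := mem_arcs aij.
have szc : size (contract_circle i j c) = (size c).-1 by rewrite size_map size_rem.
have ltc k : (k < size c)%N -> (collapse i j k < (size c).-1)%N.
  by apply: collapse_ltn; rewrite ?cn.
apply/ewfP; rewrite szc; split.
- rewrite /contract_circle map_inj_in_uniq ?rem_uniq //.
  by apply: sub_in2 (@collapse_inj i j) => v; rewrite mem_rem_uniq // => /andP[].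
- by move=> _ /mapP[v /mem_rem vc ->]; apply: ltc; apply: cn.
- have valid_map v : evalid (size c) r v ->
      evalid (size c).-1 r (vertex_map (collapse i j) id v).
    by case: v => k //=; apply: ltc.
  by move=> _ /mapP[e /En/andP[v1 v2] ->]; rewrite /= !valid_map.
move=> v vv; suff [x vx ->] : exists2 x, evalid (size c) r x &
    v = vertex_map (collapse i j) id x.
  rewrite min_valence_map; apply: leq_trans (val x vx) _; exact: leq_valence_map.
case: v vv => k /= ltk; last by exists (inr k).
by have [x ltx ->] := collapse_surj ij (cn i ic) (cn j jc) ltk; exists (inl x).
Qed.

Lemma perm_del (T : eqType) x0 a (s : seq T) : (a < size s)%N ->
  perm_eq s (nth x0 s a :: del a s).
Proof.
move=> lta; rewrite -{1}(cat_take_drop a s) (drop_nth x0 lta) /del.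
exact: (permEl (perm_catCA _ [:: _] _)).
Qed.

Lemma mem_del (T : eqType) a (s : seq T) x : x \in del a s -> x \in s.
Proof. by rewrite mem_cat => /orP[/mem_take|/mem_drop]. Qed.

Lemma map_del (T1 T2 : Type) (f : T1 -> T2) a s : map f (del a s) = del a (map f s).
Proof. by rewrite /del map_cat map_take map_drop. Qed.

Lemma econtract_edgeE a c r E : econtract_edge a (EPreGraph c r E) =
  EPreGraph c r.-1
    (map (eedge_map (identify (nth edefault E a).1 (nth edefault E a).2)) (del a E)).
Proof. by rewrite /econtract_edge /=; case: nth. Qed.

Lemma contractible_nth G a : eadmissible G -> (a < size (eedges G))%N ->
  eregular (nth edefault (eedges G) a) ->
  contractible (nth edefault (eedges G) a).1 (nth edefault (eedges G) a).2.
Proof.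
case/andP=> _ /allP loops lta; rewrite /contractible /eregular => reg; rewrite reg andbT.
apply: contraNneq reg => eq_e; have := loops _ (mem_nth edefault lta).
by rewrite -eq_e eqxx /= => ->.
Qed.

Lemma ewf_econtract_edge a G : ewf G -> eadmissible G -> (a < size (eedges G))%N ->
  eregular (nth edefault (eedges G) a) -> ewf (econtract_edge a G).
Proof.
move=> wfG adm lta reg; have := contractible_nth adm lta reg.
case: G wfG adm lta reg => c r E /ewfP[Uc cn En val] _ /= lta _.
rewrite econtract_edgeE; have pE := perm_del edefault lta.
move: (En _ (mem_nth edefault lta)) pE; case: (nth _ _ _) => u v /= /andP[vu vv] pE uv.
apply/ewfP; split=> //.
  move=> _ /mapP[f /mem_del/En/andP[v1 v2] ->] /=.
  by rewrite !identify_valid.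
move=> x /(identify_surj uv vu vv) [y vy ->].
have val' z : evalid (size c) r z -> (min_valence z <= valence ((u, v) :: del a E) z)%N.
  by move=> vz; rewrite -(perm_valence _ pE); apply: val.
have uNv : u != v by case/andP: uv.
case y_uv: (y \in [:: u; v]); last first.
  rewrite /min_valence identify_external // y_uv orbF.
  rewrite (@valence_contract_other _ _ _ _ u v) ?val' //; first last.
  - by move=> f _; rewrite !identify_eq // y_uv !andbF !orbF.
  - by move: y_uv; rewrite !inE => /norP[].
  - by move: y_uv; rewrite !inE => /norP[].
have -> : identify u v y = identify u v u.
  by apply/eqP; rewrite identify_eq // y_uv !inE eqxx orbT.
have : (valence (map (edge_map (identify u v)) (del a E)) (identify u v u) + 2 =
        valence ((u, v) :: del a E) u + valence ((u, v) :: del a E) v)%N.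
  apply: valence_contract => // f _.
  by rewrite !identify_eq // !inE eqxx /= !andbT !orbA !orbb.
move/contracted_valence; apply; [exact: val'|exact: val'|by case/andP: uv|].
rewrite identify_external // !inE eqxx /=.
by case: (is_external u); case: (is_external v).
Qed.

(** Internal vertices carry no label in the even case, so exchanging two of their names produces no
    sign. *)
Definition erename (a : nat) (G : epregraph) : epregraph :=
  EPreGraph (ecirc G) (eint G)
    (map (eedge_map (vertex_map id (swp a))) (eedges G)).

Lemma ewf_erename a G : (a.+1 < eint G)%N -> ewf (erename a G) = ewf G.
Proof.
case: G => c r E /= lta.
have := @ewf_vertex_map id (swp a) c r E (fun=> erefl) (@swpK a) (fun=> erefl).
by rewrite map_id; apply=> k; rewrite swp_lt.
Qed.

Lemma ewf_erenumber a G : (a.+1 < size (ecirc G))%N ->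
  ewf (erenumber (swp a) G) = ewf G.
Proof.
case: G => c r E /= lta; apply: ewf_vertex_map => // [|k]; first exact: swpK.
by rewrite swp_lt.
Qed.

Lemma nth_swp (T : Type) (x0 : T) s1 x y s2 k :
  nth x0 (s1 ++ y :: x :: s2) (swp (size s1) k) = nth x0 (s1 ++ x :: y :: s2) k.
Proof.
rewrite /swp !nth_cat; case: (ltngtP k (size s1)) => [lt|gt|->].
- by rewrite ltn_eqF ?lt // ltnS ltnW.
- have [->|ne] := eqVneq k (size s1).+1; first by rewrite ltnn subnn subSnn.
  rewrite ltnNge (ltnW gt) /=; have -> : (k - size s1 = (k - (size s1).+2).+2)%N by lia.
  by [].
by rewrite ltnNge leqnSn subSnn subnn.
Qed.

(** The relation [erel_edges] speaks of positions; for an adjacent transposition this recovers the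
    splitting of the lists used by [ecompatible_swap]. *)
Lemma swap_adjacent (T : Type) (x0 : T) (s s' : seq T) a :
    (a.+1 < size s)%N -> size s' = size s ->
    (forall k, (k < size s)%N -> nth x0 s' (swp a k) = nth x0 s k) ->
  exists s1 x y s2, [/\ s = s1 ++ x :: y :: s2, s' = s1 ++ y :: x :: s2 & size s1 = a].
Proof.
move=> lta sz Dnth; exists (take a s), (nth x0 s a), (nth x0 s a.+1), (drop a.+2 s).
have sza : size (take a s) = a by rewrite size_take ltnW // ifT // ltnW.
have Ds : s = take a s ++ nth x0 s a :: nth x0 s a.+1 :: drop a.+2 s.
  by rewrite -!drop_nth ?cat_take_drop // ltnW.
split=> //; apply: (@eq_from_nth _ x0).
  by rewrite sz {1}Ds !size_cat.
move=> k; rewrite sz => ltk; rewrite -[k](swpK a) Dnth ?swp_lt // {1}Ds.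
by rewrite -[in LHS](swpK a k) -{2}sza swpK -nth_swp sza.
Qed.

Lemma map_rename1 n E :
  map (eedge_map (vertex_map id (perm_nat (1 : 'S_n)%g))) E = E.
Proof.
by rewrite -[RHS]map_id; apply: eq_map => -[[a|a] [b|b]]; rewrite /eedge_map /= ?perm_nat1.
Qed.

(** * The even complex: relations and the maps compatible with them *)

Section EvenRelations.
Variable R : realType.
Local Notation eD := (eD R).
Local Notation gen G := (<< G >> : {malg R[egraph]}).

Lemma eclassE (G : egraph) : eclass R G = qclass (@erel R) (gen G).
Proof. by rewrite /eclass valK. Qed.

Lemma eclass_rel (a : R) (P Q : epregraph) : ewf P = ewf Q ->
  (forall G H : egraph, G = P :> epregraph -> H = Q :> epregraph ->
     erel (gen H - a *: gen G)) ->
  eclass R Q = a *: eclass R P.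
Proof.
move=> eq_wf rel; rewrite /eclass; case: insubP => [H wfQ DH|nwfQ]; last first.
  by rewrite insubF ?scaler0 // eq_wf (negPf nwfQ).
rewrite -eq_wf in wfQ; rewrite (insubT ewf wfQ) -linearZ; apply/qclass_eq.
rewrite -[X in Defs.span _ X]addr0 -[X in X + _]scale1r.
by apply: span_cons; [exact: rel | exact: span_zero].
Qed.

Lemma eclass_rot c r E k : eclass R (EPreGraph (rot k c) r E) = eclass R (EPreGraph c r E).
Proof.
rewrite -[RHS]scale1r; apply: eclass_rel => [|G H DG DH]; first by rewrite ewf_rot.
rewrite scale1r; apply: (@erel_same _ _ _ k 1%g); rewrite DG DH //=.
rewrite map_rename1; apply: all2_refl; apply: esame_endsxx.
Qed.

Lemma eclass_same_ends c r E E' : all2 esame_ends E' E ->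
  eclass R (EPreGraph c r E') = eclass R (EPreGraph c r E).
Proof.
move=> EE'; rewrite -[RHS]scale1r; apply: eclass_rel => [|G H DG DH].
  by rewrite (ewf_same_ends _ _ EE').
rewrite scale1r; apply: (@erel_same _ _ _ 0 1%g); rewrite DG DH ?rot0 //=.
by rewrite map_rename1.
Qed.

Lemma eclass_erename a G : (a.+1 < eint G)%N -> eclass R (erename a G) = eclass R G.
Proof.
move=> lt_an; rewrite -[RHS]scale1r; apply: eclass_rel => [|P H DP DH].
  by rewrite ewf_erename.
have lta : (a < eint P)%N by rewrite DP; apply: ltnW.
have lta' : (a.+1 < eint P)%N by rewrite DP.
have D1 : Ordinal lta' = (Ordinal lta).+1 :> nat by [].
rewrite scale1r; apply: (@erel_same _ _ _ 0 (tperm (Ordinal lta) (Ordinal lta'))).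
- by rewrite DH -DP.
- by rewrite DH rot0 -DP.
rewrite DH -DP /=.
have st := perm_nat_tperm D1.
rewrite (_ : map _ _ = map (eedge_map (vertex_map id (swp a))) (eedges P)).
  by apply: all2_refl; apply: esame_endsxx.
by apply: eq_map => -[[k|k] [l|l]]; rewrite /eedge_map /= ?st.
Qed.

Lemma eclass_erenumber a G : (a.+1 < size (ecirc G))%N ->
  eclass R (erenumber (swp a) G) = - eclass R G.
Proof.
move=> lt_an; rewrite -scaleN1r; apply: eclass_rel => [|P H DP DH].
  by rewrite ewf_erenumber.
have lta : (a < size (ecirc P))%N by rewrite DP; apply: ltnW.
have lta' : (a.+1 < size (ecirc P))%N by rewrite DP.
have D1 : Ordinal lta' = (Ordinal lta).+1 :> nat by [].
have := @erel_renumber R P H (tperm (Ordinal lta) (Ordinal lta')).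
rewrite (odd_tperm_adjacent D1) expr1; apply; rewrite DH -DP.
have st := perm_nat_tperm D1; rewrite /erenumber; congr EPreGraph.
  by apply: eq_map => v; rewrite st.
by apply: eq_map => -[[k|k] [l|l]]; rewrite /eedge_map /= ?st.
Qed.

Lemma eclass_swap c r E1 x y E2 :
  eclass R (EPreGraph c r (E1 ++ y :: x :: E2)) =
  - eclass R (EPreGraph c r (E1 ++ x :: y :: E2)).
Proof.
rewrite -scaleN1r; apply: eclass_rel => [|P H DP DH].
  by apply: ewf_perm; rewrite perm_cat2l; apply: (permEl (perm_catCA [:: x] [:: y] E2)).
have szP : eedges P = E1 ++ x :: y :: E2 by rewrite DP.
have lta' : ((size E1).+1 < size (eedges P))%N by rewrite szP size_cat /=; lia.
have lta : (size E1 < size (eedges P))%N by apply: ltnW.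
have D1 : Ordinal lta' = (Ordinal lta).+1 :> nat by [].
have := @erel_edges R P H (tperm (Ordinal lta) (Ordinal lta')).
rewrite (odd_tperm_adjacent D1) expr1; apply; rewrite ?DH ?DP //=.
  by rewrite !size_cat.
move=> i; rewrite -perm_natE (perm_nat_tperm D1) /=; move: (nat_of_ord i) => k.
by rewrite szP; apply: nth_swp.
Qed.

Lemma eclass_inadmissible G : ~~ eadmissible G -> eclass R G = 0.
Proof.
move=> nadm; rewrite -[RHS](scale0r (eclass R G)); apply: eclass_rel => // P H DP DH.
by rewrite scale0r subr0; apply: erel_inadmissible; rewrite DH.
Qed.

(** The relation [erel_same] is split into rotation of the circle, reversal of edges and renaming of
    internal vertices; all permutations are reduced to adjacent transpositions. *)
Record ecompatible (M : lmodType R) (f : epregraph -> M) : Prop := ECompatible {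
  ecompatible_rot c r E k : ewf (EPreGraph c r E) ->
    f (EPreGraph (rot k c) r E) = f (EPreGraph c r E);
  ecompatible_same_ends c r E E' : ewf (EPreGraph c r E) -> all2 esame_ends E' E ->
    f (EPreGraph c r E') = f (EPreGraph c r E);
  ecompatible_erename a G : ewf G -> (a.+1 < eint G)%N -> f (erename a G) = f G;
  ecompatible_erenumber a G : ewf G -> (a.+1 < size (ecirc G))%N ->
    f (erenumber (swp a) G) = - f G;
  ecompatible_swap c r E1 x y E2 : ewf (EPreGraph c r (E1 ++ x :: y :: E2)) ->
    f (EPreGraph c r (E1 ++ y :: x :: E2)) = - f (EPreGraph c r (E1 ++ x :: y :: E2));
  ecompatible_inadmissible G : ewf G -> ~~ eadmissible G -> f G = 0 }.

Lemma ecompatible_rename (M : lmodType R) (f : epregraph -> M) n (s : 'S_n) c E :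
    ecompatible f -> ewf (EPreGraph c n E) ->
  let E' := map (eedge_map (vertex_map id (perm_nat s))) E in
  ewf (EPreGraph c n E') /\ f (EPreGraph c n E') = f (EPreGraph c n E).
Proof.
move=> fP; elim/perm_adjacent_ind: s E => [|t u IHt IHu|i j Dj] E wfE /=.
- by rewrite map_rename1.
- have [wft ft] := IHt E wfE; have [wfu fu] := IHu _ wft.
  have -> : map (eedge_map (vertex_map id (perm_nat (t * u)%g))) E =
      map (eedge_map (vertex_map id (perm_nat u)))
        (map (eedge_map (vertex_map id (perm_nat t))) E).
    rewrite -map_comp; apply: eq_map => -[[a|a] [b|b]]; rewrite /eedge_map /= ?perm_natM //.
  by rewrite fu ft.
have -> : map (eedge_map (vertex_map id (perm_nat (tperm i j)))) E =
          eedges (erename i (EPreGraph c n E)).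
  by apply: eq_map => -[[a|a] [b|b]]; rewrite /eedge_map /= ?(perm_nat_tperm Dj).
have lti : (i.+1 < n)%N by rewrite -Dj.
have := @ecompatible_erename _ _ fP i (EPreGraph c n E) wfE lti.
by have := @ewf_erename i (EPreGraph c n E) lti; rewrite /erename /= => -> ->.
Qed.

Lemma ecompatible_renumber (M : lmodType R) (f : epregraph -> M) G (s : 'S_(size (ecirc G))) :
    ecompatible f -> ewf G ->
  f (erenumber (perm_nat s) G) = (-1) ^+ s *: f G.
Proof.
move=> fP wfG; suff H n : forall (s : 'S_n) G, size (ecirc G) = n -> ewf G ->
    ewf (erenumber (perm_nat s) G) /\
    f (erenumber (perm_nat s) G) = (-1) ^+ s *: f G by case: (H _ s G).
elim/perm_adjacent_ind => [|t u IHt IHu|i j Dj] {s wfG}{}G DG wfG.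
- suff -> : erenumber (perm_nat (1 : 'S_n)%g) G = G.
    by rewrite odd_perm1 expr0 scale1r.
  case: (G) => c r E; rewrite /erenumber /= -[RHS]/(EPreGraph c r E); congr EPreGraph.
    by rewrite -[RHS]map_id; apply: eq_map => v; rewrite perm_nat1.
  by rewrite -[RHS]map_id; apply: eq_map => -[[a|a] [b|b]]; rewrite /eedge_map /= ?perm_nat1.
- have [wft ft] := IHt G DG wfG.
  have [|wfu fu] := IHu (erenumber _ G) _ wft; first by rewrite size_map.
  have -> : erenumber (perm_nat (t * u)%g) G =
            erenumber (perm_nat u) (erenumber (perm_nat t) G).
    rewrite /erenumber /=; congr EPreGraph; rewrite -map_comp.
      by apply: eq_map => v; rewrite perm_natM.
    by apply: eq_map => -[[a|a] [b|b]]; rewrite /eedge_map /= ?perm_natM.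
  by rewrite wfu fu ft scalerA odd_permM signr_addb mulrC.
have -> : erenumber (perm_nat (tperm i j)) G = erenumber (swp i) G.
  congr EPreGraph; first by apply: eq_map => v; rewrite (perm_nat_tperm Dj).
  by apply: eq_map => -[[a|a] [b|b]]; rewrite /eedge_map /= ?(perm_nat_tperm Dj).
have lti : (i.+1 < size (ecirc G))%N by rewrite DG -Dj.
by rewrite ewf_erenumber // ecompatible_erenumber // odd_tperm_adjacent // scaleN1r.
Qed.

Lemma ecompatible_edges (M : lmodType R) (f : epregraph -> M) c r n (s : 'S_n) E E' :
    ecompatible f -> ewf (EPreGraph c r E) -> size E = n -> size E' = n ->
    (forall i : 'I_n, nth edefault E' (s i) = nth edefault E i) ->
  ewf (EPreGraph c r E') /\ f (EPreGraph c r E') = (-1) ^+ s *: f (EPreGraph c r E).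
Proof.
move=> fP; elim/perm_adjacent_ind: s E E' => [|t u IHt IHu|i j Dj] E E' wfE szE szE' Dnth.
- suff -> : E' = E by rewrite odd_perm1 expr0 scale1r.
  apply: (@eq_from_nth _ edefault); rewrite szE' ?szE // => k ltk.
  by have := Dnth (Ordinal ltk); rewrite perm1.
(* The intermediate list is [E] permuted by [t] alone, the factor of the product that acts first;
   [u] then takes it to [E']. *)
- pose F := mkseq (fun k => nth edefault E (perm_nat t^-1%g k)) n.
  have szF : size F = n by rewrite size_mkseq.
  have DF (i : 'I_n) : nth edefault F (t i) = nth edefault E i.
    by rewrite nth_mkseq // perm_natE permK.
  have [wfF fF] := IHt E F wfE szE szF DF.
  have [|wfE' fE'] := IHu F E' wfF szF szE'.
    move=> i; have := Dnth (t^-1%g i); rewrite permM permKV => ->.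
    by rewrite -DF permKV.
  by rewrite fE' fF scalerA odd_permM signr_addb mulrC.
have lti : (i.+1 < size E)%N by rewrite szE -Dj.
have [|k ltk|E1 [x [y [E2 [DE DE' szE1]]]]] := @swap_adjacent _ edefault E E' i lti.
- by rewrite szE.
- rewrite szE in ltk; have := Dnth (Ordinal ltk).
  by rewrite -perm_natE (perm_nat_tperm Dj).
rewrite DE in wfE; rewrite DE DE' (ecompatible_swap fP) // odd_tperm_adjacent // expr1 scaleN1r.
split=> //; rewrite (@ewf_perm _ _ (E1 ++ x :: y :: E2)) //.
by rewrite perm_cat2l; apply: (permEl (perm_catCA [:: y] [:: x] E2)).
Qed.

Lemma ecompatible_kills (M : lmodType R) (f : epregraph -> M) : ecompatible f ->
  forall b : {malg R[egraph]}, erel b -> lext (fun G : egraph => f G) b = 0.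
Proof.
move=> fP b; case=> {b}.
- move=> G H k s Dr Dc EH; rewrite lextB !lextU; have : ewf (egraph_val G) := valP G.
  move: s Dr Dc EH; case: (egraph_val G) => c r E; case: (egraph_val H) => c' r' E'.
  move=> /= s -> -> EH wfG.
  have [wfE fE] := ecompatible_rename s fP wfG.
  rewrite (ecompatible_rot fP) ?(ecompatible_same_ends fP _ EH) //.
    by rewrite fE subrr.
  by rewrite (ewf_same_ends _ _ EH).
- move=> G H s DH; rewrite lextB lextZ !lextU DH ecompatible_renumber ?subrr //.
  exact: valP.
- move=> G H s Dc Dr sz Dnth; rewrite lextB lextZ !lextU.
  have : ewf (egraph_val G) := valP G.
  move: s Dr Dc sz Dnth; case: (egraph_val G) => c r E; case: (egraph_val H) => c' r' E'.
  move=> /= s -> -> sz Dnth wfG.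
  by have [_ ->] := ecompatible_edges fP wfG erefl sz Dnth; rewrite subrr.
by move=> G nadm; rewrite lextU ecompatible_inadmissible //; exact: valP.
Qed.
End EvenRelations.

(** * The even complex: the coboundary respects the relations *)

Lemma drop_label_swp a k :
  (forall l, l != k -> drop_label (swp a k) (swp a l) = drop_label k l) \/
  exists2 b, (forall l, l != k -> drop_label (swp a k) (swp a l) = swp b (drop_label k l)) &
    forall n, (a.+1 < n -> k < n -> b.+1 < n.-1)%N.
Proof.
have [Dk|Nk] := eqVneq k a.
  have -> : swp a k = a.+1 by rewrite Dk /swp eqxx.
  by left=> l; rewrite /drop_label /swp Dk; do !case: ifP; lia.
have [Dk|Nk'] := eqVneq k a.+1.
  have -> : swp a k = a by rewrite Dk /swp eqxx gtn_eqF.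
  by left=> l; rewrite /drop_label /swp Dk; do !case: ifP; lia.
have -> : swp a k = k by rewrite /swp (negPf Nk) (negPf Nk').
(* The surviving transposition goes down by one when the dropped name [k] lies below the transposed
   pair. *)
right; exists (if (k < a)%N then a.-1 else a) => [l|n]; last by case: ifP; lia.
case: (ltnP k a) => lta; rewrite /drop_label.
  by rewrite /swp; do !case: ifP; lia.
by rewrite /swp; do !case: ifP; lia.
Qed.

(** The unsigned counterpart of [contraction_sign_swp] for internal names: a transposition of names
    is absorbed by the contraction or survives as a transposition of the remaining names, and
    neither outcome affects the class. *)
Lemma identify_erename a u v : contractible u v ->
  let h := vertex_map id (swp a) in
  (forall x, identify (h u) (h v) (h x) = identify u v x) \/
  exists2 b, (forall x, identify (h u) (h v) (h x) =
                        vertex_map id (swp b) (identify u v x)) &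
    forall p r, (a.+1 < r)%N -> evalid p r u -> evalid p r v -> (b.+1 < r.-1)%N.
Proof.
move=> uv /=; elim/contractible_ind: uv => {u v} [u v IH|i k|k l kl].
- case: IH => [IH|[b IH ltb]]; first by left=> x; rewrite identifyC IH identifyC.
  right; exists b => [x|p r lta vv vu]; last exact: (ltb p).
  by rewrite identifyC IH identifyC.
- have eqk l : (swp a l == swp a k) = (l == k) by rewrite (inj_eq (@swp_inj a)).
  case: (drop_label_swp a k) => [eqd|[b eqd ltb]].
    left=> -[l|l] //=; rewrite !vertex_eqE eqk; case: eqVneq => //= lk.
    by rewrite [if _ then _ else _]eqd.
  right; exists b => [[l|l]|p r lta _ ltk] //=; last exact: ltb.
  rewrite !vertex_eqE eqk; case: eqVneq => //= lk; congr inr; exact: eqd.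
case: (contraction_sign_swp a kl) => [[_ eqc]|[_ [b eqc ltb]]].
  by left=> -[m|m] //=; rewrite eqc.
right; exists b => [[m|m]|p r lta ltk ltl] //=; [by rewrite eqc|exact: ltb].
Qed.

(** Contracting an edge never removes an external label, so it commutes with any relabelling of the
    external vertices. *)
Lemma identify_erenumber f u v x : contractible u v ->
  let h := vertex_map f id in identify (h u) (h v) (h x) = h (identify u v x).
Proof.
move=> uv /=; elim/contractible_ind: uv x => {u v} [u v IH x|i k x|k l kl x].
- by rewrite identifyC IH identifyC.
- by case: x => l //=; rewrite !vertex_eqE; case: eqP.
by case: x.
Qed.

Lemma econtract_arcE i j c r E : econtract_arc i j (EPreGraph c r E) =
  EPreGraph (map (collapse i j) (rem j c)) r
    (map (eedge_map (vertex_map (collapse i j) id)) E).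
Proof. by []. Qed.

Lemma eq_eedge_map h h' : h =1 h' -> eedge_map h =1 eedge_map h'.
Proof. by move=> eqh [u v]; rewrite /eedge_map /= !eqh. Qed.

Lemma eregular_vertex_map f g e :
  eregular (eedge_map (vertex_map f g) e) = eregular e.
Proof. by case: e => [[k|k] [l|l]]. Qed.

Lemma eregular_same_ends e e' : esame_ends e e' -> eregular e = eregular e'.
Proof. by case/esame_endsP=> -> //; rewrite /eregular /= andbC. Qed.

Lemma identify_same_ends e e' : esame_ends e e' ->
  identify e.1 e.2 =1 identify e'.1 e'.2.
Proof. by case/esame_endsP=> -> //= x; apply: identifyC. Qed.

Section EvenDelta.
Variable R : realType.

Lemma edeltaE c r E : edelta_graph R (EPreGraph c r E) =
  if eadmissible (EPreGraph c r E) then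
    \sum_(a <- arcs c) (-1) ^+ contraction_sign a.1 a.2 *:
      eclass R (econtract_arc a.1 a.2 (EPreGraph c r E)) +
    \sum_(0 <= a < size E | eregular (nth edefault E a))
      (-1) ^+ (a.+1 + 1 + size c) *: eclass R (econtract_edge a (EPreGraph c r E))
  else 0.
Proof. by []. Qed.

Lemma edelta_rot c r E k : ewf (EPreGraph c r E) ->
  edelta_graph R (EPreGraph (rot k c) r E) = edelta_graph R (EPreGraph c r E).
Proof.
case/ewfP=> Uc _ _ _; rewrite !edeltaE.
rewrite (@eadmissible_perm c _ r _ E _ (perm_refl E)); case: ifP => // adm; congr (_ + _).
  rewrite (perm_big _ (perm_arcs_rot k Uc)); apply: eq_bigr => -[i j] _ /=.
  have [m] := contract_circle_rot k i j Uc; rewrite /econtract_arc /= => ->.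
  by rewrite eclass_rot.
by apply: eq_bigr => a _; rewrite !econtract_edgeE eclass_rot size_rot.
Qed.

Lemma edelta_same_ends c r E E' : ewf (EPreGraph c r E) -> all2 esame_ends E' E ->
  edelta_graph R (EPreGraph c r E') = edelta_graph R (EPreGraph c r E).
Proof.
move=> wfG EE'; rewrite !edeltaE (eadmissible_same_ends c c r r EE').
case: ifP => // adm; congr (_ + _).
  apply: eq_bigr => -[i j] _ /=; rewrite !econtract_arcE; congr (_ *: _).
  by apply: eclass_same_ends; apply: all2_map EE' => e f; apply: esame_ends_map.
rewrite (all2_size EE').
have same a := all2_nth a (esame_endsxx edefault) EE'.
apply: eq_big => [a|a _]; first exact: eregular_same_ends.
rewrite !econtract_edgeE; congr (_ *: _); apply: eclass_same_ends.
apply: all2_map (all2_del a EE') => e f /esame_ends_map h.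
by rewrite (eq_eedge_map (identify_same_ends (same a))); apply: h.
Qed.

Lemma edelta_erename a G : ewf G -> (a.+1 < eint G)%N ->
  edelta_graph R (erename a G) = edelta_graph R G.
Proof.
case: G => c r E wfG lta; have /ewfP[Uc cn En _] := wfG.
rewrite -[erename _ _]/(EPreGraph c r (map (eedge_map (vertex_map id (swp a))) E)).
rewrite !edeltaE (@eadmissible_vertex_map id (swp a) c c r r E) //; last exact: swp_inj.
case: ifP => // adm; congr (_ + _).
  apply: eq_bigr => -[i j] _ /=; congr (_ *: _).
  rewrite -(@eclass_erename R a (econtract_arc i j (EPreGraph c r E))) //.
  congr (eclass R (EPreGraph _ _ _)); rewrite -!map_comp.
  by apply: eq_map => -[[k|k] [l|l]].
rewrite size_map big_nat_cond [RHS]big_nat_cond; apply: eq_big => b.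
  case: (ltnP b (size E)) => [ltb|_]; last by rewrite andbF.
  by rewrite (nth_map edefault) // eregular_vertex_map.
case/andP=> ltb; rewrite (nth_map edefault) // eregular_vertex_map => reg.
congr (_ *: _); rewrite !econtract_edgeE (nth_map edefault) // -map_del -map_comp.
have := contractible_nth adm ltb reg; have := En _ (mem_nth edefault ltb).
move: (nth _ _ _) => [u v] /= /andP[vu vv] uv.
case: (identify_erename a uv) => [eqi|[b' eqi ltb']].
  by congr (eclass R (EPreGraph _ _ _)); apply: eq_map => e; rewrite /eedge_map /= !eqi.
rewrite -[RHS](@eclass_erename R b' (EPreGraph c r.-1 _)); last exact: ltb' vu vv.
congr (eclass R (EPreGraph _ _ _)); rewrite -map_comp.
by apply: eq_map => e; rewrite /eedge_map /= !eqi.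
Qed.

Lemma edelta_erenumber a G : ewf G -> (a.+1 < size (ecirc G))%N ->
  edelta_graph R (erenumber (swp a) G) = - edelta_graph R G.
Proof.
case: G => c r E wfG lta; have /ewfP[Uc cn En _] := wfG.
rewrite -[erenumber _ _]/(EPreGraph (map (swp a) c) r
  (map (eedge_map (vertex_map (swp a) id)) E)).
rewrite !edeltaE (@eadmissible_vertex_map (swp a) id c _ r r E) //; last exact: swp_inj.
case: ifP => [adm|_]; last by rewrite oppr0.
rewrite opprD -!sumrN; congr (_ + _).
  rewrite (arcs_map (@swp_inj a) Uc) big_map big_seq [RHS]big_seq.
  apply: eq_bigr => -[i j] aij /=; have /andP[ic jc] := mem_arcs aij.
  have ij := arcs_neq Uc aij.
  rewrite !econtract_arcE (map_rem (@swp_inj a)) -!map_comp.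
  case: (contraction_sign_swp a ij) => [[odds eqc]|[odds [b eqc ltb]]].
    rewrite (signr_oddN _ odds) scaleNr; congr (- (_ *: eclass R (EPreGraph _ _ _))).
      by apply: eq_map => v /=; rewrite eqc.
    by apply: eq_map => -[[k|k] [l|l]]; rewrite /eedge_map /= ?eqc.
  rewrite (signr_eq_odd _ odds) -scalerN -(@eclass_erenumber _ b); last first.
    by rewrite size_map size_rem //; apply: ltb; [exact: lta|exact: cn|exact: cn].
  congr (_ *: eclass R (EPreGraph _ _ _)); rewrite -map_comp.
    by apply: eq_map => v /=; rewrite eqc.
  by apply: eq_map => -[[k|k] [l|l]]; rewrite /eedge_map /= ?eqc.
rewrite !size_map big_nat_cond [RHS]big_nat_cond; apply: eq_big => b.
  case: (ltnP b (size E)) => [ltb|_]; last by rewrite andbF.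
  by rewrite (nth_map edefault) // eregular_vertex_map.
case/andP=> ltb; rewrite (nth_map edefault) // eregular_vertex_map => reg.
rewrite !econtract_edgeE (nth_map edefault) // -map_del -map_comp -scalerN.
rewrite -(@eclass_erenumber R a (EPreGraph c r.-1 _)) //.
congr (_ *: eclass R (EPreGraph _ _ _)); rewrite -map_comp; apply: eq_map => e.
have uv := contractible_nth adm ltb reg.
by rewrite /eedge_map /= !identify_erenumber.
Qed.

(** The counterpart of [contraction_sign_swp] for edge labels. If the removed edge is one of the two
    exchanged, its position changes parity and the remaining lists agree; otherwise its position is
    unchanged and the exchange survives among the remaining edges. *)
Lemma del_swap (T : Type) (s1 s2 : seq T) x y a :
  let s := s1 ++ x :: y :: s2 in let s' := s1 ++ y :: x :: s2 in
  (odd (swp (size s1) a) = ~~ odd a /\ del (swp (size s1) a) s' = del a s) \/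
  (swp (size s1) a = a /\ exists t1 t2, del a s = t1 ++ x :: y :: t2 /\
                                        del a s' = t1 ++ y :: x :: t2).
Proof.
rewrite /=; elim: s1 a => [|z s1 IH] a /=.
  case: a => [|[|a]]; [left; by rewrite /del /= drop0|left; by rewrite /del /= drop0|].
  by right; split=> //; exists [::], (del a s2).
case: a => [|a]; first by right; split=> //; exists s1, s2; rewrite /del /= !drop0.
have swpS : swp (size s1).+1 a.+1 = (swp (size s1) a).+1 := swp_addn 1 _ _.
have delS (t : seq T) b : del b.+1 (z :: t) = z :: del b t by [].
rewrite swpS !delS /=; case: (IH a) => [[-> ->]|[-> [t1 [t2 [-> ->]]]]]; first by left.
by right; split=> //; exists (z :: t1), t2.
Qed.

Lemma big_nat_swp (V : nmodType) n a (P : pred nat) (F : nat -> V) : (a.+1 < n)%N ->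
  \sum_(0 <= k < n | P k) F k = \sum_(0 <= k < n | P (swp a k)) F (swp a k).
Proof.
move=> lta; rewrite -(big_map (swp a) P F); apply: perm_big; apply: uniq_perm.
- exact: iota_uniq.
- by rewrite (map_inj_uniq (@swp_inj a)) iota_uniq.
by move=> k; rewrite -[k in RHS](swpK a) (mem_map (@swp_inj a)) !mem_index_iota swp_lt.
Qed.

Lemma edelta_swap c r E1 x y E2 : ewf (EPreGraph c r (E1 ++ x :: y :: E2)) ->
  edelta_graph R (EPreGraph c r (E1 ++ y :: x :: E2)) =
  - edelta_graph R (EPreGraph c r (E1 ++ x :: y :: E2)).
Proof.
move=> wfG; have pE : perm_eq (E1 ++ y :: x :: E2) (E1 ++ x :: y :: E2).
  by rewrite perm_cat2l; apply: (permEl (perm_catCA [:: y] [:: x] E2)).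
rewrite !edeltaE (eadmissible_perm c c r r pE).
case: ifP => [adm|_]; last by rewrite oppr0.
rewrite opprD -!sumrN; congr (_ + _).
  apply: eq_bigr => -[i j] _ /=; rewrite !econtract_arcE !map_cat /= eclass_swap.
  by rewrite scalerN.
(* Reindexing by the transposition matches each edge with itself in the other list. *)
rewrite (perm_size pE) (@big_nat_swp _ _ (size E1)); last first.
  by rewrite size_cat /= !addnS !ltnS leq_addr.
rewrite big_nat_cond [RHS]big_nat_cond; apply: eq_big => a; first by rewrite nth_swp.
rewrite nth_swp => /andP[lta reg]; rewrite !econtract_edgeE nth_swp.
case: (del_swap E1 E2 x y a) => /= [[odds ->]|[-> [t1 [t2 [-> ->]]]]].
  rewrite (@signr_oddN _ _ (a.+1 + 1 + size c)) ?scaleNr //.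
  by rewrite !oddD /= odds; case: (odd a); case: (odd _).
by rewrite !map_cat /= eclass_swap scalerN.
Qed.

Lemma edelta_compatible : ecompatible (edelta_graph R).
Proof.
split; [exact: edelta_rot|exact: edelta_same_ends|exact: edelta_erename|
  exact: edelta_erenumber|exact: edelta_swap|].
by move=> G _ nadm; rewrite /edelta_graph (negPf nadm).
Qed.
End EvenDelta.

(** * The even complex: the shuffle product respects the relations *)

Section EvenShuffle.
Variable R : realType.

Lemma eshuffleE c1 r1 E1 c2 r2 E2 :
  eshuffle_graph R (EPreGraph c1 r1 E1) (EPreGraph c2 r2 E2) =
  (-1) ^+ (size c2 * size E1) *:
    \sum_(w <- cyclic_shuffles c1 (map (addn (size c1)) c2))
      eclass R (EPreGraph w (r1 + r2)
        (E1 ++ map (eedge_map (eshift (size c1) r1)) E2)).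
Proof. by []. Qed.

Lemma map_eedge_id_in h p r (E : seq eedge) :
    (forall e, e \in E -> evalid p r e.1 && evalid p r e.2) ->
    (forall v, evalid p r v -> h v = v) -> map (eedge_map h) E = E.
Proof.
move=> En hid; rewrite -[RHS]map_id; apply/eq_in_map => e /En/andP[v1 v2].
by rewrite /eedge_map !hid // -surjective_pairing.
Qed.

Lemma eq_map_eedge h h' (E : seq eedge) : h =1 h' ->
  map (eedge_map h) E = map (eedge_map h') E.
Proof. by move=> eqh; apply: eq_map; apply: eq_eedge_map. Qed.

Lemma map_eedge_comp h h' (E : seq eedge) :
  map (eedge_map h) (map (eedge_map h') E) = map (eedge_map (h \o h')) E.
Proof. by rewrite -map_comp. Qed.

Lemma eshuffle_compatiblel G2 : ewf G2 ->
  ecompatible (fun G1 => eshuffle_graph R G1 G2).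
Proof.
case: G2 => c2 r2 E2 wf2; split.
- move=> c r E k wf1; rewrite !eshuffleE size_rot; congr (_ *: _).
  rewrite sum_cyclic_shuffles_rotl //; last by move=> m w _; apply: eclass_rot.
  exact: ejoin_circ_uniq wf1 wf2.
- move=> c r E E' wf1 EE'; rewrite !eshuffleE (all2_size EE'); congr (_ *: _).
  apply: eq_bigr => w _; apply: eclass_same_ends; apply: all2_cat EE' _.
  by apply: all2_refl; apply: esame_endsxx.
- move=> a [c r E] wf1 lta; rewrite [erename _ _]/= !eshuffleE size_map.
  congr (_ *: _); apply: eq_bigr => w _.
  rewrite -[RHS](@eclass_erename R a) /=; last exact: ltn_addr.
  congr (eclass R (EPreGraph _ _ _)); rewrite map_cat map_eedge_comp; congr cat.
  by apply: eq_map_eedge => -[k|k] //=; rewrite (@swp_ge a r) // leq_addr.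
- move=> a [c r E] wf1 lta; rewrite [erenumber _ _]/= !eshuffleE !size_map.
  have fix2 : map (swp a) (map (addn (size c)) c2) = map (addn (size c)) c2.
    by rewrite -map_comp; apply: eq_map => v /=; rewrite (@swp_ge a (size c)) // leq_addr.
  rewrite -{1}fix2 sum_cyclic_shuffles_map; last by move=> v v' _ _; apply: swp_inj.
  rewrite -scalerN -sumrN big_seq [X in _ = _ *: X]big_seq; congr (_ *: _).
  apply: eq_bigr => w w_sh; rewrite -(@eclass_erenumber _ a) /=; last first.
    by rewrite (@size_eshuffle r r2 c c2 E E2 w w_sh) ltn_addr.
  congr (eclass R (EPreGraph _ _ _)); rewrite map_cat map_eedge_comp; congr cat.
  by apply: eq_map_eedge => -[k|k] //=; rewrite (@swp_ge a (size c)) // leq_addr.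
- move=> c r E1 x y E1' wf1; rewrite !eshuffleE -scalerN -sumrN !size_cat /=.
  by congr (_ *: _); apply: eq_bigr => w _; rewrite -!catA /= eclass_swap.
case=> c r E wf1 nadm; rewrite /eshuffle_graph big_seq big1 ?scaler0 // => w w_sh.
by apply: eclass_inadmissible; rewrite eadmissible_ejoin // (negPf nadm).
Qed.

Lemma eshuffle_compatibler G1 : ewf G1 ->
  ecompatible (fun G2 => eshuffle_graph R G1 G2).
Proof.
case: G1 => c1 r1 E1 wf1; have /ewfP[Uc1 cn1 En1 _] := wf1; split.
- move=> c r E k wf2; rewrite !eshuffleE size_rot map_rot; congr (_ *: _).
  have Uc := ejoin_circ_uniq wf1 wf2; have Uc' := Uc; rewrite uniq_catC in Uc'.
  have Uck : uniq (c1 ++ rot k (map (addn (size c1)) c)).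
    by rewrite (perm_uniq (s2 := c1 ++ map (addn (size c1)) c)) // perm_cat2l perm_rot.
  have rotF r' F m (w : seq nat) : uniq w ->
    eclass R (EPreGraph (rot m w) r' F) = eclass R (EPreGraph w r' F).
    by move=> _; apply: eclass_rot.
  (* The second circle is brought to the first place, where rotations are harmless, and then moved
     back. *)
  rewrite [LHS](sum_cyclic_shufflesC Uck (rotF _ _)).
  rewrite (sum_cyclic_shuffles_rotl _ Uc' (rotF _ _)).
  by rewrite [LHS](sum_cyclic_shufflesC Uc' (rotF _ _)).
- move=> c r E E' wf2 EE'; rewrite !eshuffleE; congr (_ *: _).
  apply: eq_bigr => w _; apply: eclass_same_ends; apply: all2_cat.
    by apply: all2_refl; apply: esame_endsxx.
  by apply: all2_map EE' => e f; apply: esame_ends_map.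
- move=> a [c r E] wf2 lta; rewrite [erename _ _]/= !eshuffleE.
  congr (_ *: _); apply: eq_bigr => w _.
  rewrite -[RHS](@eclass_erename R (r1 + a)) /=; last by rewrite -addnS ltn_add2l.
  congr (eclass R (EPreGraph _ _ _)); rewrite map_cat !map_eedge_comp; congr cat.
    apply/esym; apply: (map_eedge_id_in En1) => -[k|k] //= ltk.
    by rewrite swp_lt_id // ltn_addr.
  by apply: eq_map_eedge => -[k|k] //=; rewrite swp_addn.
- move=> a [c r E] wf2 lta; rewrite [erenumber _ _]/= !eshuffleE !size_map.
  have fix1 : map (swp (size c1 + a)) c1 = c1.
    rewrite -[RHS]map_id; apply/eq_in_map => v /cn1 ltv.
    by rewrite swp_lt_id // ltn_addr.
  have -> : map (addn (size c1)) (map (swp a) c) =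
            map (swp (size c1 + a)) (map (addn (size c1)) c).
    by rewrite -!map_comp; apply: eq_map => v /=; rewrite swp_addn.
  rewrite -{1}fix1 sum_cyclic_shuffles_map; last by move=> v v' _ _; apply: swp_inj.
  rewrite -scalerN -sumrN big_seq [X in _ = _ *: X]big_seq; congr (_ *: _).
  apply: eq_bigr => w w_sh; rewrite -(@eclass_erenumber _ (size c1 + a)) /=; last first.
    by rewrite (@size_eshuffle r1 r c1 c E1 E w w_sh) -addnS ltn_add2l.
  congr (eclass R (EPreGraph _ _ _)); rewrite map_cat !map_eedge_comp; congr cat.
    apply/esym; apply: (map_eedge_id_in En1) => -[k|k] //= ltk.
    by rewrite swp_lt_id // ltn_addr.
  by apply: eq_map_eedge => -[k|k] //=; rewrite swp_addn.
- move=> c r E x y E' wf2; rewrite !eshuffleE -scalerN -sumrN.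
  by congr (_ *: _); apply: eq_bigr => w _; rewrite !map_cat !catA /= eclass_swap.
case=> c r E wf2 nadm; rewrite /eshuffle_graph big_seq big1 ?scaler0 // => w w_sh.
by apply: eclass_inadmissible; rewrite eadmissible_ejoin // (negPf nadm) andbF.
Qed.
End EvenShuffle.

(** * The even complex: the Leibniz rule for two graphs *)

Lemma contractible_gt0 p r u v : contractible u v ->
  evalid p r u -> evalid p r v -> (0 < r)%N.
Proof.
move=> uv; elim/contractible_ind: uv => {u v} [u v IH vv vu|i k _|k l _].
- exact: IH.
- exact: leq_ltn_trans.
by move=> ltk _; apply: leq_ltn_trans ltk.
Qed.

(** The contraction uses up one internal name of the first factor and no external label, so only the
    shift of internal names drops by one. *)
Lemma identify_eshift_fresh p r u v x : contractible u v ->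
  evalid p r u -> evalid p r v -> identify u v (eshift p r x) = eshift p r.-1 x.
Proof.
move=> uv; elim/contractible_ind: uv => {u v} [u v IH vv vu|i k|k l kl].
- by rewrite identifyC; apply: IH.
- rewrite identify_mixed /= => lti ltk; case: x => a //=; rewrite vertex_eqE.
  by rewrite gtn_eqF ?ltn_addr //= /drop_label ltn_addr //; congr inr; lia.
by case: x => a //= ltk ltl; rewrite collapse_shift.
Qed.

Lemma identify_eshift p r u v x : contractible u v ->
  identify (eshift p r u) (eshift p r v) (eshift p r x) = eshift p r (identify u v x).
Proof.
move=> uv; elim/contractible_ind: uv x => {u v} [u v IH x|i k x|k l kl x].
- by rewrite identifyC IH identifyC.
- case: x => l //=; rewrite !vertex_eqE eqn_add2l; case: eqP => //= lk.
  by rewrite /eshift /= ltn_add2l; congr inr; case: ifP; lia.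
by case: x => a //=; rewrite collapse_addn.
Qed.

Lemma identify_eshift_id p r u v x : contractible u v -> evalid p r x ->
  identify (eshift p r u) (eshift p r v) x = x.
Proof.
move=> uv; elim/contractible_ind: uv => {u v} [u v IH|i k|k l kl].
- by rewrite identifyC.
- case: x => l //= ltl; rewrite vertex_eqE ltn_eqF ?ltn_addr //=.
  by rewrite ltnNge ltnW // ltn_addr.
by case: x => a //= lta; rewrite collapse_id.
Qed.

Lemma del_catl (T : Type) a (s1 s2 : seq T) : (a < size s1)%N ->
  del a (s1 ++ s2) = del a s1 ++ s2.
Proof.
rewrite /del; elim: s1 a => // x s1 IH [|a] /=; first by rewrite !drop0.
by rewrite ltnS => /IH ->.
Qed.

Lemma del_catr (T : Type) a (s1 s2 : seq T) :
  del (size s1 + a) (s1 ++ s2) = s1 ++ del a s2.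
Proof. by rewrite /del; elim: s1 => //= x s1 ->. Qed.

Lemma size_del (T : Type) a (s : seq T) : (a < size s)%N -> size (del a s) = (size s).-1.
Proof.
by move=> lta; rewrite size_cat size_take size_drop lta; lia.
Qed.

Section EvenLeibniz.
Variables (R : realType) (r1 r2 : nat) (c1 c2 : seq nat) (E1 E2 : seq eedge).
Local Notation G1 := (EPreGraph c1 r1 E1).
Local Notation G2 := (EPreGraph c2 r2 E2).
Hypotheses (wf1 : ewf G1) (wf2 : ewf G2).
Hypotheses (adm1 : eadmissible G1) (adm2 : eadmissible G2).

Let c2' := map (addn (size c1)) c2.
Let E2' := map (eedge_map (eshift (size c1) r1)) E2.

Let ltc1 v : v \in c1 -> (v < size c1)%N.
Proof. by have /ewfP[_ cn _ _] := wf1; apply: cn. Qed.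

Let valid1 e : e \in E1 -> evalid (size c1) r1 e.1 && evalid (size c1) r1 e.2.
Proof. by have /ewfP[_ _ En _] := wf1; apply: En. Qed.

Let Uc : uniq (c1 ++ c2') := ejoin_circ_uniq wf1 wf2.

Lemma edelta_ejoin_arcs :
  (-1) ^+ elambda G1 G2 *: (\sum_(w <- eshuffles G1 G2) \sum_(a <- arcs w)
     (-1) ^+ contraction_sign a.1 a.2 *: eclass R (econtract_arc a.1 a.2 (ejoin G1 G2 w))) =
  \sum_(a <- arcs c1) (-1) ^+ contraction_sign a.1 a.2 *:
     eshuffle_graph R (econtract_arc a.1 a.2 G1) G2 +
  (-1) ^+ edegree G1 *: \sum_(a <- arcs c2) (-1) ^+ contraction_sign a.1 a.2 *:
     eshuffle_graph R G1 (econtract_arc a.1 a.2 G2).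
Proof.
(* As in the odd case, the relabelled edges depend on the arc and not on the shuffle. *)
pose h i j := map (eedge_map (vertex_map (collapse i j) id)).
pose F i j w := (-1) ^+ contraction_sign i j *:
  eclass R (EPreGraph w (r1 + r2) (h i j (E1 ++ E2'))).
transitivity ((-1) ^+ (size c2 * size E1) *:
    \sum_(w <- cyclic_shuffles c1 c2') \sum_(a <- arcs w)
      F a.1 a.2 (contract_circle a.1 a.2 w)) => //.
rewrite sum_arcs_shuffle //; first last.
- move=> i j w /ltc1 lti /mapP[k _ ->]; rewrite /F.
  have ij : i != (size c1 + k)%N by rewrite ltn_eqF // ltn_addr.
  rewrite (signr_oddN _ (odd_contraction_signC ij)) scaleNr.
  apply/eqP; rewrite subr_eq0; apply/eqP; congr (_ *: eclass R (EPreGraph _ _ _)).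
  by apply: eq_map_eedge => -[l|l] //=; rewrite collapseC.
- by move=> i j k w; rewrite /F eclass_rot.
rewrite scalerDr !scaler_sumr; congr (_ + _).
  rewrite big_seq [RHS]big_seq; apply: eq_bigr => -[i j] aij /=.
  have /andP[ic jc] := mem_arcs aij; have lti := ltc1 ic; have ltj := ltc1 jc.
  have szc : size (contract_circle i j c1) = (size c1).-1 by rewrite size_map size_rem.
  rewrite econtract_arcE eshuffleE szc size_map -scaler_sumr !scalerA mulrC.
  congr (_ *: _).
  have -> : map (collapse i j) c2' = map (addn (size c1).-1) c2.
    by rewrite -map_comp; apply: eq_map => v /=; rewrite collapse_shift.
  apply: eq_bigr => w _; rewrite /h map_cat map_eedge_comp.
  congr (eclass R (EPreGraph _ _ (_ ++ _))).
  by apply: eq_map_eedge => -[l|l] //=; rewrite collapse_shift.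
have /ewfP[Uc2 _ _ _] := wf2.
rewrite (arcs_map (@addnI (size c1)) Uc2) big_map big_seq [RHS]big_seq.
apply: eq_bigr => -[i j] aij /=; have /andP[ic jc] := mem_arcs aij.
have szc : size (contract_circle i j c2) = (size c2).-1 by rewrite size_map size_rem.
rewrite /F contraction_sign_addn -scaler_sumr econtract_arcE eshuffleE szc !scalerA.
rewrite contract_circle_addn; have -> : map (collapse (size c1 + i) (size c1 + j)) c1 = c1.
  by rewrite -[RHS]map_id; apply/eq_in_map => v /ltc1 ltv; rewrite collapse_id.
congr (_ *: _).
  (* The label shift contributes [size c1]. Contracting an arc of [c2] also lowers [elambda] by
     [size E1]; together they make up [edegree G1]. *)
  rewrite /edegree /= -!exprD; apply: signr_eq_odd.
  have : (0 < size c2)%N by case: (c2) ic.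
  case: (size c2) => // m _; rewrite mulSn !oddD oddM.
  by case: (odd (size E1)); case: (odd (size c1)); case: (odd m); case: (odd _).
apply: eq_bigr => w _; rewrite /h map_cat !map_eedge_comp.
congr (eclass R (EPreGraph _ _ (_ ++ _))).
  apply: (map_eedge_id_in valid1) => -[l|l] //= ltl; by rewrite collapse_id.
by apply: eq_map_eedge => -[l|l] //=; rewrite collapse_addn.
Qed.

Lemma edelta_ejoin_edges :
  (-1) ^+ elambda G1 G2 *: (\sum_(w <- eshuffles G1 G2)
     \sum_(0 <= a < size (eedges (ejoin G1 G2 w)) |
           eregular (nth edefault (eedges (ejoin G1 G2 w)) a))
       (-1) ^+ (a.+1 + 1 + size w) *: eclass R (econtract_edge a (ejoin G1 G2 w))) =
  \sum_(0 <= a < size E1 | eregular (nth edefault E1 a))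
     (-1) ^+ (a.+1 + 1 + size c1) *: eshuffle_graph R (econtract_edge a G1) G2 +
  (-1) ^+ edegree G1 *: \sum_(0 <= a < size E2 | eregular (nth edefault E2 a))
     (-1) ^+ (a.+1 + 1 + size c2) *: eshuffle_graph R G1 (econtract_edge a G2).
Proof.
(* Contracting an edge changes neither the circle nor its labels, so the same shuffle [w] is used
   before and after, and the sums over shuffles and over edges can simply be exchanged. *)
transitivity ((-1) ^+ (size c2 * size E1) *: (\sum_(w <- cyclic_shuffles c1 c2')
    (\sum_(0 <= a < size E1 | eregular (nth edefault E1 a))
      (-1) ^+ (a.+1 + 1 + (size c1 + size c2)) *:
        eclass R (ejoin (econtract_edge a G1) G2 w) +
     \sum_(0 <= a < size E2 | eregular (nth edefault E2 a))
      (-1) ^+ (size E1 + a.+1 + 1 + (size c1 + size c2)) *: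
        eclass R (ejoin G1 (econtract_edge a G2) w)))).
  congr (_ *: _); rewrite big_seq [RHS]big_seq; apply: eq_bigr => w w_sh.
  have szw := @size_eshuffle r1 r2 c1 c2 E1 E2 w w_sh.
  rewrite [eedges _]/= size_cat size_map (@big_cat_nat _ _ _ (size E1)) ?leq_addr //=.
  congr (_ + _).
    rewrite big_nat_cond [RHS]big_nat_cond; apply: eq_big => a.
      by case: (ltnP a (size E1)) => lta; rewrite ?andbF // nth_cat lta.
    rewrite nth_cat; case/andP=> /andP[_ lta]; rewrite lta szw => reg.
    rewrite /ejoin econtract_edgeE nth_cat lta del_catl // map_cat -/E2'.
    have uv := contractible_nth adm1 lta reg.
    have /andP[vu vv] := valid1 (mem_nth edefault lta).
    rewrite econtract_edgeE /=; congr (_ *: eclass R (EPreGraph _ _ (_ ++ _))).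
      (* A contractible pair has an internal end, so [r1] is positive and the truncated predecessor
         passes to the first summand. *)
      by case: (r1) (contractible_gt0 uv vu vv).
    by rewrite map_eedge_comp; apply: eq_map_eedge => x /=; apply: identify_eshift_fresh.
  rewrite -{1}[size E1]add0n big_addn addKn.
  have nthE2 a : (a < size E2)%N -> nth edefault (E1 ++ E2') (a + size E1) =
      eedge_map (eshift (size c1) r1) (nth edefault E2 a).
    by move=> lta; rewrite nth_cat ltnNge leq_addl addnK /= (nth_map edefault).
  rewrite big_nat_cond [RHS]big_nat_cond; apply: eq_big => a.
    case: (ltnP a (size E2)) => lta; rewrite ?andbF // nthE2 //.
    by rewrite eregular_vertex_map.
  case/andP=> /andP[_ lta]; rewrite nthE2 // eregular_vertex_map szw => reg.
  rewrite /ejoin econtract_edgeE nthE2 // [(a + size E1)%N]addnC del_catr map_cat /E2' -map_del.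
  have uv := contractible_nth adm2 lta reg.
  have /ewfP[_ _ En2 _] := wf2; have /andP[vu vv] := En2 _ (mem_nth edefault lta).
  rewrite econtract_edgeE /=; congr (_ *: eclass R (EPreGraph _ _ (_ ++ _))).
  - by rewrite [(size E1 + a.+1)%N]addnS.
  - by case: (r2) (contractible_gt0 uv vu vv) => // m _; rewrite addnS.
  - by apply: (map_eedge_id_in valid1) => x vx; apply: identify_eshift_id.
  by rewrite !map_eedge_comp; apply: eq_map_eedge => x /=; apply: identify_eshift.
rewrite big_split /= scalerDr; congr (_ + _).
  rewrite exchange_big scaler_sumr /= big_nat_cond [RHS]big_nat_cond.
  apply: eq_bigr => a /andP[/andP[_ lta] reg]; rewrite -scaler_sumr /eshuffle_graph !scalerA.
  rewrite econtract_edgeE /elambda /eshuffles /= size_map size_del //.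
  (* The join has [size c2] more external vertices than [G1], which compensates the drop of
     [elambda] when [E1] loses an edge. *)
  congr (_ *: _); rewrite -!exprD; apply: signr_eq_odd; case: (size E1) lta => // m _.
  rewrite mulnS !oddD !oddM /=; move: (odd a) (odd m) (odd (size c1)) (odd (size c2)).
  by do 4!case.
rewrite exchange_big !scaler_sumr /=; apply: eq_bigr => a _.
rewrite -scaler_sumr /eshuffle_graph !scalerA econtract_edgeE /elambda /eshuffles /=.
(* Here [elambda] is unchanged: [size E1] comes from the shift of edge labels and [size c1] from the
   additional external vertices. *)
congr (_ *: _); rewrite /edegree /= -!exprD; apply: signr_eq_odd.
rewrite !oddD !oddM /=.
by move: (odd a) (odd (size E1)) (odd (size c1)) (odd (size c2)); do 4!case.
Qed.

End EvenLeibniz.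

Lemma eleibniz_graph (R : realType) (G1 G2 : egraph) :
  edelta (eshuffle_graph R G1 G2) =
  eshuffle (edelta_graph R G1) (qclass (@erel R) << G2 >>) +
  (-1) ^+ edegree G1 *: eshuffle (qclass (@erel R) << G1 >>) (edelta_graph R G2).
Proof.
have dB := ecompatible_kills (edelta_compatible R).
have gBl (G : egraph) := ecompatible_kills (eshuffle_compatiblel R (valP G)).
have gBr (G : egraph) := ecompatible_kills (eshuffle_compatibler R (valP G)).
have dlin : linear (@edelta R) by apply: qext_linear.
have ml z : linear (fun x : eD R => eshuffle x z).
  exact: (qext2_linearl (g := fun G G' : egraph => eshuffle_graph R G G') gBl gBr).
have mr z : linear (fun y : eD R => eshuffle z y).
  exact: (qext2_linearr (g := fun G G' : egraph => eshuffle_graph R G G') gBl gBr).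
have dU (P : epregraph) : ewf P -> edelta (eclass R P) = edelta_graph R P.
  by move=> wfP; rewrite (eclassE R (EGraph wfP)) /edelta qext_class // lextU.
have mU (P Q : egraph) : eshuffle (eclass R P) (eclass R Q) = eshuffle_graph R P Q.
  rewrite !eclassE.
  exact: (qext2U (g := fun G G' : egraph => eshuffle_graph R G G') gBl gBr).
rewrite -!eclassE.
(* All terms vanish when a factor is inadmissible. *)
have [adm1|nadm1] := boolP (eadmissible G1); last first.
  rewrite -mU eclass_inadmissible // /edelta_graph (negPf nadm1).
  by rewrite !(linear_0 (ml _)) (linear_0 dlin) scaler0 addr0.
have [adm2|nadm2] := boolP (eadmissible G2); last first.
  rewrite -mU [eclass R G2]eclass_inadmissible // {2}/edelta_graph (negPf nadm2).
  by rewrite !(linear_0 (mr _)) (linear_0 dlin) scaler0 addr0.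
have wf1 : ewf G1 := valP G1; have wf2 : ewf G2 := valP G2.
have dE (P : epregraph) : eadmissible P -> edelta_graph R P =
    \sum_(a <- arcs (ecirc P)) (-1) ^+ contraction_sign a.1 a.2 *:
       eclass R (econtract_arc a.1 a.2 P) +
    \sum_(0 <= a < size (eedges P) | eregular (nth edefault (eedges P) a))
       (-1) ^+ (a.+1 + 1 + size (ecirc P)) *: eclass R (econtract_edge a P).
  by rewrite /edelta_graph => ->.
have mPl P : ewf P -> eshuffle (eclass R P) (eclass R G2) = eshuffle_graph R P G2.
  by move=> wfP; apply: (mU (EGraph wfP)).
have mPr P : ewf P -> eshuffle (eclass R G1) (eclass R P) = eshuffle_graph R G1 P.
  by move=> wfP; apply: (mU _ (EGraph wfP)).
have mlD z x y : eshuffle (x + y) z = eshuffle x z + eshuffle y z :> eD R.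
  by have := ml z 1 x y; rewrite !scale1r.
have mrD z x y : eshuffle z (x + y) = eshuffle z x + eshuffle z y :> eD R.
  by have := mr z 1 x y; rewrite !scale1r.
rewrite (dE _ adm1) (dE _ adm2).
rewrite mlD mrD !(linear_sum_scale (ml _)) !(linear_sum_scale (mr _)).
transitivity ((-1) ^+ elambda G1 G2 *: \sum_(w <- eshuffles G1 G2)
    edelta_graph R (ejoin G1 G2 w)).
  rewrite /eshuffle_graph; under eq_bigr do rewrite -[eclass _ _]scale1r.
  rewrite -[_ *: _]addr0 dlin (linear_0 dlin) addr0; congr (_ *: _).
  rewrite (linear_sum_scale dlin) big_seq [RHS]big_seq; apply: eq_bigr => w w_sh.
  rewrite scale1r dU //; case: G1 G2 w_sh {adm1 adm2 wf1 wf2 mPl mPr}.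
  by move=> [c1 r1 E1] wf1 [[c2 r2 E2] wf2]; apply: ewf_eshuffle.
have lhsE (w : seq nat) : w \in eshuffles G1 G2 -> edelta_graph R (ejoin G1 G2 w) =
    \sum_(a <- arcs w) (-1) ^+ contraction_sign a.1 a.2 *:
       eclass R (econtract_arc a.1 a.2 (ejoin G1 G2 w)) +
    \sum_(0 <= a < size (eedges (ejoin G1 G2 w)) |
          eregular (nth edefault (eedges (ejoin G1 G2 w)) a))
       (-1) ^+ (a.+1 + 1 + size w) *: eclass R (econtract_edge a (ejoin G1 G2 w)).
  move=> w_sh; apply: dE; move: wf1 wf2 adm1 adm2 {w_sh}.
  case: (egraph_val G1) => c1 r1 E1; case: (egraph_val G2) => c2 r2 E2 w1 w2 a1 a2.
  by rewrite eadmissible_ejoin // a1 a2.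
rewrite big_seq (eq_bigr _ lhsE) -big_seq big_split /= !scalerDr addrACA; congr (_ + _).
  transitivity (\sum_(a <- arcs (ecirc G1)) (-1) ^+ contraction_sign a.1 a.2 *:
      eshuffle_graph R (econtract_arc a.1 a.2 G1) G2 +
    (-1) ^+ edegree G1 *: \sum_(a <- arcs (ecirc G2)) (-1) ^+ contraction_sign a.1 a.2 *:
      eshuffle_graph R G1 (econtract_arc a.1 a.2 G2)).
    move: wf1 wf2; case: (egraph_val G1) => c1 r1 E1; case: (egraph_val G2) => c2 r2 E2.
    exact: edelta_ejoin_arcs.
  congr (_ + _ *: _); rewrite big_seq [RHS]big_seq; apply: eq_bigr => -[i j] aij /=.
    by rewrite mPl // ewf_econtract_arc.
  by rewrite mPr // ewf_econtract_arc.
transitivity (\sum_(0 <= a < size (eedges G1) | eregular (nth edefault (eedges G1) a))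
    (-1) ^+ (a.+1 + 1 + size (ecirc G1)) *: eshuffle_graph R (econtract_edge a G1) G2 +
  (-1) ^+ edegree G1 *:
    \sum_(0 <= a < size (eedges G2) | eregular (nth edefault (eedges G2) a))
    (-1) ^+ (a.+1 + 1 + size (ecirc G2)) *: eshuffle_graph R G1 (econtract_edge a G2)).
  move: wf1 wf2 adm1 adm2.
  case: (egraph_val G1) => c1 r1 E1; case: (egraph_val G2) => c2 r2 E2.
  exact: edelta_ejoin_edges.
congr (_ + _ *: _); rewrite [LHS]big_nat_cond [RHS]big_nat_cond;
  apply: eq_bigr => a /andP[/andP[_ lta] reg].
  by rewrite mPl // ewf_econtract_edge.
by rewrite mPr // ewf_econtract_edge.
Qed.

Lemma eleibniz (R : realType) p (x y : eD R) : ehomogeneous p x ->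
  edelta (eshuffle x y) = eshuffle (edelta x) y + (-1) ^+ p *: eshuffle x (edelta y).
Proof.
apply: (leibniz_extension (f := fun G : egraph => edelta_graph R G)
  (g := fun G G' : egraph => eshuffle_graph R G G')).
- exact: ecompatible_kills (edelta_compatible R).
- by move=> G; apply: ecompatible_kills (eshuffle_compatiblel R (valP G)).
- by move=> G; apply: ecompatible_kills (eshuffle_compatibler R (valP G)).
exact: eleibniz_graph.
Qed.

Theorem proposition3p1 (R : realType) :
  (forall (p : nat) (x y : oD R), ohomogeneous p x ->
     odelta (oshuffle x y) =
       oshuffle (odelta x) y + (-1) ^+ p *: oshuffle x (odelta y)) /\
  (forall (p : nat) (x y : eD R), ehomogeneous p x ->
     edelta (eshuffle x y) =
       eshuffle (edelta x) y + (-1) ^+ p *: eshuffle x (edelta y)).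
Proof.
split=> p x y hx; [exact: oleibniz|exact: eleibniz].
Qed.
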